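(* Let $N\ge 2$, let $\Omega\subset\mathbb{R}^N$ be a bounded Lipschitz domain, let $\alpha>0$, $0<s<1<p<\infty$, $\delta\in(0,1)$, let $H$ be a Finsler--Minkowski norm on $\mathbb{R}^N$, and let $w\in A_p^t$ with $t\in I$. Let $f\in L^m(\Omega)\setminus\{0\}$ be a nonnegative function, where $m$ is the exponent defined in the context, and let $u_\delta\in W_0^{1,p}(\Omega,w)$ be the unique weak solution of $$\mathcal{M}_\alpha u=f(x)u^{-\delta}\ \text{in }\Omega,\qquad u>0\ \text{in }\Omega,\qquad u=0\ \text{in }\mathbb{R}^N\setminus\Omega.$$ Then the following hold. (a) (Extremal property) $$\Theta(\Omega):=\inf_{v\in W_0^{1,p}(\Omega,w)\setminus\{0\}}\Big\{\int_\Omega H(\nabla v)^p\,w\,dx+\alpha\int_{\mathbb{R}^N}\int_{\mathbb{R}^N}|v(x)-v(y)|^p\,d\mu:\ \int_\Omega|v|^{1-\delta}f\,dx=1\Big\}$$ $$=\Big(\int_\Omega H(\nabla u_\delta)^p\,w\,dx+\alpha\int_{\mathbb{R}^N}\int_{\mathbb{R}^N}|u_\delta(x)-u_\delta(y)|^p\,d\mu\Big)^{\frac{1-\delta-p}{1-\delta}}.$$ (b) (Weighted anisotropic and nonlocal Sobolev-type inequality) For a constant $C$, the inequality $$C\Big(\int_\Omega|v|^{1-\delta}f\,dx\Big)^{\frac p{1-\delta}}\le\int_\Omega H(\nabla v)^p\,w\,dx+\alpha\int_{\mathbb{R}^N}\int_{\mathbb{R}^N}|v(x)-v(y)|^p\,d\mu$$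 holds for every $v\in W_0^{1,p}(\Omega,w)$ if and only if $C\le\Theta(\Omega)$. (c) (Simplicity of extremals) If $v\in W_0^{1,p}(\Omega,w)$ satisfies $$\Theta(\Omega)\Big(\int_\Omega|v|^{1-\delta}f\,dx\Big)^{\frac p{1-\delta}}=\int_\Omega H(\nabla v)^p\,w\,dx+\alpha\int_{\mathbb{R}^N}\int_{\mathbb{R}^N}|v(x)-v(y)|^p\,d\mu,$$ then there exists a constant $k\in\mathbb{R}$ such that $v=ku_\delta$.
   Context: Finsler--Minkowski norm: a function $H:\mathbb{R}^N\to[0,\infty)$, $H\in C^1(\mathbb{R}^N\setminus\{0\})$, which is convex with strictly convex unit ball (i.e. $H(\xi+\eta)<H(\xi)+H(\eta)$ unless one of $\xi,\eta$ is a nonnegative multiple of the other), satisfies $H(\xi)=0\iff\xi=0$, $H(t\xi)=|t|H(\xi)$ for all $t\in\mathbb{R}$, $\xi\in\mathbb{R}^N$, and $c_1|\xi|\le H(\xi)\le c_2|\xi|$ for some constants $c_1,c_2>0$. $\nabla H(\nabla u)$ denotes the gradient of $H$ evaluated at $\nabla u(x)$; $H(\xi)^{p-1}\nabla H(\xi):=0$ at $\xi=0$. Weights: a weight is $w\in L^1_{\mathrm{loc}}(\mathbb{R}^N)$ with $0<w<\infty$ a.e. It belongs to $A_p$ if there is $C>0$ with $\big(\frac1{|B|}\int_B w\,dx\big)\big(\frac1{|B|}\int_B w^{-1/(p-1)}dx\big)^{p-1}\le C$ for every ball $B\subset\mathbb{R}^N$. Let $I:=(\frac1{p-1},\infty)\cap(\frac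 Np,\infty)$. We write $w\in A_p^t$, $t\in I$, if $w\in A_p$ and $w^{-t}\in L^1(\Omega)$. Put $p_t:=\frac{pt}{t+1}\in[1,p)$ and $p_t^*:=\frac{Np_t}{N-p_t}$ if $p_t<N$. The exponent $m$ is: $m=\big(\frac{p_t^*}{1-\delta}\big)'$ if $1\le p_t<N$; $m=l$ for some $l>1$ if $p_t=N$; $m=1$ if $p_t>N$; here $l'=l/(l-1)$. Nonlocal measure: $w(B):=\int_B w\,dx$, $B_{x,y}$ is the open ball with center $\frac{x+y}2$ and radius $\frac{|x-y|}2$, $K(x,y):=\frac{w(x)w(y)}{w(B_{x,y})}$, and $d\mu:=\frac{K(x,y)}{|x-y|^{sp}}\,dx\,dy$ on $\mathbb{R}^N\times\mathbb{R}^N$. $J_p(\tau):=|\tau|^{p-2}\tau$ for $\tau\in\mathbb{R}$ (with $J_p(0)=0$). Space: $W_0^{1,p}(\Omega,w)$ is the closure of $C_c^\infty(\Omega)$ (functions extended by zero outside $\Omega$) with respect to the norm $\|u\|:=\Big(\int_\Omega H(\nabla u)^p\,w\,dx+\alpha\int_{\mathbb{R}^N}\int_{\mathbb{R}^N}|u(x)-u(y)|^p\,d\mu\Big)^{1/p}$. Operator: $\mathcal{M}_\alpha u=-\mathrm{div}\big(w\,H(\nabla u)^{p-1}\nabla H(\nabla u)\big)+\alpha\,\mathrm{P.V.}\int_{\mathbb{R}^N}\frac{J_p(u(x)-u(y))}{|x-y|^{sp}}K(x,y)\,dy$, understood in the following weak sense. Weak solution: $u\in W_0^{1,p}(\Omega,w)$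 is a weak solution of the problem if (1) for every compactly contained $\omega\Subset\Omega$ there is a constant $C(\omega)>0$ with $u\ge C(\omega)$ a.e. in $\omega$; and (2) for every $\varphi\in C_c^1(\Omega)$, $$\int_\Omega H(\nabla u)^{p-1}\nabla H(\nabla u)\cdot\nabla\varphi\,w\,dx+\alpha\int_{\mathbb{R}^N}\int_{\mathbb{R}^N}J_p(u(x)-u(y))(\varphi(x)-\varphi(y))\,d\mu=\int_\Omega f\,u^{-\delta}\varphi\,dx.$$ Under the hypotheses of the claim such a weak solution exists and is unique. *)

(* Defs.v *)
From HB Require Import structures.
From mathcomp Require Import all_boot all_order all_algebra.
From mathcomp Require Import all_classical all_reals all_analysis.

Set Implicit Arguments.
Unset Strict Implicit.
Unset Printing Implicit Defensive.
Import Order.TTheory GRing.Theory Num.Theory.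
Import numFieldNormedType.Exports.
Local Open Scope classical_set_scope.
Local Open Scope ring_scope.

(* 'rV[T]_n carries the sigma-algebra generated by the coordinates; for
   T := R : realType this is the Borel sigma-algebra of R^n. *)
Definition measure_rV_display : measure_display -> measure_display.
Proof. exact. Qed.

Section measurable_rV.
Context {d} {T : measurableType d}.
Variable n : nat.

Let coors : 'I_n -> 'rV[T]_n -> T := fun i x => x ord0 i.

Let rV_set0 : g_sigma_preimage coors set0.
Proof. exact: sigma_algebra0. Qed.

Let rV_setC A : g_sigma_preimage coors A -> g_sigma_preimage coors (~` A).
Proof. exact: sigma_algebraC. Qed.

Let rV_bigcup (F : _^nat) : (forall i, g_sigma_preimage coors (F i)) ->
  g_sigma_preimage coors (\bigcup_i (F i)).
Proof. exact: sigma_algebra_bigcup. Qed.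

HB.instance Definition _ := @isMeasurable.Build (measure_rV_display d)
  'rV[T]_n (g_sigma_preimage coors) rV_set0 rV_setC rV_bigcup.

End measurable_rV.

Lemma measurable_coord d (T : measurableType d) n (i : 'I_n) :
  measurable_fun [set: 'rV[T]_n] (fun x => x ord0 i).
Proof.
move=> _ Y mY; rewrite setTI; apply: sub_sigma_algebra => /=.
rewrite -bigcup_seq/=; exists i => /=; first by rewrite mem_index_enum.
by exists Y => //; rewrite setTI.
Qed.

Lemma measurable_fun_coordP d1 d2 (T1 : measurableType d1)
    (T2 : measurableType d2) n (f : T1 -> 'rV[T2]_n) :
  measurable_fun [set: T1] f <->
  forall i, measurable_fun [set: T1] (fun x => f x ord0 i).
Proof.
apply: (@iff_trans _ (g_sigma_preimage
    (fun i => (fun v : 'rV[T2]_n => v ord0 i) \o f) `<=` measurable)).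
  rewrite g_sigma_preimage_comp; split=> [mf A [/= C preC <-]|prefS].
    exact: mf.
  by move=> _ A mA; apply: prefS; exists A.
split=> [mcf i|mf].
- move=> _ A mA.
  apply: mcf; apply: sub_sigma_algebra.
  case: n i => [[] []//|n i] in f *.
  rewrite -bigcup_mkord_ord.
  exists i; first exact: ltn_ord.
  by exists A => //; rewrite inord_val.
- apply: smallest_sub; first exact: sigma_algebra_measurable.
  case: n => [|n] in f mf *; first by rewrite big_ord0.
  rewrite -bigcup_mkord_ord; apply: bigcup_sub => i Ii.
  by move=> A [B mB <-]; exact: mf.
Qed.

Section lebesgue_rV.
Context {R : realType}.

Definition rV_cons n (z : R * 'rV[R]_n) : 'rV[R]_n.+1 :=
  \row_i if unlift ord0 i is Some j then z.2 ord0 j else z.1.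

Lemma rV_cons0 n (z : R * 'rV[R]_n) : rV_cons z ord0 ord0 = z.1.
Proof. by rewrite mxE unlift_none. Qed.

Lemma rV_consS n (z : R * 'rV[R]_n) i :
  rV_cons z ord0 (lift ord0 i) = z.2 ord0 i.
Proof. by rewrite mxE liftK. Qed.

Lemma measurable_rV_cons n : measurable_fun [set: R * 'rV[R]_n] (@rV_cons n).
Proof.
apply/measurable_fun_coordP => i; case: (unliftP ord0 i) => [j|] ->.
  apply: (eq_measurable_fun (fun z : R * 'rV[R]_n => z.2 ord0 j)).
    by move=> z _; rewrite rV_consS.
  apply: (measurableT_comp (measurable_coord j)); exact: measurable_snd.
apply: (eq_measurable_fun (fun z : R * 'rV[R]_n => z.1)).
  by move=> z _; rewrite rV_cons0.
exact: measurable_fst.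
Qed.

Definition rV_uncons n (x : 'rV[R]_n.+1) : R * 'rV[R]_n :=
  (x ord0 ord0, \row_i x ord0 (lift ord0 i)).

Lemma rV_consK n : cancel (@rV_cons n) (@rV_uncons n).
Proof.
move=> [a v]; rewrite /rV_uncons rV_cons0; congr (_, _).
by apply/rowP => i; rewrite mxE rV_consS.
Qed.

Lemma measurable_rV_uncons n : measurable_fun [set: 'rV[R]_n.+1] (@rV_uncons n).
Proof.
apply: measurable_fun_pair; first exact: measurable_coord.
apply/measurable_fun_coordP => i.
apply: (eq_measurable_fun (fun x : 'rV[R]_n.+1 => x ord0 (lift ord0 i))).
  by move=> x _; rewrite /= mxE.
exact: measurable_coord.
Qed.

Section step.
Variables (n : nat) (m : {sigma_finite_measure set 'rV[R]_n -> \bar R}).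

Definition lebesgue_rV_step : set 'rV[R]_n.+1 -> \bar R :=
  pushforward (lebesgue_measure \x m)%E (@rV_cons n).

Let nu0 : lebesgue_rV_step set0 = 0%E.
Proof. by rewrite /lebesgue_rV_step /pushforward preimage_set0 measure0. Qed.

Let nu_ge0 A : (0 <= lebesgue_rV_step A)%E.
Proof. by rewrite /lebesgue_rV_step /pushforward measure_ge0. Qed.

Let nu_sigma : semi_sigma_additive lebesgue_rV_step.
Proof.
move=> F mF tF mUF; rewrite /lebesgue_rV_step /pushforward preimage_bigcup.
have mpre B : measurable B -> measurable (@rV_cons n @^-1` B).
  by move=> mB; rewrite -[X in measurable X]setTI; exact: measurable_rV_cons.
apply: measure_semi_sigma_additive; first by move=> k; exact: mpre.
- apply/trivIsetP => i j _ _ ij; rewrite -preimage_setI.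
  by move/trivIsetP : tF => /(_ _ _ I I ij) ->; rewrite preimage_set0.
- by rewrite -preimage_bigcup; exact: mpre.
Qed.

HB.instance Definition _ := isMeasure.Build _ _ _ lebesgue_rV_step
  nu0 nu_ge0 nu_sigma.

Let nu_sigma_finite : sigma_finite setT lebesgue_rV_step.
Proof.
have /sigma_finiteP[F [TF ndF Foo]] := sigma_finiteT (@lebesgue_measure R).
have /sigma_finiteP[G [TG ndG Goo]] := sigma_finiteT m.
exists (fun k => @rV_uncons n @^-1` (F k `*` G k)).
  apply/esym; rewrite -subTset => x _.
  have [i _ Fi] : (\bigcup_i F i) (rV_uncons x).1 by rewrite -TF.
  have [j _ Gj] : (\bigcup_i G i) (rV_uncons x).2 by rewrite -TG.
  exists (maxn i j) => //; split.
  - by move: Fi; exact/subsetPset/ndF/leq_maxl.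
  - by move: Gj; exact/subsetPset/ndG/leq_maxr.
move=> k; have [mF Fk] := Foo k; have [mG Gk] := Goo k.
split.
  rewrite -[X in measurable X]setTI; apply: measurable_rV_uncons => //.
  exact: measurableX.
rewrite /lebesgue_rV_step /pushforward -comp_preimage.
rewrite (_ : _ \o _ = id) ?preimage_id; last first.
  by apply/funext => z /=; rewrite rV_consK.
by rewrite product_measure1E// lte_mul_pinfty// ge0_fin_numE.
Qed.

HB.instance Definition _ := Measure_isSigmaFinite.Build _ _ _ lebesgue_rV_step
  nu_sigma_finite.

End step.

(* n-fold product of the one-dimensional Lebesgue measure; lebesgue_rV_box
   computes it on boxes, which determines it. *)
Fixpoint lebesgue_rV n : {sigma_finite_measure set 'rV[R]_n -> \bar R} :=
  if n is n'.+1 then lebesgue_rV_step (lebesgue_rV n') else \d_(0 : 'rV[R]_0).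

Lemma lebesgue_rV_box n (A : 'I_n -> set R) : (forall i, measurable (A i)) ->
  lebesgue_rV n [set x | forall i, A i (x ord0 i)] =
  (\prod_(i < n) lebesgue_measure (A i))%E.
Proof.
elim: n A => [|n IH] A mA.
  by rewrite big_ord0 /= diracE mem_set//= => -[].
have mbox : measurable
    [set x : 'rV[R]_n | forall i, A (lift ord0 i) (x ord0 i)].
  rewrite (_ : mkset _ = \bigcap_(i in [set: 'I_n])
      ((fun x : 'rV[R]_n => x ord0 i) @^-1` A (lift ord0 i))); last first.
    by apply/seteqP; split => [x xA i _|x xA i]; [exact: xA|exact: xA].
  apply: fin_bigcap_measurable => // i _.
  by rewrite -[X in measurable X]setTI; exact: measurable_coord.
rewrite big_ord_recl -IH // -product_measure1E//=; last exact: mA.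
rewrite /lebesgue_rV_step /pushforward; congr (_ _).
apply/seteqP; split => [z zA|z [z1 z2] i].
  split; first by have := zA ord0; rewrite rV_cons0.
  by move=> i; have := zA (lift ord0 i); rewrite rV_consS.
by case: (unliftP ord0 i) => [k|] ->; rewrite ?rV_cons0 ?rV_consS.
Qed.
End lebesgue_rV.

(* The norm that the library puts on 'rV[R]_N is the sup norm. It induces the
   usual topology, but |x| and the balls below are Euclidean. *)
Section euclidean.
Context {R : realType} {N : nat}.
Implicit Types (x y c : 'rV[R]_N) (r : R).

Definition dotr x y : R := \sum_(i < N) x ord0 i * y ord0 i.

Definition enorm x : R := Num.sqrt (dotr x x).

Definition eball c r : set 'rV[R]_N := [set x | enorm (x - c) < r].

End euclidean.

(* Near each boundary point, Omega is the strict epigraph of a Lipschitz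
   function gamma in the direction e. Only the values of gamma on the hyperplane
   orthogonal to e matter, and a Lipschitz function there extends to R^N. *)
Definition lipschitz_boundary (R : realType) (N : nat) (Omega : set 'rV[R]_N) :=
  forall x0, (closure Omega `\` interior Omega) x0 ->
  exists (r L : R) (e : 'rV[R]_N) (gamma : 'rV[R]_N -> R),
    [/\ 0 < r, enorm e = 1,
        forall y z, `|gamma y - gamma z| <= L * enorm (y - z) &
        forall x, eball x0 r x ->
          (Omega x <-> gamma (x - dotr x e *: e) < dotr x e)].

Definition bounded_lipschitz_domain (R : realType) (N : nat)
    (Omega : set 'rV[R]_N) :=
  [/\ open Omega, connected Omega, Omega !=set0, bounded_set Omega &
      lipschitz_boundary Omega].

Section differential_calculus.
Context {R : realType} {N : nat}.
Implicit Types (f phi : 'rV[R]_N -> R) (x : 'rV[R]_N) (U Omega : set 'rV[R]_N).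

Definition partial (i : 'I_N) f : 'rV[R]_N -> R :=
  fun x => 'D_(delta_mx ord0 i) f x.

Definition grad f x : 'rV[R]_N := \row_i partial i f x.

Definition C1_on U f := forall x, U x -> forall i : 'I_N,
  derivable f x (delta_mx ord0 i) /\ {for x, continuous (partial i f)}.

Definition smooth f := forall s : seq 'I_N, C1_on setT (foldr partial f s).

Definition compactly_supported_in Omega f :=
  compact (closure [set x | f x != 0]) /\ closure [set x | f x != 0] `<=` Omega.

Definition Cc1 Omega : set ('rV[R]_N -> R) :=
  [set phi | C1_on setT phi /\ compactly_supported_in Omega phi].

Definition Ccoo Omega : set ('rV[R]_N -> R) :=
  [set phi | smooth phi /\ compactly_supported_in Omega phi].

End differential_calculus.

Definition finsler_minkowski (R : realType) (N : nat) (H : 'rV[R]_N -> R) :=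
  (forall xi, 0 <= H xi) /\
  C1_on [set xi | xi != 0] H /\
  convex_function setT H /\
  (forall xi eta,
      ~ (exists2 k, 0 <= k & xi = k *: eta \/ eta = k *: xi) ->
      H (xi + eta) < H xi + H eta) /\
  (forall xi, H xi = 0 <-> xi = 0) /\
  (forall (k : R) xi, H (k *: xi) = `|k| * H xi) /\
  (exists c1 c2 : R, [/\ 0 < c1, 0 < c2 &
      forall xi, c1 * enorm xi <= H xi <= c2 * enorm xi]).

(* The admissible exponents m; a relation because any l > 1 is allowed when
   p_t = N. *)
Definition datum_exponent (R : realType) (N : nat) (p t delta m : R) :=
  let pt := p * t / (t + 1) in
  let conjugate l := l / (l - 1) in
  let pt_star := N%:R * pt / (N%:R - pt) in
  [\/ 1 <= pt < N%:R /\ m = conjugate (pt_star / (1 - delta)),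
      pt = N%:R /\ 1 < m | N%:R < pt /\ m = 1].

Section weights.
Context {R : realType} {N : nat}.
Local Notation mu := (@lebesgue_rV R N).
Implicit Types (w u : 'rV[R]_N -> R) (Omega B : set 'rV[R]_N) (p t s : R).

Definition loc_integrable Omega u := forall K, compact K -> K `<=` Omega ->
  mu.-integrable K (EFin \o u).

Definition weight w :=
  loc_integrable setT w /\ {ae mu, forall x, 0 < w x}.

Definition average B u : \bar R :=
  (((fine (mu B))^-1)%R%:E * \int[mu]_(x in B) (u x)%:E)%E.

Definition muckenhoupt p w := weight w /\
  exists2 C : R, 0 < C & forall (c : 'rV[R]_N) (r : R), 0 < r ->
    (average (eball c r) w *
     average (eball c r) (fun x => (w x `^ (- (p - 1)^-1))%R) `^ (p - 1)
       <= C%:E)%E.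

(* w \in A_p^t, including the requirement t \in I. *)
Definition muckenhoupt_t Omega p t w :=
  [/\ (p - 1)^-1 < t, N%:R / p < t, muckenhoupt p w &
      mu.-integrable Omega (fun x => (w x `^ (- t))%:E)].

Definition in_Lp Omega (m : R) (f : 'rV[R]_N -> R) :=
  measurable_fun Omega f /\
  (\int[mu]_(x in Omega) (`|f x| `^ m)%:E < +oo)%E.

(* w(B_{x,y}) is the denominator; the diagonal x = y, where it vanishes, is
   Lebesgue-null. *)
Definition kernelK w (x y : 'rV[R]_N) : R :=
  w x * w y / \int[mu]_(z in eball (2^-1 *: (x + y)) (enorm (x - y) / 2)) w z.

(* Density of d mu with respect to dx dy. *)
Definition nonlocal_density w s p (z : 'rV[R]_N * 'rV[R]_N) : R :=
  kernelK w z.1 z.2 / enorm (z.1 - z.2) `^ (s * p).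

End weights.

Section sobolev.
Context {R : realType} {N : nat}.
Local Notation mu := (@lebesgue_rV R N).
Implicit Types (u v phi w H : 'rV[R]_N -> R) (Omega : set 'rV[R]_N).

Definition weak_gradient Omega u (g : 'rV[R]_N -> 'rV[R]_N) :=
  loc_integrable Omega u /\ forall i : 'I_N,
    loc_integrable Omega (fun x => g x ord0 i) /\
    forall phi, Ccoo Omega phi ->
      \int[mu]_(x in Omega) (u x * partial i phi x) =
      - \int[mu]_(x in Omega) (g x ord0 i * phi x).

(* A version of the weak gradient of u in Omega, well defined up to null sets
   (and 0 when u has no weak gradient). *)
Definition wgrad Omega u : 'rV[R]_N -> 'rV[R]_N :=
  xget (fun=> 0) (weak_gradient Omega u).

Variables (Omega : set 'rV[R]_N) (p s alpha : R) (H w : 'rV[R]_N -> R).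

Definition energy v : \bar R :=
  (\int[mu]_(x in Omega) (H (wgrad Omega v x) `^ p * w x)%:E +
   alpha%:E * \int[mu \x mu]_z
     (`|v z.1 - v z.2| `^ p * nonlocal_density w s p z)%:E)%E.

Definition energy_norm v : \bar R := (energy v `^ p^-1)%E.

(* Closure of Ccoo Omega for energy_norm, taken inside the functions that have a
   weak gradient in Omega, vanish outside Omega and have finite norm. Elements
   are Borel representatives defined on the whole of R^N. *)
Definition W0 : set ('rV[R]_N -> R) := [set v : 'rV[R]_N -> R |
  [/\ measurable_fun setT v,
      {ae mu, forall x, ~ Omega x -> v x = 0},
      exists g, weak_gradient Omega v g,
      (energy_norm v < +oo)%E &
      forall eps : R, 0 < eps ->
        exists2 phi, Ccoo Omega phi & (energy_norm (v \- phi)%R < eps%:E)%E]].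

Definition ae_zero v := {ae mu, forall x, v x = 0}.

Definition Jp (tau : R) : R := `|tau| `^ (p - 2) * tau.

(* H(xi)^(p-1) grad H(xi); it is 0 at xi = 0, since H(0) = 0 and 0 `^ (p-1) = 0. *)
Definition flux (xi : 'rV[R]_N) : 'rV[R]_N := H xi `^ (p - 1) *: grad H xi.

Variables (delta : R) (f : 'rV[R]_N -> R).

Definition weak_solution u :=
  [/\ W0 u,
      forall omega : set 'rV[R]_N,
        compact (closure omega) -> closure omega `<=` Omega ->
        exists2 C : R, 0 < C & {ae mu, forall x, omega x -> C <= u x} &
      forall phi, Cc1 Omega phi ->
        \int[mu]_(x in Omega) (dotr (flux (wgrad Omega u x)) (grad phi x) * w x)
        + alpha * \int[(mu \x mu)%E]_z
            (Jp (u z.1 - u z.2) * (phi z.1 - phi z.2) * nonlocal_density w s p z)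
        = \int[mu]_(x in Omega) (f x * u x `^ (- delta) * phi x)].

Definition singular_mass v : \bar R :=
  (\int[mu]_(x in Omega) (`|v x| `^ (1 - delta) * f x)%:E)%E.

Definition Theta : \bar R := ereal_inf [set energy v | v in
  [set v : 'rV[R]_N -> R | [/\ W0 v, ~ ae_zero v & singular_mass v = 1%E]]].

End sobolev.

(* Main.v *)
(* Write E for the energy and M(v) for the integral of |v|^(1-delta) f. Testing the
   equation of u with regularized absolute values of smooth approximations of v, then
   applying Young's inequality and Fatou's lemma, gives
     int f u^(-delta) |v| + int int gap(u, v) <= (1 - 1/p) E(u) + (1/p) E(v),
   where gap >= 0 is the deficit in Young's inequality for the nonlocal term. With
   v = u, and with the equation tested by approximations of u, E(u) = M(u) =: S.
   If E(v) = S, concavity of the power 1 - delta,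
     |v|^(1-delta) <= delta u^(1-delta) + (1-delta) u^(-delta) |v|,
   yields M(v) + (1-delta) int int gap <= S; by scaling,
     S^((1-delta-p)/(1-delta)) M(v)^(p/(1-delta)) <= E(v) for every v.
   In the case of equality the gap vanishes, hence |v|(x) - |v|(y) = u(x) - u(y) and
   v(x) v(y) >= 0 for almost all x and y. Fixing x outside Omega gives |v| = u, and
   fixing x inside Omega shows that v has constant sign. *)
From HB Require Import structures.
From mathcomp Require Import all_boot all_order all_algebra.
From mathcomp Require Import all_classical all_reals all_analysis.
From mathcomp Require Import measurable_realfun ring lra.
Require Import Defs.

Set Implicit Arguments.
Unset Strict Implicit.
Unset Printing Implicit Defensive.
Import Order.TTheory GRing.Theory Num.Theory.
Import numFieldNormedType.Exports.
Local Open Scope classical_set_scope.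
Local Open Scope ring_scope.

(** * Topology and measurability of R^N *)

(** The weak form holds only for compactly supported C^1 test functions, whereas the comparison
    needs it for |v| with v a mere limit in the energy norm. The integrability of f u^(-delta) |v|
    is not known beforehand; it comes out of the equation, since Young's inequality bounds both
    pairings by energies and Fatou carries the bound to the limit. Fatou yields only M(u) <= E(u)
    for v = u, so the reverse inequality needs a separate quantitative approximation. Absolute
    values are tested because the mass sees only |v|; increments of |v| are at most those of v, so
    the energy of v stays on the right. Of the two Young deficits the nonlocal one is carried
    through the limit: its vanishing links almost all pairs of points at once, including points
    outside Omega, where every function is 0. The same freezing of an outer point replaces a
    Poincare inequality when energy convergence is turned into convergence a.e. The exponent of S
    comes from normalization: c u with c = S^(-1/(1-delta)) has mass 1 and energy c^p S =
    S^((1-delta-p)/(1-delta)). *)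

Section rV_topology.
Context {R : realType} {N : nat}.
Local Notation mu := (@lebesgue_rV R N).
Implicit Types (x y c : 'rV[R]_N) (U : set 'rV[R]_N).

Lemma measurable_box (A : 'I_N -> set R) : (forall i, measurable (A i)) ->
  measurable [set x : 'rV[R]_N | forall i, A i (x ord0 i)].
Proof.
move=> mA; rewrite (_ : mkset _ = \bigcap_(i in [set: 'I_N])
    ((fun x : 'rV[R]_N => x ord0 i) @^-1` A i)); last first.
  by apply/seteqP; split => [x xA i _|x xA i]; [exact: xA|exact: xA].
apply: fin_bigcap_measurable => // i _.
by rewrite -[X in measurable X]setTI; exact: measurable_coord.
Qed.

Lemma rV_ballE x e y : 0 < e -> ball x e y <-> forall i, `|x ord0 i - y ord0 i| < e.
Proof.
move=> e0; split => [[_ xy] i|xy]; first exact: xy.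
by split => // i j; rewrite ord1; exact: xy.
Qed.

(** The sigma-algebra is generated by the coordinates rather than by open sets, so open sets must be
    reached through countably many boxes: rational centres and radii [1/(n+1)]. The second cube is
    closed because compact boxes inside [U] are extracted from it later. *)
Lemma rV_open_rat_cube U x : open U -> U x ->
  exists (q : 'rV[rat]_N) (n : nat),
    (forall i, `|ratr (q ord0 i) - x ord0 i| < n.+1%:R^-1) /\
    (forall y, (forall i, `|ratr (q ord0 i) - y ord0 i| <= n.+1%:R^-1) -> U y).
Proof.
move=> oU Ux; have /nbhs_ballP[e /= e0 eU] : nbhs x U by exact: open_nbhs_nbhs.
(* The centre will be within [1/(n+1)] of [x], so a radius below [e / 2] keeps the whole cube within
   [e] of [x]. *)
have [n ne] : exists n : nat, n.+1%:R^-1 < e / 2.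
  have [n _ nP] := near_infty_natSinv_lt (PosNum (divr_gt0 e0 (ltr0n R 2))).
  by exists n; apply: nP => /=.
have /choice[q qP] : forall i : 'I_N, exists r : rat, `|ratr r - x ord0 i| < n.+1%:R^-1.
  move=> i; have [r] := @rat_in_itvoo R (x ord0 i - n.+1%:R^-1) (x ord0 i + n.+1%:R^-1)
    ltac:(by rewrite ltrD2l gtrN ?invr_gt0).
  by rewrite in_itv/= => rP; exists r; rewrite ltr_distl.
exists (\row_i q i), n; split => [i|y yP]; first by rewrite mxE.
apply: eU; apply/rV_ballE => // i.
rewrite (le_lt_trans (ler_distD (ratr (q i)) _ _))//.
rewrite (splitr e) distrC ltrD//; first exact: lt_trans ne.
by have := yP i; rewrite mxE => /le_lt_trans; exact.
Qed.

Lemma open_measurable_rV U : open U -> measurable U.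
Proof.
move=> oU.
pose box (z : 'rV[rat]_N * nat) := [set x : 'rV[R]_N | forall i,
  `|ratr (z.1 ord0 i) - x ord0 i| < z.2.+1%:R^-1].
rewrite (_ : U = \bigcup_(z : 'rV[rat]_N * nat) (if `[< box z `<=` U >] then box z else set0)).
  apply: countable_bigcupT_measurable => [|z]; first exact: countableP.
  case: ifPn => // _; apply: (@measurable_box (fun i => [set r : R | `|ratr (z.1 ord0 i) - r| < z.2.+1%:R^-1])) => i.
  rewrite [X in measurable X](_ : _ = ball (ratr (z.1 ord0 i) : R) z.2.+1%:R^-1) //.
  by rewrite ball_itv; exact: measurable_itv.
apply/seteqP; split => [x Ux|x [z _]]; last by case: asboolP => // + zx; exact.
have [q [n [qx qU]]] := rV_open_rat_cube oU Ux.
exists (q, n) => //; rewrite asboolT// => y yq; apply: qU => i; exact/ltW/yq.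
Qed.

Lemma closed_measurable_rV U : closed U -> measurable U.
Proof.
move=> cU; rewrite -(setCK U); apply: measurableC; apply: open_measurable_rV.
exact: closed_openC.
Qed.

Lemma compact_measurable_rV U : compact U -> measurable U.
Proof.
move=> cU; apply: closed_measurable_rV; exact: compact_closed.
Qed.

(** Continuity is asked only on an open [U] because the partial derivatives of [H] are continuous
    only away from 0. *)
Lemma measurable_fun_continuous_on U (h : 'rV[R]_N -> R) : open U ->
  (forall x, U x -> {for x, continuous h}) -> measurable_fun U h.
Proof.
move=> oU ch; apply: (measurability _ (RGenOInfty.measurableE R)) => _ [_ [a ->] <-].
apply: open_measurable_rV; rewrite openE => x [Ux]; rewrite /= in_itv/= andbT => ax.
apply: filterI; first exact: open_nbhs_nbhs.
have := ch x Ux; move/(_ `]a, +oo[%classic); apply.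
apply: open_nbhs_nbhs; split; first exact: interval_open.
by rewrite /= in_itv/= andbT.
Qed.

Lemma continuous_measurable_rV (h : 'rV[R]_N -> R) : continuous h -> measurable_fun setT h.
Proof. by move=> ch; apply: (measurable_fun_continuous_on openT) => x _; exact: ch. Qed.

Lemma compact_cube (M : R) : compact [set x : 'rV[R]_N | forall i, `|x ord0 i| <= M].
Proof.
rewrite (_ : mkset _ = [set x : 'rV[R]_N | forall i, `[- M, M]%classic (x ord0 i)]).
  apply: (rV_compact (A := fun=> `[- M, M]%classic)) => i; exact: segment_compact.
by apply/seteqP; split => x xM i; have := xM i; rewrite /= in_itv/= ler_norml.
Qed.

Lemma lebesgue_rV_cube_fin (M : R) :
  (mu [set x : 'rV[R]_N | forall i, (`|x ord0 i| <= M)%R] < +oo)%E.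
Proof.
rewrite (_ : mkset _ = [set x : 'rV[R]_N | forall i, `[- M, M]%classic (x ord0 i)]); last first.
  by apply/seteqP; split => x xM i; have := xM i; rewrite /= in_itv/= ler_norml.
rewrite (@lebesgue_rV_box _ _ (fun=> `[- M, M]%classic)); last by move=> i; exact: measurable_itv.
rewrite (eq_bigr (fun=> (fine (lebesgue_measure `[- M, M]%classic))%:E)) ?prodEFin ?ltry//.
by move=> i _; rewrite fineK// lebesgue_measure_itv; case: ifP.
Qed.

Lemma bounded_set_cube U : bounded_set U ->
  exists M : R, forall x, U x -> forall i, `|x ord0 i| <= M.
Proof.
move=> [M [_ MU]]; exists (M + 1) => x Ux i.
have := MU (M + 1) _ x Ux; rewrite ltrDl ltr01 => /(_ isT) xM.
apply: le_trans xM; rewrite /= -[`|x|]/(mx_norm x) mx_normrE.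
exact: (le_bigmax _ (fun ij : 'I_1 * 'I_N => `|x ij.1 ij.2|) (ord0, i)).
Qed.

Lemma compact_lebesgue_fin U : compact U -> (mu U < +oo)%E.
Proof.
move=> cU; have [M UM] := bounded_set_cube (compact_bounded cU).
apply: le_lt_trans (lebesgue_rV_cube_fin M).
apply: le_measure; rewrite ?inE.
- exact: compact_measurable_rV.
- apply: compact_measurable_rV; exact: compact_cube.
- exact: UM.
Qed.

Lemma lebesgue_rV_open_cube_gt0 c (e : R) : 0 < e ->
  (0 < mu [set x : 'rV[R]_N | forall i, (`|c ord0 i - x ord0 i| < e)%R])%E.
Proof.
move=> e0; rewrite (_ : mkset _ = [set x : 'rV[R]_N | forall i, (ball (c ord0 i) e) (x ord0 i)])//.
rewrite (@lebesgue_rV_box _ _ (fun i => ball (c ord0 i) e)); last by move=> i; rewrite ball_itv; exact: measurable_itv.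
rewrite (eq_bigr (fun=> (e *+ 2)%:E)); last first.
  by move=> i _; rewrite lebesgue_measure_ball// ltW.
by rewrite prodEFin lte_fin; apply: prodr_gt0 => i _; rewrite pmulrn_lgt0.
Qed.

Lemma open_lebesgue_gt0 U : open U -> U !=set0 -> (0 < mu U)%E.
Proof.
move=> oU [x Ux]; have [q [n [_ qU]]] := rV_open_rat_cube oU Ux.
have n0 : 0 < n.+1%:R^-1 :> R by rewrite invr_gt0.
pose c : 'rV[R]_N := \row_i ratr (q ord0 i).
apply: lt_le_trans (lebesgue_rV_open_cube_gt0 c n0) _.
apply: le_measure; rewrite ?inE.
- apply: (@measurable_box (fun i => ball (c ord0 i) n.+1%:R^-1)) => i; exact: measurable_ball.
- exact: open_measurable_rV.
- by move=> y yc; apply: qU => i; have := yc i; rewrite mxE => /ltW.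
Qed.

End rV_topology.

(** * Continuously differentiable and smooth functions *)

Section C1_functions.
Context {R : realType} {N : nat}.
Local Notation mu := (@lebesgue_rV R N).
Implicit Types (x y v : 'rV[R]_N) (f g : 'rV[R]_N -> R) (U Omega : set 'rV[R]_N).

Lemma rV_continuousD f g : continuous f -> continuous g -> continuous (fun x => f x + g x).
Proof. by move=> cf cg x; have h := cvgD (cf x) (cg x); exact: h. Qed.

Lemma rV_continuousB f g : continuous f -> continuous g -> continuous (fun x => f x - g x).
Proof. by move=> cf cg x; have h := cvgB (cf x) (cg x); exact: h. Qed.

Lemma rV_continuousM f g : continuous f -> continuous g -> continuous (fun x => f x * g x).
Proof. by move=> cf cg x; have h := cvgM (cf x) (cg x); exact: h. Qed.

Lemma rV_continuous_cst (c : R) : continuous (fun _ : 'rV[R]_N => c).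
Proof. by move=> x; have h := cvg_cst c (F := nbhs x); exact: h. Qed.

Lemma line_quotientE x v (t : R) f :
  (fun h : R => h^-1 *: (f (h *: v + (x + t *: v)) - f (x + t *: v))) =
  (fun h : R => h^-1 *: (f (x + (h *: (1 : R) + t) *: v) - f (x + t *: v))).
Proof.
by apply/funext => h; rewrite -[h *: (1 : R)]/(h * 1) mulr1 scalerDl addrCA.
Qed.

(** Both derivatives are limits of the same difference quotient. Through this equivalence the mean
    value theorem and the chain rule of one variable apply to directional derivatives. *)
Lemma is_derive_line x v (t : R) f (l : R) :
  is_derive (x + t *: v) v f l <-> is_derive t (1 : R) (fun h : R => f (x + h *: v)) l.
Proof.
split=> -[df <-]; constructor.
- by move: df; rewrite /derivable/= line_quotientE.
- by rewrite /derive line_quotientE.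
- by rewrite /derivable/= line_quotientE.
- by rewrite /derive line_quotientE.
Qed.

Lemma is_derive_line0 x v f (l : R) :
  is_derive x v f l <-> is_derive (0 : R) (1 : R) (fun h : R => f (x + h *: v)) l.
Proof. by rewrite -is_derive_line scale0r addr0. Qed.

Lemma is_derive_comp1 x v (h : R -> R) f (a b : R) :
  is_derive (f x) (1 : R) h a -> is_derive x v f b -> is_derive x v (h \o f) (a * b).
Proof.
move=> hh /is_derive_line0 hf; apply/is_derive_line0.
apply: (@is_derive1_comp _ h (fun t : R => f (x + t *: v)) 0 a b) => //.
by rewrite scale0r addr0.
Qed.

(** The mean value theorem on the segment between 0 and [d]; the symmetric condition [|t| <= |d|]
    covers both signs of [d]. *)
Lemma mvt_bound (h dh : R -> R) (d M : R) :
  (forall t, `|t| <= `|d| -> is_derive t (1 : R) h (dh t)) ->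
  (forall t, `|t| <= `|d| -> `|dh t| <= M) -> `|h d - h 0| <= M * `|d|.
Proof.
move=> hd hM.
have cont a b : (forall t, t \in `[a, b] -> `|t| <= `|d|) -> {within `[a, b], continuous h}.
  move=> ab; apply: continuous_in_subspaceT => t; rewrite inE => /ab td.
  have [dht _] := hd t td.
  by apply: differentiable_continuous; apply/derivable1_diffP.
have [d0|d0] := leP 0 d.
- have tP t : t \in `[0, d] -> `|t| <= `|d|.
    by rewrite in_itv/= => /andP[t0 td]; rewrite !ger0_norm.
  have [t|c /tP cd ->] := @MVT_segment _ h dh 0 d d0 _ (cont _ _ tP).
    by rewrite in_itv/= => /andP[/ltW t0 /ltW td]; apply: hd; apply: tP; rewrite in_itv/= t0.
  by rewrite subr0 normrM ler_wpM2r// hM.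
- have tP t : t \in `[d, 0] -> `|t| <= `|d|.
    by rewrite in_itv/= => /andP[t0 td]; rewrite !ler0_norm ?lerN2 // ltW.
  have [t|c /tP cd] := @MVT_segment _ h dh d 0 (ltW d0) _ (cont _ _ tP).
    by rewrite in_itv/= => /andP[/ltW t0 /ltW td]; apply: hd; apply: tP; rewrite in_itv/= t0.
  by rewrite distrC => ->; rewrite sub0r normrM normrN ler_wpM2r// hM.
Qed.

Lemma C1_is_derive f i : C1_on setT f -> forall x,
  is_derive x (delta_mx ord0 i) f (partial i f x).
Proof. by move=> Cf x; have [dfx _] := Cf x I i; constructor. Qed.

Lemma C1_partial_continuous f i : C1_on setT f -> continuous (partial i f).
Proof. by move=> Cf x; have [] := Cf x I i. Qed.

(* Moving from x to y one coordinate at a time keeps the path in the sup-norm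
   ball, where each partial derivative is bounded. *)
Lemma C1_continuous f : C1_on setT f -> continuous f.
Proof.
move=> Cf x.
pose M := \big[Num.max/0]_(i < N) `|partial i f x| + 1.
have [r /= r0 rM] : exists2 r : R, 0 < r & forall y, ball x r y -> forall i, `|partial i f y| <= M.
  have : \forall y \near x, forall i, `|partial i f y| <= M.
    apply: (filter_forall (f := fun i => [set y | `|partial i f y| <= M]) (F := nbhs x)) => i.
    have /cvgr_norm_le := @C1_partial_continuous f i Cf x; apply.
    by apply: le_lt_trans (le_bigmax 0 (fun j => `|partial j f x|) i) _; rewrite ltrDl.
  by move/nbhs_ballP => [r r0 rP]; exists r.
have M0 : 0 <= M by rewrite addr_ge0// bigmax_ge_id.
have lip y : ball x r y -> `|f y - f x| <= \sum_(i < N) M * `|y ord0 i - x ord0 i|.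
  move=> /(rV_ballE _ _ r0) xy.
  pose z (k : nat) : 'rV[R]_N := \row_i if (i < k)%N then y ord0 i else x ord0 i.
  have -> : f y = f (z N) by congr f; apply/rowP => i; rewrite mxE ltn_ord.
  have -> : f x = f (z 0) by congr f; apply/rowP => i; rewrite mxE.
  rewrite -(telescope_sumr (f \o z) (leq0n N)) big_mkord.
  apply: le_trans (ler_norm_sum _ _ _) _; apply: ler_sum => k _ /=.
  have zS : z k.+1 = z k + (y ord0 k - x ord0 k) *: delta_mx ord0 k.
    apply/rowP => i; rewrite !mxE eqxx/=; have [->|ik] := eqVneq i k.
      by rewrite ltnS leqnn ltnn mulr1 addrC subrK.
    by rewrite mulr0 addr0 ltnS leq_eqVlt (negbTE (_ : (nat_of_ord i != k))).
  have := @mvt_bound (fun t => f (z k + t *: delta_mx ord0 k))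
     (fun t => partial k f (z k + t *: delta_mx ord0 k)) (y ord0 k - x ord0 k) M.
  rewrite scale0r addr0 -zS; apply => t td.
    by apply/is_derive_line; exact: C1_is_derive.
  apply: rM; apply/rV_ballE => // i; rewrite !mxE eqxx/=.
  have [->|ik] := eqVneq i k.
    rewrite ltnn mulr1 opprD addNKr normrN (le_lt_trans td)// distrC; exact: xy.
  by rewrite mulr0 addr0; case: ifP => _; [exact: xy|rewrite subrr normr0].
have FF : Filter (nbhs x) := @nbhs_filter 'rV[R]_N x.
apply/cvgrPdist_le => e e0.
(* The denominators are shifted to stay positive, also for [N = 0]; each of the [N] increments then
   contributes at most [e / N.+1]. *)
have N0 : 0 < N.+1%:R * (M + 1) :> R by rewrite mulr_gt0 ?ltr0n// ltr_pwDr.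
apply/(@nbhs_ballP R 'rV[R]_N x); exists (Num.min r (e / (N.+1%:R * (M + 1)))) => /=.
  by rewrite lt_min r0 divr_gt0.
move=> y xy; rewrite distrC; apply: le_trans (lip y _) _.
  by apply: le_ball xy; rewrite ge_min lexx.
apply: (@le_trans _ _ (\sum_(i < N) e / N.+1%:R)); last first.
  rewrite sumr_const card_ord -[X in X <= _](mulr_natr (e / N.+1%:R : R)) -mulrA.
  by rewrite ler_piMr ?(ltW e0)// mulrC ler_pdivrMr ?ltr0n// mul1r ler_nat.
apply: ler_sum => i _.
have -> : e / N.+1%:R = (M + 1) * (e / (N.+1%:R * (M + 1))).
  by field; rewrite ?pnatr_eq0 ?gt_eqF// ltr_pwDr.
have : ball x (e / (N.+1%:R * (M + 1))) y.
  by apply: le_ball xy; rewrite ge_min lexx orbT.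
move=> /(rV_ballE _ _ (divr_gt0 e0 N0))/(_ i)/ltW xyi.
by apply: ler_pM => //; [rewrite lerDl|rewrite distrC].
Qed.

End C1_functions.

Section smooth_functions.
Context {R : realType} {N : nat}.
Implicit Types (f g : 'rV[R]_N -> R).

(** Truncating the order makes induction possible: a partial of a product is a sum of products that
    are smooth to one order less, whereas [smooth] has no order to decrease. *)
Definition smooth_upto (k : nat) f :=
  forall s : seq 'I_N, (size s <= k)%N -> C1_on setT (foldr partial f s).

Lemma smooth_uptoP f : smooth f <-> forall k, smooth_upto k f.
Proof. by split => [sf k s _|sf s]; [exact: sf|exact: (sf (size s))]. Qed.

Lemma smooth_upto_C1 k f : smooth_upto k f -> C1_on setT f.
Proof. by move=> /(_ [::]); exact. Qed.

(** In [foldr partial f s] the last entry of [s] is the derivative taken first, so peeling [s] from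
    the right replaces [f] by one of its partials. *)
Lemma smooth_uptoS k f : smooth_upto k.+1 f <->
  C1_on setT f /\ forall i, smooth_upto k (partial i f).
Proof.
split=> [sf|[Cf sf] s].
  split; first exact: smooth_upto_C1 sf.
  by move=> i s sk; have := sf (rcons s i); rewrite size_rcons foldr_rcons; exact.
case: (lastP s) => [//|s' i]; rewrite size_rcons foldr_rcons ltnS; exact: sf.
Qed.

Lemma smooth_uptoW k f : smooth_upto k.+1 f -> smooth_upto k f.
Proof. by move=> sf s sk; apply: sf; exact: leqW. Qed.

Lemma partialD i f g : C1_on setT f -> C1_on setT g ->
  partial i (f + g) = partial i f + partial i g.
Proof.
move=> Cf Cg; apply/funext => x; rewrite /partial deriveD//.
  by have [] := Cf x I i.
by have [] := Cg x I i.
Qed.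

Lemma partialM i f g : C1_on setT f -> C1_on setT g ->
  partial i (f * g) = f * partial i g + g * partial i f.
Proof.
move=> Cf Cg; apply/funext => x; rewrite /partial deriveM//.
  by have [] := Cf x I i.
by have [] := Cg x I i.
Qed.

Lemma partialZ i (c : R) f : C1_on setT f ->
  partial i (fun x => c * f x) = (fun x => c * partial i f x).
Proof.
move=> Cf; apply/funext => x; rewrite /partial.
by rewrite (deriveMl c); have [] := Cf x I i.
Qed.

Lemma C1D f g : C1_on setT f -> C1_on setT g -> C1_on setT (f + g).
Proof.
move=> Cf Cg x _ i; rewrite partialD//; have [df cf] := Cf x I i; have [dg cg] := Cg x I i.
by split; [exact: (derivableD df dg)|exact: (continuousD cf cg)].
Qed.

Lemma C1M f g : C1_on setT f -> C1_on setT g -> C1_on setT (f * g).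
Proof.
move=> Cf Cg x _ i; rewrite partialM//; have [df cf] := Cf x I i; have [dg cg] := Cg x I i.
split; first exact: (derivableM df dg).
have h1 := cvgM (C1_continuous Cf (x := x)) cg; have h2 := cvgM (C1_continuous Cg (x := x)) cf.
exact: (cvgD (h1 _) (h2 _)).
Qed.

Lemma smooth_uptoD k f g : smooth_upto k f -> smooth_upto k g -> smooth_upto k (f + g).
Proof.
elim: k f g => [|k IH] f g.
  move=> sf sg [|//] _; exact: C1D (smooth_upto_C1 sf) (smooth_upto_C1 sg).
move=> /smooth_uptoS[Cf sf] /smooth_uptoS[Cg sg]; apply/smooth_uptoS; split; first exact: C1D.
by move=> i; rewrite (partialD i Cf Cg); exact: (IH _ _ (sf i) (sg i)).
Qed.

Lemma smooth_uptoM k f g : smooth_upto k f -> smooth_upto k g -> smooth_upto k (f * g).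
Proof.
elim: k f g => [|k IH] f g.
  by move=> sf sg [|//] _; exact: C1M (smooth_upto_C1 sf) (smooth_upto_C1 sg).
move=> sf sg; have /smooth_uptoS[Cf dsf] := sf; have /smooth_uptoS[Cg dsg] := sg.
apply/smooth_uptoS; split; first exact: C1M.
move=> i; rewrite (partialM i Cf Cg); apply: smooth_uptoD.
  exact: (IH _ _ (smooth_uptoW sf) (dsg i)).
exact: (IH _ _ (smooth_uptoW sg) (dsf i)).
Qed.

Lemma smooth_C1 f : smooth f -> C1_on setT f.
Proof. by move=> /(_ [::]). Qed.

Lemma smoothD f g : smooth f -> smooth g -> smooth (f + g).
Proof.
by move=> /smooth_uptoP sf /smooth_uptoP sg; apply/smooth_uptoP => k; exact: smooth_uptoD.
Qed.

Lemma smoothM f g : smooth f -> smooth g -> smooth (f * g).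
Proof.
by move=> /smooth_uptoP sf /smooth_uptoP sg; apply/smooth_uptoP => k; exact: smooth_uptoM.
Qed.

Lemma C1_cst (c : R) : C1_on setT (cst c : 'rV[R]_N -> R).
Proof.
move=> x _ i; split; first exact: derivable_cst.
rewrite (_ : partial i _ = cst 0); first exact: cst_continuous.
by apply/funext => y; rewrite /partial derive_cst.
Qed.

Lemma smooth_cst (c : R) : smooth (cst c : 'rV[R]_N -> R).
Proof.
apply/smooth_uptoP => k; elim: k c => [|k IH] c; first by move=> [|//] _; exact: C1_cst.
apply/smooth_uptoS; split; first exact: C1_cst.
move=> i; rewrite (_ : partial i _ = cst 0); first exact: IH.
by apply/funext => y; rewrite /partial derive_cst.
Qed.

Lemma smoothZ (c : R) f : smooth f -> smooth (fun x => c * f x).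
Proof. exact: smoothM (smooth_cst c). Qed.

Lemma smooth_prod (I : Type) (r : seq I) (F : I -> 'rV[R]_N -> R) :
  (forall i, smooth (F i)) -> smooth (fun x => \prod_(i <- r) F i x).
Proof.
move=> sF; elim: r => [|i r IH].
  rewrite (_ : (fun _ => _) = cst 1); first exact: smooth_cst.
  by apply/funext => x; rewrite big_nil.
rewrite (_ : (fun _ => _) = F i * (fun x => \prod_(i <- r) F i x)); first exact: smoothM.
by apply/funext => x; rewrite big_cons.
Qed.

End smooth_functions.

(** * Integration by parts *)

Section integration_by_parts.
Context {R : realType}.
Local Notation mu := (@lebesgue_rV R).

Lemma partial_near0 N (g : 'rV[R]_N -> R) i x :
  (\forall y \near x, g y = 0) -> partial i g x = 0.
Proof.
move=> gx; rewrite /partial (_ : 'D_(delta_mx ord0 i) g x = 'D_(delta_mx ord0 i) (cst 0) x).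
  by rewrite derive_cst.
exact: near_eq_derive.
Qed.

(** The bound becomes strict because the argument needs [g] to be zero on a whole neighbourhood of
    the point. *)
Lemma partial_eq0_off_cube N (g : 'rV[R]_N -> R) (M : R) i :
  (forall (x : 'rV[R]_N) j, M <= `|x ord0 j| -> g x = 0) ->
  forall (x : 'rV[R]_N) j, M < `|x ord0 j| -> partial i g x = 0.
Proof.
move=> gM x j Mx; apply: partial_near0; apply/(@nbhs_ballP R 'rV[R]_N x).
exists (`|x ord0 j| - M) => /=; first by rewrite subr_gt0.
move=> y /rV_ballE; rewrite subr_gt0 => /(_ Mx j) xy; apply: (gM y j).
have := ler_distD 0 (x ord0 j) (y ord0 j); rewrite !subr0.
by have := lerB_dist (x ord0 j) (y ord0 j); lra.
Qed.

Lemma continuous_bounded_on_compact N (h : 'rV[R]_N -> R) (K : set 'rV[R]_N) :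
  continuous h -> compact K -> exists C : R, forall x, K x -> `|h x| <= C.
Proof.
move=> ch cK; have : compact (h @` K).
  by apply: continuous_compact => //; exact: continuous_subspaceT.
move=> /compact_bounded[M [_ hM]]; exists (M + 1) => x Kx.
by apply: (hM (M + 1)); rewrite ?ltrDl//; exists x.
Qed.

Lemma continuous_compact_integrable N (h : 'rV[R]_N -> R) (K : set 'rV[R]_N) :
  continuous h -> compact K -> (mu N).-integrable K (EFin \o h).
Proof.
move=> ch cK; apply: measurable_bounded_integrable.
- exact: compact_measurable_rV.
- exact: compact_lebesgue_fin.
- by apply: measurable_funTS; exact: continuous_measurable_rV.
- have [C hC] := continuous_bounded_on_compact ch cK.
  exists C; split; first exact: num_real.
  by move=> C' CC' x Kx /=; rewrite (le_trans (hC x Kx))// ltW.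
Qed.

Lemma continuous_support_integrable N (h : 'rV[R]_N -> R) (K D : set 'rV[R]_N) :
  continuous h -> compact K -> (forall x, ~ K x -> h x = 0) -> measurable D ->
  (mu N).-integrable D (EFin \o h).
Proof.
move=> ch cK hK mD; apply: (@integrableS _ _ _ _ setT) => //.
rewrite (_ : EFin \o h = (EFin \o h) \_ K).
  have mK : measurable K by exact: compact_measurable_rV.
  by apply/(integrable_mkcond _ mK); exact: continuous_compact_integrable.
apply/funext => x; rewrite patchE; case: ifPn => //.
by rewrite notin_setE => /hK /= ->.
Qed.

Lemma cons_delta0 n (a : R) (v : 'rV[R]_n) :
  rV_cons (a, v) = rV_cons (0, v) + a *: delta_mx ord0 ord0.
Proof.
apply/rowP => i; rewrite !mxE; case: unliftP => [j|] ->/=.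
  by rewrite mulr0 addr0.
by rewrite mulr1 add0r.
Qed.

Lemma cons_deltaS n (a : R) (v : 'rV[R]_n) j (t : R) :
  rV_cons (a, v + t *: delta_mx ord0 j) =
  rV_cons (a, v) + t *: delta_mx ord0 (lift ord0 j).
Proof.
apply/rowP => i; rewrite !mxE; case: unliftP => [k|] ->/=.
  by rewrite !mxE /= (inj_eq lift_inj).
by rewrite mulr0 addr0.
Qed.

Lemma is_derive_cons0 n (g : 'rV[R]_n.+1 -> R) v (a : R) : C1_on setT g ->
  is_derive a (1 : R) (fun a => g (rV_cons (a, v))) (partial ord0 g (rV_cons (a, v))).
Proof.
move=> Cg; rewrite (_ : (fun a => _) =
  fun a => g (rV_cons (0, v) + a *: delta_mx ord0 ord0)).
  by rewrite cons_delta0; apply/is_derive_line; exact: C1_is_derive.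
by apply/funext => b; rewrite cons_delta0.
Qed.

Lemma is_derive_consS n (g : 'rV[R]_n.+1 -> R) v (a : R) j : C1_on setT g ->
  is_derive v (delta_mx ord0 j) (fun v => g (rV_cons (a, v)))
    (partial (lift ord0 j) g (rV_cons (a, v))).
Proof.
move=> Cg; apply/is_derive_line0; rewrite (_ : (fun h => _) =
  fun t => g (rV_cons (a, v) + t *: delta_mx ord0 (lift ord0 j))).
  by apply/is_derive_line0; exact: C1_is_derive.
by apply/funext => t; rewrite cons_deltaS.
Qed.

Lemma continuous_cons n (a : R) : continuous (fun v : 'rV[R]_n => rV_cons (a, v)).
Proof.
move=> v; apply/(@cvg_ballP R 'rV[R]_n.+1); first exact: (@nbhs_filter 'rV[R]_n v).
move=> e e0; apply/(@nbhs_ballP R 'rV[R]_n v); exists e => //= y /(rV_ballE _ _ e0) vy.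
apply/(rV_ballE _ _ e0) => i; case: (unliftP ord0 i) => [k|] ->.
  by rewrite !rV_consS.
by rewrite !rV_cons0 subrr normr0.
Qed.

Lemma continuous_cons0 n (v : 'rV[R]_n) : continuous (fun a : R => rV_cons (a, v)).
Proof.
move=> a; apply/(@cvg_ballP R 'rV[R]_n.+1) => e e0.
apply/nbhs_ballP; exists e => //= b ab.
apply/(rV_ballE _ _ e0) => i; case: (unliftP ord0 i) => [k|] ->.
  by rewrite !rV_consS subrr normr0.
by rewrite !rV_cons0.
Qed.

Lemma C1_cons n (g : 'rV[R]_n.+1 -> R) (a : R) : C1_on setT g ->
  C1_on setT (fun v => g (rV_cons (a, v))) /\
  forall j v, partial j (fun v => g (rV_cons (a, v))) v =
              partial (lift ord0 j) g (rV_cons (a, v)).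
Proof.
move=> Cg; have pE j v : partial j (fun v => g (rV_cons (a, v))) v =
              partial (lift ord0 j) g (rV_cons (a, v)).
  by have [] := is_derive_consS v a j Cg.
split=> // v _ j; split; first by have [] := is_derive_consS v a j Cg.
rewrite (_ : partial j _ = partial (lift ord0 j) g \o (fun v => rV_cons (a, v))).
  by apply: continuous_comp; [exact: continuous_cons|exact: C1_partial_continuous].
by apply/funext => v'; rewrite /= pE.
Qed.

(** The fundamental theorem of calculus on [[-M, M]], both endpoint values of [F] being zero. *)
Lemma integral_derive0 (F dF : R -> R) (M : R) : 0 < M -> continuous dF ->
  (forall a, is_derive a (1 : R) F (dF a)) ->
  (forall a, M <= `|a| -> F a = 0) -> (forall a, M < `|a| -> dF a = 0) ->
  (\int[lebesgue_measure]_a (dF a)%:E = 0)%E.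
Proof.
move=> M0 cdF dFP FM dFM.
have -> : (\int[lebesgue_measure]_a (dF a)%:E =
   \int[lebesgue_measure]_(a in `[(- M)%R, M]) (dF a)%:E)%E.
  rewrite [RHS]integral_mkcond; apply: eq_integral => a _; rewrite patchE.
  case: ifPn => //; rewrite notin_setE /= in_itv/= => /negP; rewrite -ler_norml -ltNge.
  by move=> /dFM ->.
have cF : continuous F.
  by move=> a; apply: differentiable_continuous; apply/derivable1_diffP; have [] := dFP a.
rewrite (@continuous_FTC2 _ dF F (- M) M).
- by rewrite !FM ?subee// ?normrN ger0_norm// ltW.
- by rewrite gtrN.
- exact: continuous_subspaceT.
- split; first by move=> a _; have [] := dFP a.
    by apply: cvg_at_right_filter; exact: cF.
  by apply: cvg_at_left_filter; exact: cF.
- by move=> a _; rewrite derive1E; have [_ ->] := dFP a.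
Qed.

(** [lebesgue_rV n.+1] is by definition a pushforward under [rV_cons], so this is a change of
    variables. Integrability is returned too, since Fubini asks for it on the product. *)
Lemma lebesgue_rVS_integrable n (F : 'rV[R]_n.+1 -> R) :
  measurable_fun setT F -> (mu n.+1).-integrable setT (EFin \o F) ->
  (lebesgue_measure \x mu n)%E.-integrable setT (fun z => (F (rV_cons z))%:E) /\
  (\int[mu n.+1]_x (F x)%:E = \int[lebesgue_measure \x mu n]_z (F (rV_cons z))%:E)%E.
Proof.
move=> mF iF; pose P := (lebesgue_measure \x mu n)%E : measure _ R.
pose mE := (measurable_realfun.measurable_EFinP _ _).2 mF.
have mabs : measurable_fun setT (fun x => `|(F x)%:E|%E) by exact: measurableT_comp mE.
have := fun phi h => @ge0_integral_pushforward _ _ _ _ R phi h P setT _ measurableT mabs.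
move=> /(_ (@rV_cons R n) (@measurable_rV_cons R n)); rewrite preimage_setT => E.
have iF' : P.-integrable setT (fun z => (F (rV_cons z))%:E).
  apply/integrableP; split.
    exact: (measurableT_comp mE (@measurable_rV_cons R n)).
  have /integrableP[_ +] := iF; apply: le_lt_trans; rewrite -E//.
split=> //.
have := fun phi h => @integral_pushforward _ _ _ _ R phi h P setT _ mE.
move=> /(_ (@rV_cons R n) (@measurable_rV_cons R n)); rewrite preimage_setT => ->//.
Qed.

(** Induction on the dimension by Fubini: a derivative in the first coordinate is integrated along
    that coordinate first, any other one over the remaining coordinates first, where the induction
    hypothesis applies to the slice. *)
Lemma integral_partial0 N (g : 'rV[R]_N -> R) (M : R) : C1_on setT g -> 0 < M ->
  (forall (x : 'rV[R]_N) j, M <= `|x ord0 j| -> g x = 0) ->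
  forall i, (\int[mu N]_x (partial i g x)%:E = 0)%E.
Proof.
elim: N g => [|n IH] g Cg M0 gM i; first by case: i.
have cp := C1_partial_continuous (i := i) Cg.
have ip : (mu n.+1).-integrable setT (EFin \o partial i g).
  apply: (continuous_support_integrable cp (@compact_cube R n.+1 M) _ measurableT) => x.
  move=> /existsNP[j /negP]; rewrite -ltNge; exact: partial_eq0_off_cube.
have [ip' ->] := lebesgue_rVS_integrable (continuous_measurable_rV cp) ip.
have [j ij|ij] := unliftP ord0 i; last first.
  rewrite -integral21_prod_meas1//; apply: integral0_eq => v _.
  rewrite /fubini_G/=; apply: (@integral_derive0 (fun a => g (rV_cons (a, v))) _ M) => //.
  - move=> a; apply: (@continuous_comp R 'rV[R]_n.+1 R (fun a => rV_cons (a, v)) (partial i g)).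
      exact: continuous_cons0.
    exact: cp.
  - by move=> a; rewrite ij; exact: is_derive_cons0.
  - by move=> a Ma; apply: (gM _ ord0); rewrite rV_cons0.
  - by move=> a Ma; apply: (partial_eq0_off_cube i gM (j := ord0)); rewrite rV_cons0.
rewrite -integral12_prod_meas1//; apply: integral0_eq => a _.
rewrite /fubini_F/=; have [Cga pE] := C1_cons a Cg.
rewrite -[RHS](IH (fun v => g (rV_cons (a, v))) Cga M0 _ j).
  by apply: eq_integral => v _; rewrite pE ij.
by move=> x k Mx; apply: (gM _ (lift ord0 k)); rewrite rV_consS.
Qed.

End integration_by_parts.

Section compact_supports.
Context {R : realType} {N : nat}.
Local Notation mu := (@lebesgue_rV R N).
Implicit Types (f g : 'rV[R]_N -> R) (Omega : set 'rV[R]_N).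

Lemma csupp_sub Omega f g : compactly_supported_in Omega f ->
  (forall x, f x = 0 -> g x = 0) -> compactly_supported_in Omega g.
Proof.
move=> [cf fO] fg; have gf : closure [set x | g x != 0] `<=` closure [set x | f x != 0].
  by apply: closureS => x /=; apply: contra_neq; exact: fg.
split; last exact: subset_trans gf fO.
by apply: subclosed_compact cf gf; exact: closed_closure.
Qed.

Lemma csuppD Omega f g : compactly_supported_in Omega f ->
  compactly_supported_in Omega g -> compactly_supported_in Omega (f + g).
Proof.
move=> [cf fO] [cg gO].
have fg : closure [set x | (f + g) x != 0] `<=`
          closure [set x | f x != 0] `|` closure [set x | g x != 0].
  rewrite -closureU; apply: closureS => x /=.
  apply: contraPP => /not_orP[/negP/negPn/eqP fx /negP/negPn/eqP gx].
  by rewrite -[(f + g) x]/(f x + g x) fx gx addr0 eqxx.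
split; last by move=> x /fg[/fO|/gO].
by apply: subclosed_compact (compactU cf cg) fg; exact: closed_closure.
Qed.

Lemma support_partial f i x :
  ~ closure [set x | f x != 0] x -> partial i f x = 0.
Proof.
move=> fx; apply: partial_near0.
have : nbhs x (~` closure [set x | f x != 0]).
  by apply: open_nbhs_nbhs; split => //; apply: closed_openC; exact: closed_closure.
apply: filterS => y /= fy; apply: contra_notP fy => /eqP fy; exact: subset_closure.
Qed.

Lemma support_out f x : ~ closure [set x | f x != 0] x -> f x = 0.
Proof. by apply: contra_notP => /eqP fx; exact: subset_closure. Qed.

Lemma csupp_cube Omega f : compactly_supported_in Omega f ->
  exists2 M : R, 0 < M & forall (x : 'rV[R]_N) j, M <= `|x ord0 j| -> f x = 0.
Proof.
move=> [cf _]; have [M fM] := bounded_set_cube (compact_bounded cf).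
exists (Num.max 1 (M + 1)); first by rewrite lt_max ltr01.
move=> x j Mx; apply: support_out => /fM/(_ j) xM.
by move: Mx; rewrite ge_max => /andP[_]; lra.
Qed.

Lemma continuous_csupp_integrable Omega f h : compactly_supported_in Omega f ->
  continuous h -> (forall x, ~ closure [set x | f x != 0] x -> h x = 0) ->
  open Omega -> mu.-integrable Omega (EFin \o h).
Proof.
move=> [cf _] ch hf oO; apply: (continuous_support_integrable ch cf hf).
exact: open_measurable_rV.
Qed.

Lemma loc_integrable_continuous Omega h : continuous h -> loc_integrable Omega h.
Proof. by move=> ch K cK _; exact: continuous_compact_integrable. Qed.

Lemma Rintegral_csupp Omega f h : compactly_supported_in Omega f ->
  (forall x, ~ closure [set x | f x != 0] x -> h x = 0) ->
  \int[mu]_(x in Omega) h x = \int[mu]_x h x.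
Proof.
move=> [_ fO] hf; rewrite Rintegral_mkcond; apply: eq_Rintegral => x _.
rewrite patchE; case: ifPn => //; rewrite notin_setE => Ox.
by rewrite hf// => /fO.
Qed.

(** [phi * psi] vanishes outside a cube because [psi] does, so its partial derivative integrates to
    0 over the whole space; the product rule splits this integral. *)
Lemma integral_by_parts Omega phi psi i : open Omega ->
  C1_on setT phi -> C1_on setT psi -> compactly_supported_in Omega psi ->
  \int[mu]_(x in Omega) (phi x * partial i psi x) =
  - \int[mu]_(x in Omega) (partial i phi x * psi x).
Proof.
move=> oO Cphi Cpsi cpsi; apply/eqP; rewrite -addr_eq0; apply/eqP.
have cphi := C1_continuous Cphi; have cpsi' := C1_continuous Cpsi.
have cdphi := C1_partial_continuous (i := i) Cphi.
have cdpsi := C1_partial_continuous (i := i) Cpsi.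
rewrite -RintegralD.
- rewrite (Rintegral_csupp cpsi); last first.
    by move=> x xpsi; rewrite (support_out xpsi) (support_partial _ xpsi) !mulr0 addr0.
  have [M M0 psiM] := csupp_cube cpsi.
  have phipsiM (x : 'rV[R]_N) j : M <= `|x ord0 j| -> (phi * psi) x = 0.
    by move=> /psiM psix; rewrite -[LHS]/(phi x * psi x) psix mulr0.
  have := integral_partial0 (C1M Cphi Cpsi) M0 phipsiM i; rewrite partialM// => I0.
  rewrite /Rintegral -[RHS]/(fine 0%E) -I0; congr fine; apply: eq_integral => x _.
  by rewrite [X in _ + X]mulrC.
- exact: open_measurable_rV.
- apply: (continuous_csupp_integrable cpsi) => //.
    exact: rV_continuousM.
  by move=> x xpsi; rewrite (support_partial _ xpsi) mulr0.
- apply: (continuous_csupp_integrable cpsi) => //.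
    exact: rV_continuousM.
  by move=> x xpsi; rewrite (support_out xpsi) mulr0.
Qed.

Lemma weak_gradient_grad Omega phi : open Omega -> C1_on setT phi ->
  weak_gradient Omega phi (grad phi).
Proof.
move=> oO Cphi; split; first exact/loc_integrable_continuous/C1_continuous.
move=> i; have gE : (fun x => grad phi x ord0 i) = partial i phi.
  by apply/funext => x; rewrite mxE.
split; first by rewrite gE; exact/loc_integrable_continuous/C1_partial_continuous.
move=> psi [spsi cpsi]; rewrite (integral_by_parts i oO Cphi (smooth_C1 spsi) cpsi).
by congr (- _); apply: eq_Rintegral => x _; rewrite mxE.
Qed.

End compact_supports.

(** * Smooth ramps built from exp(-1/t) *)

Section bump_functions.
Context {R : realType}.

(* The powers of 1/t make the family closed under differentiation, see
   [is_derive_expinv]. *)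
Definition expinv (k : nat) (t : R) : R := if 0 < t then t^-1 ^+ k * expR (- t^-1) else 0.

Lemma expinv_ge0 k t : 0 <= expinv k t.
Proof.
rewrite /expinv; case: ifPn => // t0.
by rewrite mulr_ge0 ?expR_ge0// exprn_ge0// invr_ge0 ltW.
Qed.

(** With s = 1/t this follows from exp s >= 1 + s^(k+1)/(k+1)!. The linear bound makes the
    difference quotients of [expinv] at 0 tend to 0. *)
Lemma expinv_le_lin k t : 0 < t -> expinv k t <= (k.+1)`!%:R * t.
Proof.
move=> t0; rewrite /expinv t0 expRN ler_pdivrMr ?expR_gt0//.
have s0 : 0 < t^-1 by rewrite invr_gt0.
have := expR_ge1Dxn k (ltW s0) => h.
have F0 : 0 < (k.+1)`!%:R :> R by rewrite ltr0n fact_gt0.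
apply: (@le_trans _ _ ((k.+1)`!%:R * t * (t^-1 ^+ k.+1 / (k.+1)`!%:R))); last first.
  by rewrite ler_wpM2l ?mulr_ge0 ?ltW//; lra.
by rewrite exprS -subr_ge0 le_eqVlt eq_sym subr_eq0 (_ : _ == _)//; apply/eqP; field; rewrite gt_eqF//= gt_eqF.
Qed.

Lemma is_derive_expinv k t :
  is_derive t (1 : R) (expinv k) (expinv k.+2 t - k%:R * expinv k.+1 t).
Proof.
have [t0|t0|->] := ltgtP t 0.
- have E : \forall x \near t, cst 0 x = expinv k x.
    near=> x; rewrite /expinv ifF//; apply/negbTE; rewrite -leNgt ltW//.
    by near: x; exact: lt_nbhsl.
  rewrite /expinv !ifF ?mulr0 ?subr0; do ?by apply/negbTE; rewrite -leNgt ltW.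
  by apply: near_eq_is_derive E _; exact: is_derive_cst.
- have dV : is_derive t (1 : R) (fun x : R => x^-1) (- t ^- 2 *: (1 : R)).
    have tn0 : id t != 0 by rewrite gt_eqF.
    exact: (@is_deriveV R id t 1 1 tn0 (is_derive_id t 1)).
  have dX := is_deriveX k dV.
  have dE := @is_derive1_comp _ expR (- (fun x : R => x^-1)) t _ _ (is_derive_expR _) (is_deriveN dV).
  have dM := is_deriveM dX dE.
  have E : \forall x \near t, ((fun x : R => x^-1) ^+ k * (expR \o - (fun x : R => x^-1))) x = expinv k x.
    near=> x; rewrite /expinv ifT; last by near: x; exact: lt_nbhsr.
    by rewrite -[LHS]/(((fun x : R => x^-1) ^+ k) x * expR (- x^-1)) exprfctE.
  apply: (near_eq_is_derive E); apply: (is_derive_eq dM); rewrite /expinv t0 exprfctE.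
  rewrite /GRing.scale/= -exprVn; case: k {dX dM E} => [|k] /=.
    by rewrite expr0 !mul0r mulr0 addr0 subr0 mul1r mulr1 opprK mulrC.
  by rewrite !exprS; ring.
(* At 0 the quotient for [h > 0] is [expinv k.+1 h], hence at most a constant times [h]. The limit 0
   agrees with the claimed formula because every [expinv j 0] is 0. *)
- have C : (fun h : R => h^-1 *: (expinv k (h *: (1 : R) + 0) - expinv k 0)) @ 0^' --> (0 : R).
    apply/cvgrPdist_le => e e0; near=> h.
    rewrite {2}/expinv ltxx subr0 addr0 -[h *: (1 : R)]/(h * 1) mulr1 sub0r normrN.
    have [h0|h0] := leP h 0.
      by rewrite /expinv ifF ?scaler0 ?normr0 ?(ltW e0)//; apply/negbTE; rewrite -leNgt.
    have -> : h^-1 *: expinv k h = expinv k.+1 h.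
      by rewrite /expinv h0 -[LHS]/(h^-1 * _) exprS mulrA.
    rewrite ger0_norm ?expinv_ge0// (le_trans (expinv_le_lin _ h0))//.
    have : `|h| <= e / (k.+2)`!%:R.
      by near: h; apply: dnbhs0_le; rewrite divr_gt0// ltr0n fact_gt0.
    by rewrite gtr0_norm// ler_pdivlMr ?ltr0n ?fact_gt0// mulrC.
  have v0 j : expinv j 0 = 0 by rewrite /expinv ltxx.
  rewrite !v0 mulr0 subr0; constructor; first exact: cvgP C.
  exact: cvg_lim C.
Unshelve. all: by end_near.
Qed.

Lemma continuous_expinv k : continuous (expinv k).
Proof.
move=> t; have [dt _] := is_derive_expinv k t.
by apply: differentiable_continuous; apply/derivable1_diffP.
Qed.

Definition ramp N (i : 'I_N) (c a : R) (k : nat) (x : 'rV[R]_N) : R :=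
  expinv k (c * (x ord0 i - a)).

Lemma is_derive_ramp N (i j : 'I_N) c a k (x : 'rV[R]_N) :
  is_derive x (delta_mx ord0 j) (ramp i c a k)
    ((c * (i == j)%:R) * (ramp i c a k.+2 x - k%:R * ramp i c a k.+1 x)).
Proof.
rewrite mulrC; apply: (is_derive_comp1 (is_derive_expinv _ _)).
apply/is_derive_line0; rewrite (_ : (fun h : R => _) =
    (fun h : R => c * (x ord0 i - a) + (c * (i == j)%:R) * h)); last first.
  by apply/funext => h; rewrite !mxE/=; ring.
have h1 := is_deriveM (is_derive_cst (c * (i == j)%:R) (0 : R) (1 : R)) (is_derive_id (0 : R) (1 : R)).
have h := is_deriveD (is_derive_cst (c * (x ord0 i - a)) (0 : R) (1 : R)) h1.
by apply: (is_derive_eq h); rewrite add0r scaler0 addr0 -[LHS]/(c * (i == j)%:R * 1) mulr1.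
Qed.

Lemma continuous_ramp N (i : 'I_N) c a k : continuous (ramp i c a k).
Proof.
move=> x; apply: (@continuous_comp 'rV[R]_N R R (fun x => c * (x ord0 i - a)) (expinv k)).
  apply: rV_continuousM; first exact: rV_continuous_cst.
  by apply: rV_continuousB; [exact: coord_continuous|exact: rV_continuous_cst].
exact: continuous_expinv.
Qed.

(** Partial derivatives of a ramp are combinations of ramps with larger [k], so the induction on the
    order of differentiation runs over all [k] at once. *)
Lemma smooth_ramp N (i : 'I_N) c a k : smooth (ramp i c a k).
Proof.
have pE k' j : partial j (ramp i c a k') =
    (fun x => (c * (i == j)%:R) * (ramp i c a k'.+2 x - k'%:R * ramp i c a k'.+1 x)).
  by apply/funext => x; have [_ <-] := is_derive_ramp i j c a k' x.
have C1r k' : C1_on setT (ramp i c a k').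
  move=> x _ j; split; first by have [] := is_derive_ramp i j c a k' x.
  rewrite pE; apply: rV_continuousM; first exact: rV_continuous_cst.
  apply: rV_continuousB; first exact: continuous_ramp.
  by apply: rV_continuousM; [exact: rV_continuous_cst|exact: continuous_ramp].
apply/smooth_uptoP => n; elim: n k => [|n IH] k; first by move=> [|//] _; exact: C1r.
apply/smooth_uptoS; split; first exact: C1r.
move=> j; rewrite pE; apply: smooth_uptoM; first exact: (smooth_uptoP _).1 (smooth_cst _) n.
apply: smooth_uptoD; first exact: IH.
rewrite (_ : (fun x => _) = cst (- k%:R) * ramp i c a k.+1).
  by apply: smooth_uptoM; [exact: (smooth_uptoP _).1 (smooth_cst _) n|exact: IH].
by apply/funext => x; rewrite -[RHS]/(- k%:R * _) mulNr.
Qed.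

End bump_functions.

(** * The fundamental lemma of the calculus of variations *)

Section variational_lemma.
Context {R : realType} {N : nat}.
Local Notation mu := (@lebesgue_rV R N).
Implicit Types (h : 'rV[R]_N -> R) (U Omega : set 'rV[R]_N) (a b c : 'rV[R]_N).

Definition obox a b : set 'rV[R]_N := [set x | forall i, a ord0 i < x ord0 i < b ord0 i].

Definition cbox a b : set 'rV[R]_N := [set x | forall i, a ord0 i <= x ord0 i <= b ord0 i].

Lemma obox_cbox a b : obox a b `<=` cbox a b.
Proof. by move=> x xab i; have /andP[/ltW-> /ltW->] := xab i. Qed.

Lemma cbox_compact a b : compact (cbox a b).
Proof.
rewrite (_ : cbox a b = [set x | forall i, `[a ord0 i, b ord0 i]%classic (x ord0 i)]).
  apply: (rV_compact (A := fun i => `[a ord0 i, b ord0 i]%classic)) => i.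
  exact: segment_compact.
by apply/seteqP; split => x xab i; have := xab i; rewrite /= in_itv.
Qed.

Lemma obox_measurable a b : measurable (obox a b).
Proof.
rewrite (_ : obox a b = [set x | forall i, `]a ord0 i, b ord0 i[%classic (x ord0 i)]).
  by apply: (measurable_box (A := fun i => `]a ord0 i, b ord0 i[%classic)) => i; exact: measurable_itv.
by apply/seteqP; split => x xab i; have := xab i; rewrite /= in_itv.
Qed.

Lemma cbox_closed a b : closed (cbox a b).
Proof. by apply: compact_closed; [exact: norm_hausdorff|exact: cbox_compact]. Qed.

Lemma open_box_cover U : open U -> U !=set0 -> exists a b : nat -> 'rV[R]_N,
  (forall n, cbox (a n) (b n) `<=` U) /\ U `<=` \bigcup_n obox (a n) (b n).
Proof.
move=> oU [x0 Ux0].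
pose lo (z : 'rV[rat]_N * nat) : 'rV[R]_N := \row_i (ratr (z.1 ord0 i) - z.2.+1%:R^-1).
pose hi (z : 'rV[rat]_N * nat) : 'rV[R]_N := \row_i (ratr (z.1 ord0 i) + z.2.+1%:R^-1).
have loc x : U x -> exists z, cbox (lo z) (hi z) `<=` U /\ obox (lo z) (hi z) x.
  move=> Ux; have [q [n [qx qU]]] := rV_open_rat_cube oU Ux; exists (q, n); split.
    move=> y yq; apply: qU => i; by have := yq i; rewrite !mxE/= distrC ler_distl.
  by move=> i; rewrite !mxE/= -ltr_distl distrC.
have [z0 [z0U _]] := loc x0 Ux0.
(* Integers that code no box, and boxes not contained in [U], are sent to the default [z0]; a
   default exists because [U] is nonempty. *)
pose F n := if unpickle n is Some z then
  if `[< cbox (lo z) (hi z) `<=` U >] then z else z0 else z0.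
exists (lo \o F), (hi \o F); split.
  by move=> n /=; rewrite /F; case: unpickle => [z|//]; case: asboolP.
move=> x /loc[z [zU zx]]; exists (pickle z) => //=.
by rewrite /F pickleK asboolT.
Qed.

Lemma loc_integrable_measurable Omega h : open Omega -> loc_integrable Omega h ->
  measurable_fun Omega h.
Proof.
move=> oO hi; have [->|/set0P O0] := eqVneq Omega set0; first exact: measurable_fun_set0.
have [a [b [abO Oab]]] := open_box_cover oO O0.
have -> : Omega = \bigcup_n cbox (a n) (b n).
  apply/seteqP; split; last by move=> x [n _ /abO].
  by move=> x /Oab[n _ xn]; exists n => //; exact: obox_cbox.
apply/measurable_fun_bigcup => n.
  by apply: compact_measurable_rV; exact: cbox_compact.
by have /measurable_int/measurable_EFinP := hi _ (@cbox_compact (a n) (b n)) (abO n).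
Qed.

(** Smooth approximations of the indicator of [obox a b]. Each factor has the form exp(-1/((n+1)t)),
    with t the signed distance to a face: it is 0 for t <= 0 and tends to 1 for t > 0. *)
Definition box_bump a b (n : nat) (x : 'rV[R]_N) : R :=
  \prod_(i < N) (ramp i n.+1%:R (a ord0 i) 0 x * ramp i (- n.+1%:R) (b ord0 i) 0 x).

Lemma smooth_box_bump a b n : smooth (box_bump a b n).
Proof. by apply: smooth_prod => i; apply: smoothM; exact: smooth_ramp. Qed.

Lemma expinv0_le1 (t : R) : 0 <= expinv 0 t <= 1.
Proof.
rewrite expinv_ge0/= /expinv; case: ifPn => // t0.
by rewrite expr0 mul1r expR_le1 oppr_le0 invr_ge0 ltW.
Qed.

Lemma expinv0_cvg (t : R) : 0 < t -> expinv 0 (n.+1%:R * t) @[n --> \oo] --> (1 : R).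
Proof.
move=> t0; rewrite (_ : (fun n => _) = (fun n : nat => expR (- (t^-1 * n.+1%:R^-1)))).
  rewrite -[X in _ --> X]expR0; apply: continuous_cvg; first exact: continuous_expR.
  rewrite -[X in _ --> X]oppr0; apply: cvgN; rewrite -(mulr0 t^-1).
  by apply: cvgM; [exact: cvg_cst|exact: cvg_harmonic].
apply/funext => n; rewrite /expinv mulr_gt0 ?ltr0n// expr0 mul1r invfM mulrC//.
Qed.

Lemma box_bump_le1 a b n x : 0 <= box_bump a b n x <= 1.
Proof.
rewrite /box_bump; elim/big_ind : _ => [|u v /andP[u0 u1] /andP[v0 v1]|i _].
- by rewrite ler01 lexx.
- by rewrite mulr_ge0//= mulr_ile1.
- have /andP[u0 u1] := expinv0_le1 (n.+1%:R * (x ord0 i - a ord0 i)).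
  have /andP[v0 v1] := expinv0_le1 (- n.+1%:R * (x ord0 i - b ord0 i)).
  by rewrite mulr_ge0//= mulr_ile1.
Qed.

Lemma box_bump_out a b n x : ~ obox a b x -> box_bump a b n x = 0.
Proof.
move=> /existsNP[i /negP]; rewrite negb_and -!leNgt => xab.
rewrite /box_bump (bigD1 i)//= /ramp /expinv.
case/orP : xab => xab.
  by rewrite ifF ?mul0r//; apply/negbTE; rewrite -leNgt pmulr_rle0 ?ltr0n// subr_le0.
rewrite [X in _ * X * _]ifF ?mulr0 ?mul0r//; apply/negbTE; rewrite -leNgt.
by rewrite mulNr oppr_le0 mulr_ge0// subr_ge0.
Qed.

Lemma cvg_prodr (I : Type) (r : seq I) (F : I -> nat -> R) (L : I -> R) :
  (forall i, F i n @[n --> \oo] --> L i) ->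
  \prod_(i <- r) F i n @[n --> \oo] --> \prod_(i <- r) L i.
Proof.
move=> FL; elim: r => [|i r IH].
  by rewrite big_nil (_ : (fun _ => _) = cst 1); [exact: cvg_cst|apply/funext => n; rewrite big_nil].
rewrite big_cons (_ : (fun _ => _) = (fun n => F i n * \prod_(i <- r) F i n)); first exact: cvgM.
by apply/funext => n; rewrite big_cons.
Qed.

Lemma box_bump_cvg a b x : obox a b x -> box_bump a b n x @[n --> \oo] --> (1 : R).
Proof.
move=> xab; rewrite -[X in _ --> X](@big1_eq R 1 *%R 'I_N (index_enum 'I_N) xpredT).
rewrite /box_bump; apply: cvg_prodr => i.
have /andP[ax xb] := xab i; rewrite -[X in _ --> X]mulr1; apply: cvgM.
  by apply: expinv0_cvg; rewrite subr_gt0.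
rewrite (_ : (fun n => _) = (fun n : nat => expinv 0 (n.+1%:R * (b ord0 i - x ord0 i)))).
  by apply: expinv0_cvg; rewrite subr_gt0.
by apply/funext => n; rewrite /ramp; congr expinv; ring.
Qed.

Lemma csupp_box_bump Omega a b n : cbox a b `<=` Omega ->
  compactly_supported_in Omega (box_bump a b n).
Proof.
move=> abO; have sab : closure [set x | box_bump a b n x != 0] `<=` cbox a b.
  rewrite [X in _ `<=` X](closure_id _).1; last exact: cbox_closed.
  apply: closureS => x /=; apply: contraPP => xab.
  by apply/negP/negPn/eqP/box_bump_out => /obox_cbox.
split; last exact: subset_trans sab abO.
apply: (subclosed_compact _ (@cbox_compact a b) sab); exact: closed_closure.
Qed.

(** Dominated convergence along [box_bump]. The dominating function is [|h|] on the closed box,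
    integrable because that box is a compact subset of [Omega]. *)
Lemma integral_obox0 Omega h a b : open Omega -> loc_integrable Omega h ->
  (forall phi, Ccoo Omega phi -> \int[mu]_(x in Omega) (h x * phi x) = 0) ->
  cbox a b `<=` Omega -> (\int[mu]_(x in obox a b) (h x)%:E = 0)%E.
Proof.
move=> oO hi h0 abO; have mO := open_measurable_rV oO.
have mh := loc_integrable_measurable oO hi.
have mc : measurable (cbox a b) by apply: compact_measurable_rV; exact: cbox_compact.
have mob := obox_measurable a b.
have cO : Omega `&` cbox a b = cbox a b by rewrite setIC; apply/setIidPl.
have oOO : Omega `&` obox a b = obox a b.
  by rewrite setIC; apply/setIidPl; exact: subset_trans (@obox_cbox a b) abO.
have ig : mu.-integrable Omega ((fun x => `|h x|%:E) \_ (cbox a b))%E.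
  apply: (@integrableS _ _ _ _ setT) => //.
  by apply/(integrable_mkcond _ mc); exact: integrable_abse (hi _ (@cbox_compact _ _) abO).
pose f_ n x := (h x * box_bump a b n x)%:E.
have mf n : measurable_fun Omega (f_ n).
  apply/measurable_EFinP/measurable_funM => //; apply: measurable_funTS.
  apply: continuous_measurable_rV; apply: C1_continuous; apply: smooth_C1.
  exact: smooth_box_bump.
have fle n x : (`|f_ n x| <= ((fun x => `|h x|%:E) \_ (cbox a b)) x)%E.
  rewrite /f_ patchE; case: ifPn => [_|].
    rewrite lee_fin normrM ler_piMr//; have /andP[b0 b1] := box_bump_le1 a b n x.
    by rewrite ger0_norm.
  rewrite notin_setE => xab; rewrite box_bump_out; last by move=> /obox_cbox.
  by rewrite mulr0 /= normr0.
have iint n : (\int[mu]_(x in Omega) f_ n x = 0)%E.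
  have := h0 _ (conj (smooth_box_bump a b n) (csupp_box_bump n abO)).
  rewrite /Rintegral => fine0; rewrite -[RHS]/(0%:E) -fine0 fineK//.
  apply: integrable_fin_num => //; apply: (le_integrable mO (mf n) _ ig) => x Ox.
  by rewrite (le_trans (fle n x))// lee_abs.
have cv x : Omega x -> f_ n x @[n --> \oo] --> ((EFin \o h) \_ (obox a b)) x.
  move=> _; rewrite patchE; case: ifPn; rewrite ?notin_setE ?inE => xab.
    apply: cvg_EFin; first by near=> n.
    rewrite -[X in _ --> X]mulr1; apply: cvgM; first exact: cvg_cst.
    exact: box_bump_cvg.
  by rewrite (_ : f_^~ x = cst 0%E); [exact: cvg_cst|apply/funext => n; rewrite /f_ box_bump_out ?mulr0].
have gfin x : Omega x -> ((fun x => `|h x|%:E) \_ (cbox a b))%E x \is a fin_num.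
  by rewrite patchE; case: ifP.
have := dominated_cvg mO mf cv gfin ig (fun n x _ => fle n x).
rewrite -integral_mkcondr oOO => I; apply: (cvg_unique _ I) => //.
by rewrite (_ : (fun n => _) = cst 0%E); [exact: cvg_cst|apply/funext => n; exact: iint].
Unshelve. all: by end_near.
Qed.

(** A pi-system generating the sigma-algebra, chosen so that its intersection with an open box is
    again an open box, possibly empty. Allowing [setT] as a factor makes it possible to constrain a
    single coordinate. *)
Definition half_spaces : set (set 'rV[R]_N) :=
  [set [set x : 'rV[R]_N | forall i, A i (x ord0 i)] | A in
    [set A : 'I_N -> set R | forall i, A i = setT \/ exists r, A i = `]r, +oo[%classic]].

Lemma half_spaces_setI : setI_closed half_spaces.
Proof.
move=> _ _ [A hA <-] [B hB <-]; exists (fun i => A i `&` B i).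
  move=> i; case: (hA i) => [->|[r ->]]; first by rewrite setTI; exact: hB.
  case: (hB i) => [->|[r' ->]]; first by right; exists r; rewrite setIT.
  right; exists (Num.max r r'); apply/seteqP; split => x /=; rewrite !in_itv/= !andbT gt_max.
    by move=> [-> ->].
  by move=> /andP[].
by apply/seteqP; split => x; [move=> h; split => i; have [] := h i|move=> [h1 h2] i; split].
Qed.

Lemma measurable_half_spaces : @measurable _ 'rV[R]_N = <<s half_spaces >>.
Proof.
apply/seteqP; split; last first.
  apply: smallest_sub; first exact: sigma_algebra_measurable.
  move=> _ [A hA <-]; apply: measurable_box => i.
  by case: (hA i) => [->|[r ->]]; [exact: measurableT|exact: measurable_itv].
apply: smallest_sub; first exact: smallest_sigma_algebra.
rewrite -bigcup_seq => A [i _ /= [B mB <-]]; rewrite setTI.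
have mB' : (@RGenOInfty.G R).-sigma.-measurable B by rewrite -RGenOInfty.measurableE.
have : <<s preimage_set_system setT (fun x : 'rV[R]_N => x ord0 i) (@RGenOInfty.G R) >>
    `<=` <<s half_spaces >>.
  apply: smallest_sub; first exact: smallest_sigma_algebra.
  move=> _ [_ [r ->] <-]; rewrite setTI; apply: sub_sigma_algebra.
  exists (fun j => if j == i then `]r, +oo[%classic else setT).
    by move=> j; case: eqP => _; [right; exists r|left].
  apply/seteqP; split=> x /= => [/(_ i)|xr j]; first by rewrite eqxx.
  by case: eqP => // ->.
by rewrite g_sigma_preimageE; apply; exists B => //; rewrite setTI.
Qed.

(** The sets [S] such that [h] has zero integral over the part of [S] in a given box form a Dynkin
    system. It contains [half_spaces], hence all measurable sets, so [h] vanishes a.e. on each of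
    the countably many boxes that cover [Omega]. *)
Lemma variational_lemma Omega h : open Omega -> loc_integrable Omega h ->
  (forall phi, Ccoo Omega phi -> \int[mu]_(x in Omega) (h x * phi x) = 0) ->
  {ae mu, forall x, Omega x -> h x = 0}.
Proof.
move=> oO hi h0.
case: (eqVneq Omega set0) => [->|/set0P O0]; first exact: aeW.
have [a [b [abO Oab]]] := open_box_cover oO O0.
have mob n := obox_measurable (a n) (b n).
have ihb n : mu.-integrable (obox (a n) (b n)) (EFin \o h).
  apply: (integrableS _ _ (@obox_cbox _ _)) => //.
    by apply: compact_measurable_rV; exact: cbox_compact.
  by apply: hi; [exact: cbox_compact|exact: abO].
have hS n S : measurable S -> (\int[mu]_(x in obox (a n) (b n) `&` S) (h x)%:E = 0)%E.
  rewrite measurable_half_spaces; move: S; apply: (dynkin_induction measurable_half_spaces half_spaces_setI).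
  - by rewrite setIT; apply: (integral_obox0 oO hi h0); exact: abO.
  - move=> _ [A hA <-].
    (* [r] is the lower corner of the box cut out by the half-spaces. It dominates [a n], so the new
       closed box remains inside [Omega]. *)
    have /choice[r rA] : forall i : 'I_N, exists r : R, a n ord0 i <= r /\
        forall t, (a n ord0 i < t /\ A i t) <-> r < t.
      move=> i; case: (hA i) => [->|[r ->]]; first by exists (a n ord0 i); split=> // t; split=> [[]|].
      exists (Num.max (a n ord0 i) r); split; first by rewrite le_max lexx.
      move=> t; rewrite gt_max/= in_itv/= andbT; split; first by move=> [-> ->].
      by move=> /andP[].
    rewrite (_ : _ `&` _ = obox (\row_i r i) (b n)).
      apply: (integral_obox0 oO hi h0); apply: subset_trans (abO n) => x xr i.
      have /andP[rx xb] := xr i; rewrite mxE in rx; rewrite xb andbT.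
      exact: le_trans (rA i).1 rx.
    apply/seteqP; split=> x.
      move=> [xab xA] i; have /andP[ax xb] := xab i; rewrite mxE xb andbT.
      by apply/(rA i).2; split => //; exact: xA.
    move=> xr; split=> i; have := xr i; rewrite mxE => /andP[rx xb].
      by have [_ /(_ (x ord0 i))[_ /(_ rx)[-> _]]] := rA i.
    by have [_ /(_ (x ord0 i))[_ /(_ rx)[_ ?]]] := rA i.
  - move=> S mS IS; have := @integral_setU _ _ _ mu (obox (a n) (b n) `&` S) (obox (a n) (b n) `&` ~` S) (EFin \o h).
    rewrite -setIUr setUv setIT IS add0e => <- //.
    + by apply: (integral_obox0 oO hi h0); exact: abO.
    + exact: measurableI.
    + by apply: measurableI => //; exact: measurableC.
    + exact: measurable_int (ihb n).
    + by apply/disj_setPS => x [[_ ?] [_]].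
  - move=> F mF tF IF; rewrite setI_bigcupr integral_bigcup.
    + by rewrite eseries0// => k _ _; exact: IF.
    + apply/trivIsetP => i j _ _ ij; rewrite setIACA setIid.
      by move/trivIsetP : tF => /(_ i j I I ij) ->; rewrite setI0.
    + by move=> k; exact: measurableI.
    + apply: (integrableS (mob n)) (ihb n); last by move=> x [k _ []].
      by apply: bigcup_measurable => k _; exact: measurableI.
have aen n : {ae mu, forall x, obox (a n) (b n) x -> h x = 0}.
  have : ae_eq mu (obox (a n) (b n)) (EFin \o h) (cst 0%E).
    apply: integral_ae_eq => // E Eab mE; rewrite integral0.
    by rewrite -(hS n E mE) (_ : _ `&` E = E)//; exact/setIidPr.
  by apply: filterS => x /= + xab => /(_ xab)[].
have : {ae mu, forall x n, obox (a n) (b n) x -> h x = 0} by apply/ae_foralln.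
by apply: filterS => x hx /Oab[n _ xn]; exact: hx xn.
Qed.

End variational_lemma.

(** * Weak gradients *)

Section weak_gradients.
Context {R : realType} {N : nat}.
Local Notation mu := (@lebesgue_rV R N).
Implicit Types (u v phi : 'rV[R]_N -> R) (g k : 'rV[R]_N -> 'rV[R]_N).
Variable Omega : set 'rV[R]_N.
Hypothesis oO : open Omega.

Lemma loc_integrable_csupp u f h : loc_integrable Omega u ->
  compactly_supported_in Omega f -> continuous h ->
  (forall x, ~ closure [set x | f x != 0] x -> h x = 0) ->
  mu.-integrable Omega (fun x => (u x * h x)%:E).
Proof.
move=> iu [cf fO] ch hf; have mO := open_measurable_rV oO.
have mu' := loc_integrable_measurable oO iu.
have [C hC] := continuous_bounded_on_compact ch cf.
set K := closure _ in cf fO hf hC.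
have mK : measurable K by exact: compact_measurable_rV.
have ig : mu.-integrable Omega ((fun x => (C * u x)%:E) \_ K).
  apply: (@integrableS _ _ _ _ setT) => //; apply/(integrable_mkcond _ mK).
  rewrite (_ : (fun x => _) = (fun x => C%:E * (u x)%:E)%E); last by apply/funext => x; rewrite EFinM.
  by apply: integrableZl => //; exact: iu.
apply: (le_integrable mO _ _ ig).
  apply/measurable_EFinP/measurable_funM => //.
  by apply: measurable_funTS; exact: continuous_measurable_rV.
move=> x Ox; rewrite patchE; case: ifPn; rewrite ?notin_setE ?inE => Kx.
  rewrite lee_fin !normrM mulrC ler_wpM2r// (le_trans (hC x Kx))//.
  exact: ler_norm.
by rewrite hf// mulr0 /= normr0.
Qed.

(** The difference of two weak gradients is orthogonal to every test function. This makes [wgrad],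
    an arbitrary choice, interchangeable with any explicit weak gradient. *)
Lemma weak_gradient_unique u g k : weak_gradient Omega u g -> weak_gradient Omega u k ->
  {ae mu, forall x, Omega x -> g x = k x}.
Proof.
move=> [_ ug] [_ uk].
have gk i : {ae mu, forall x, Omega x -> g x ord0 i - k x ord0 i = 0}.
  have [ig gP] := ug i; have [ik kP] := uk i.
  apply: (variational_lemma oO).
    move=> K cK KO; rewrite (_ : EFin \o _ = (fun x => (g x ord0 i)%:E) \- (fun x => (k x ord0 i)%:E))%E.
      by apply: integrableB; [exact: compact_measurable_rV|exact: ig|exact: ik].
    by apply/funext => x /=; rewrite EFinB.
  move=> phi cphi; have [sphi cphiO] := cphi.
  have c := C1_continuous (smooth_C1 sphi).
  under eq_Rintegral do rewrite mulrBl.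
  rewrite RintegralB.
  - by apply/eqP; rewrite subr_eq0 -eqr_opp -gP// -kP.
  - exact: open_measurable_rV.
  - by apply: (loc_integrable_csupp ig cphiO c) => x; exact: support_out.
  - by apply: (loc_integrable_csupp ik cphiO c) => x; exact: support_out.
have : {ae mu, forall x, forall i : 'I_N, Omega x -> g x ord0 i - k x ord0 i = 0}.
  apply: (filter_forall (f := fun i => [set x | Omega x -> g x ord0 i - k x ord0 i = 0])) => i.
  exact: gk.
apply: filterS => x gkx Ox; apply/rowP => i; apply/eqP; rewrite -subr_eq0; apply/eqP.
exact: gkx.
Qed.

Lemma wgradP u : (exists g, weak_gradient Omega u g) -> weak_gradient Omega u (wgrad Omega u).
Proof. by move=> [g ug]; rewrite /wgrad; case: xgetP => [y -> //|/(_ g)]. Qed.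

Lemma wgrad_eq_ae u g : weak_gradient Omega u g ->
  {ae mu, forall x, Omega x -> wgrad Omega u x = g x}.
Proof. by move=> ug; apply: (weak_gradient_unique _ ug); apply: wgradP; exists g. Qed.

Lemma weak_gradientZ (c : R) u g : weak_gradient Omega u g ->
  weak_gradient Omega (fun x => c * u x) (fun x => c *: g x).
Proof.
have liZ (h : 'rV[R]_N -> R) : loc_integrable Omega h -> loc_integrable Omega (fun x => c * h x).
  move=> ih K cK KO; rewrite (_ : EFin \o _ = (fun x => c%:E * (h x)%:E)%E).
    by apply: integrableZl; [exact: compact_measurable_rV|exact: ih].
  by apply/funext => x /=; rewrite EFinM.
move=> [iu ug]; split; first exact: liZ.
move=> i; have [ig gP] := ug i; split.
  rewrite (_ : (fun x => _) = (fun x => c * g x ord0 i)); first exact: liZ.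
  by apply/funext => x; rewrite mxE.
have mO := open_measurable_rV oO.
move=> phi cphi; have [sphi cphiO] := cphi.
under eq_Rintegral do rewrite -mulrA.
under [X in _ = - X]eq_Rintegral do rewrite mxE -mulrA.
rewrite !RintegralZl//; first by rewrite gP// mulrN.
  apply: (loc_integrable_csupp ig cphiO (C1_continuous (smooth_C1 sphi))) => x.
  exact: support_out.
apply: (loc_integrable_csupp iu cphiO (C1_partial_continuous (smooth_C1 sphi))) => x.
exact: support_partial.
Qed.

Lemma weak_gradientB u v g k : weak_gradient Omega u g -> weak_gradient Omega v k ->
  weak_gradient Omega (u \- v) (fun x => g x - k x).
Proof.
have liB (h h' : 'rV[R]_N -> R) : loc_integrable Omega h -> loc_integrable Omega h' ->
    loc_integrable Omega (fun x => h x - h' x).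
  move=> ih ih' K cK KO; rewrite (_ : EFin \o _ = (fun x => (h x)%:E) \- (fun x => (h' x)%:E))%E.
    by apply: integrableB; [exact: compact_measurable_rV|exact: ih|exact: ih'].
  by apply/funext => x /=; rewrite EFinB.
move=> [iu ug] [iv vk]; split; first exact: liB.
move=> i; have [ig gP] := ug i; have [ik kP] := vk i; split.
  rewrite (_ : (fun x => _) = (fun x => g x ord0 i - k x ord0 i)); first exact: liB.
  by apply/funext => x; rewrite !mxE.
have mO := open_measurable_rV oO.
move=> phi cphi; have [sphi cphiO] := cphi.
have c := C1_continuous (smooth_C1 sphi).
have cd := C1_partial_continuous (i := i) (smooth_C1 sphi).
under eq_Rintegral do rewrite mulrBl.
under [X in _ = - X]eq_Rintegral do rewrite !mxE mulrBl.
rewrite !RintegralB//; first by rewrite gP// kP// opprB opprK addrC.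
- by apply: (loc_integrable_csupp ig cphiO c) => x; exact: support_out.
- by apply: (loc_integrable_csupp ik cphiO c) => x; exact: support_out.
- by apply: (loc_integrable_csupp iu cphiO cd) => x; exact: support_partial.
- by apply: (loc_integrable_csupp iv cphiO cd) => x; exact: support_partial.
Qed.

End weak_gradients.

(** * Finsler-Minkowski norms *)

(** A negative derivative would make the difference quotient negative at some small [t > 0]. The
    range [t <= 1] serves paths such as [1 - t], which leave the nonnegative reals afterwards. *)
Lemma is_derive_ge0 (R : realType) (h : R -> R) (l : R) :
  is_derive (0 : R) (1 : R) h l -> h 0 = 0 -> (forall t, 0 < t <= 1 -> 0 <= h t) -> 0 <= l.
Proof.
move=> [dh <-] h0 hp; rewrite leNgt; apply/negP => l0.
have /cvgrPdist_lt/(_ (- 'D_1 h 0)) : (fun t : R => t^-1 *: (h (t *: (1 : R) + 0) - h 0)) @ 0^' --> 'D_1 h 0 by exact: dh.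
rewrite oppr_gt0 => /(_ l0) [e /= e0 he].
pose d := Num.min (e / 2) 1; have d0 : 0 < d by rewrite lt_min divr_gt0//=.
have d1 : d <= 1 by rewrite ge_min lexx orbT.
have de : d < e by rewrite gt_min ltr_pdivrMr// mulr_natr mulr2n ltrDl e0.
have := he d; rewrite /= sub0r normrN gtr0_norm// gt_eqF// => /(_ de isT).
rewrite h0 subr0 addr0 -[d *: (1 : R)]/(d * 1) mulr1 ltr_norml opprK => /andP[+ _].
by rewrite ltrDl oppr_gt0 ltNge mulr_ge0 ?hp ?d0// invr_ge0 ltW.
Qed.

Section euclidean_product.
Context {R : realType} {N : nat}.
Implicit Types (x y : 'rV[R]_N).

Lemma dotrN x y : dotr x (- y) = - dotr x y.
Proof. by rewrite /dotr -sumrN; apply: eq_bigr => i _; rewrite mxE mulrN. Qed.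

Lemma dotrZ (c : R) x y : dotr x (c *: y) = c * dotr x y.
Proof. by rewrite /dotr mulr_sumr; apply: eq_bigr => i _; rewrite mxE mulrCA. Qed.

Lemma dotrZl (c : R) x y : dotr (c *: x) y = c * dotr x y.
Proof. by rewrite /dotr mulr_sumr; apply: eq_bigr => i _; rewrite mxE mulrA. Qed.

Lemma dotrB x y z : dotr x (y - z) = dotr x y - dotr x z.
Proof.
by rewrite /dotr -sumrB; apply: eq_bigr => i _; rewrite !mxE mulrBr.
Qed.

Lemma dotr_continuous : continuous (fun x => dotr x x).
Proof.
have H (r : seq 'I_N) : continuous (fun x => \sum_(i <- r) x ord0 i * x ord0 i).
  elim: r => [|i r IH].
    by under eq_fun do rewrite big_nil; exact: rV_continuous_cst.
  under eq_fun do rewrite big_cons.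
  by apply: rV_continuousD => //; apply: rV_continuousM; exact: coord_continuous.
exact: H.
Qed.

Lemma enorm_continuous : continuous (@enorm R N).
Proof.
move=> x; apply: (@continuous_comp 'rV[R]_N R R (fun x => dotr x x) Num.sqrt).
  exact: dotr_continuous.
exact: sqrt_continuous.
Qed.

Lemma enorm0 : enorm (0 : 'rV[R]_N) = 0.
Proof. by rewrite /enorm /dotr big1 ?sqrtr0// => i _; rewrite mxE mul0r. Qed.

Lemma coord_le_enorm x i : `|x ord0 i| <= enorm x.
Proof.
rewrite -sqrtr_sqr ler_wsqrtr// /dotr (bigD1 i)//= expr2 lerDl sumr_ge0// => j _.
by rewrite -expr2 sqr_ge0.
Qed.

Lemma enorm_eq0 x : enorm x = 0 -> x = 0.
Proof.
by move=> x0; apply/rowP => i; apply/eqP; rewrite mxE -normr_le0 -x0; exact: coord_le_enorm.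
Qed.

End euclidean_product.

Section finsler.
Context {R : realType} {N : nat}.
Implicit Types (xi eta v : 'rV[R]_N).
Variable H : 'rV[R]_N -> R.
Hypothesis hN : (0 < N)%N.
Hypothesis hH : finsler_minkowski H.

Lemma finsler_ge0 xi : 0 <= H xi.
Proof. by have [] := hH. Qed.

Lemma finslerZ (c : R) xi : H (c *: xi) = `|c| * H xi.
Proof. by have [_ [_ [_ [_ [_ [hZ _]]]]]] := hH; exact: hZ. Qed.

Lemma finslerN xi : H (- xi) = H xi.
Proof. by rewrite -scaleN1r finslerZ normrN normr1 mul1r. Qed.

Lemma finsler0 : H 0 = 0.
Proof. by rewrite -(scale0r (0 : 'rV[R]_N)) finslerZ normr0 mul0r. Qed.

(** Off parallel pairs the definition gives even the strict inequality; when one vector is a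
    nonnegative multiple of the other, homogeneity gives equality. *)
Lemma finslerD xi eta : H (xi + eta) <= H xi + H eta.
Proof.
have [_ [_ [_ [hD _]]]] := hH.
have [[k k0]|] := pselect (exists2 k : R, 0 <= k & xi = k *: eta \/ eta = k *: xi); last first.
  by move=> /hD/ltW.
case=> ->.
  rewrite -[X in H (_ + X)]scale1r -scalerDl !finslerZ.
  by rewrite (ger0_norm k0) ger0_norm ?addr_ge0// mulrDl mul1r.
rewrite -[X in H (X + _)]scale1r -scalerDl !finslerZ.
by rewrite (ger0_norm k0) ger0_norm ?addr_ge0// mulrDl mul1r.
Qed.

Lemma finsler_dist xi eta : `|H xi - H eta| <= H (xi - eta).
Proof.
rewrite ler_norml; apply/andP; split; last first.
  by rewrite lerBlDr; have := finslerD (xi - eta) eta; rewrite subrK.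
rewrite lerNl opprB lerBlDr -(opprB eta) finslerN.
by have := finslerD (eta - xi) xi; rewrite subrK.
Qed.

Lemma finsler_continuous : continuous H.
Proof.
move=> x; have [_ [_ [_ [_ [_ [_ [c1 [c2 [_ c20 Hle]]]]]]]]] := hH.
have FF : Filter (nbhs x) := @nbhs_filter 'rV[R]_N x.
have c : enorm (x - y) @[y --> x] --> enorm (x - x).
  apply: (@continuous_comp 'rV[R]_N 'rV[R]_N R (fun y => x - y) (@enorm R N)).
    by apply: continuousB; [exact: cst_continuous|].
  exact: enorm_continuous.
rewrite subrr enorm0 in c; apply/cvgrPdist_le => e e0.
have /cvgrPdist_le/(_ (e / c2)) := c; rewrite divr_gt0// => /(_ isT).
apply: filterS => y; rewrite sub0r normrN => h.
apply: le_trans (finsler_dist _ _) _; have /andP[_ Hy] := Hle (x - y).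
apply: le_trans Hy _; rewrite mulrC -ler_pdivlMr//.
exact: le_trans (ler_norm _) h.
Qed.

(* H is only known to have continuous partial derivatives, and no chain rule for
   such functions is available. Convexity reduces increments of H in a direction v
   to increments along the coordinate axes. *)
Lemma finsler_sum xi v :
  N%:R * H (xi + v) <= \sum_(i < N) H (xi + (N%:R * v ord0 i) *: delta_mx ord0 i).
Proof.
have E : N%:R *: (xi + v) = \sum_(i < N) (xi + (N%:R * v ord0 i) *: delta_mx ord0 i).
  rewrite big_split/= sumr_const card_ord scalerDr scaler_nat; congr (_ + _).
  by rewrite [in LHS](row_sum_delta v) scaler_sumr; apply: eq_bigr => i _; rewrite scalerA.
rewrite -[X in X * _](ger0_norm (ler0n R N)) -finslerZ E.
elim/big_ind2 : _ => [|x1 x2 y1 y2 h1 h2|//]; first by rewrite finsler0.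
by apply: le_trans (finslerD _ _) _; exact: lerD.
Qed.

(** By [finsler_sum] and the hypothesis, the sum of the values of [H] at the axis displacements
    stays above [N%:R * H xi + c * t] for [t > 0], with equality at 0. Comparing derivatives at 0
    involves only the partials of [H]. *)
Lemma finsler_slope xi v (c : R) : xi != 0 ->
  (forall t, 0 < t -> N%:R * H xi + t * c <= N%:R * H (xi + t *: v)) ->
  c <= N%:R * dotr (grad H xi) v.
Proof.
move=> xi0 hc; rewrite -subr_ge0.
pose F (i : 'I_N) (t : R) := H (xi + (N%:R * v ord0 i * t) *: delta_mx ord0 i).
pose h := (\sum_(i < N) F i) - ((cst (N%:R * H xi) + cst c * id) : R -> R).
have hE t : h t = \sum_(i < N) F i t - (N%:R * H xi + c * t).
  by rewrite /h -[LHS]/((\sum_(i < N) F i) t - (N%:R * H xi + c * t)) fct_sumE.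
have dF i : is_derive (0 : R) (1 : R) (F i) (partial i H xi * (N%:R * v ord0 i)).
  have [_ [C1H _]] := hH; have [dH _] := C1H xi xi0 i.
  have dl : is_derive ((N%:R * v ord0 i) * 0) (1 : R) (fun s : R => H (xi + s *: delta_mx ord0 i)) (partial i H xi).
    by rewrite mulr0; apply/is_derive_line0; constructor.
  apply: (@is_derive1_comp _ _ (fun t => N%:R * v ord0 i * t) 0 _ _ dl).
  have h1 := is_deriveM (is_derive_cst (N%:R * v ord0 i) (0 : R) (1 : R)) (is_derive_id (0 : R) (1 : R)).
  by apply: (is_derive_eq h1); rewrite scaler0 addr0 -[LHS]/(N%:R * v ord0 i * 1) mulr1.
have h1 := is_deriveM (is_derive_cst c (0 : R) (1 : R)) (is_derive_id (0 : R) (1 : R)).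
have h2 := is_deriveD (is_derive_cst (N%:R * H xi) (0 : R) (1 : R)) h1.
have h3 := is_deriveB (is_derive_sum dF) h2.
have -> : N%:R * dotr (grad H xi) v - c = \sum_(i < N) partial i H xi * (N%:R * v ord0 i) - (0 + (cst c (0:R) *: (1:R) + id (0:R) *: (0:R))).
  rewrite scaler0 addr0 add0r -[cst c 0 *: (1 : R)]/(c * 1) mulr1 /dotr mulr_sumr.
  by congr (_ - _); apply: eq_bigr => i _; rewrite mxE mulrCA.
apply: is_derive_ge0 h3 _ _.
  rewrite -/h hE mulr0 addr0 (eq_bigr (fun=> H xi)) ?sumr_const ?card_ord ?mulr_natl ?subrr//.
  by move=> i _; rewrite /F mulr0 scale0r addr0.
move=> t /andP[t0 _]; rewrite -[X in 0 <= X]/(h t) hE subr_ge0 (mulrC c); apply: le_trans (hc t t0) _.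
apply: le_trans (finsler_sum _ _) _; apply: ler_sum => i _.
by rewrite /F mxE mulrAC mulrA.
Qed.

(** [finsler_slope] along [- eta], where the triangle inequality bounds the increment of [H] below
    by [- t * H eta]. *)
Lemma finsler_grad_le xi eta : xi != 0 -> dotr (grad H xi) eta <= H eta.
Proof.
move=> xi0; have N0 : 0 < N%:R :> R by rewrite ltr0n.
have := @finsler_slope xi (- eta) (- (N%:R * H eta)) xi0.
rewrite dotrN mulrN lerN2 ler_pM2l//; apply => t t0.
rewrite mulrN mulrCA -mulrBr ler_pM2l// lerBlDr.
have := finslerD (xi + t *: - eta) (t *: eta).
by rewrite -addrA scalerN addNr addr0 finslerZ gtr0_norm.
Qed.

(** One inequality is [finsler_grad_le] with [eta = xi]. For the other, homogeneity makes the
    increment along [v = xi] exactly [t * H xi], and [finsler_slope] applies. *)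
Lemma finsler_euler xi : xi != 0 -> dotr (grad H xi) xi = H xi.
Proof.
move=> xi0; have N0 : 0 < N%:R :> R by rewrite ltr0n.
apply/eqP; rewrite eq_le finsler_grad_le//= -(ler_pM2l N0); apply: finsler_slope => // t t0.
rewrite mulrCA -mulrDr ler_pM2l// -[X in H (X + _)]scale1r -scalerDl finslerZ.
by rewrite gtr0_norm ?addr_gt0// mulrDl mul1r.
Qed.

Lemma flux_le p xi eta : 1 < p -> `|dotr (flux p H xi) eta| <= H xi `^ (p - 1) * H eta.
Proof.
move=> p1; rewrite /flux dotrZl normrM ger0_norm ?powR_ge0//.
have [->|xi0] := eqVneq xi 0.
  by rewrite finsler0 powR0 ?mul0r// subr_eq0 gt_eqF.
rewrite ler_wpM2l ?powR_ge0// ler_norml finsler_grad_le// andbT lerNl -dotrN -(finslerN eta).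
exact: finsler_grad_le.
Qed.

Lemma flux_self p xi : 1 < p -> dotr (flux p H xi) xi = H xi `^ p.
Proof.
move=> p1; rewrite /flux dotrZl; have [->|xi0] := eqVneq xi 0.
  by rewrite finsler0 !powR0 ?mul0r// ?subr_eq0 gt_eqF// (lt_trans ltr01).
have Hxi0 : H xi != 0.
  by apply: contra_neq xi0; have [_ [_ [_ [_ [h0 _]]]]] := hH; exact: (h0 xi).1.
rewrite finsler_euler// -[X in _ * X]powRr1 ?finsler_ge0// -powRD ?subrK//.
by rewrite Hxi0 implybT.
Qed.

(** [grad H] is continuous only off 0, so measurability is checked separately on the singleton 0 and
    on its open complement. *)
Lemma flux_measurable p i : measurable_fun setT (fun xi => flux p H xi ord0 i).
Proof.
under eq_fun do rewrite !mxE.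
apply: measurable_funM.
  apply: (measurableT_comp (measurable_powR _)).
  apply: continuous_measurable_rV; exact: finsler_continuous.
have o0 : open [set xi : 'rV[R]_N | xi != 0].
  rewrite (_ : mkset _ = ~` [set 0]); last by apply/seteqP; split=> x /eqP.
  apply: closed_openC; apply: compact_closed; [exact: norm_hausdorff|exact: compact_set1].
rewrite -(setvU [set xi : 'rV[R]_N | xi != 0]); apply/measurable_funU.
- by apply: measurableC; exact: open_measurable_rV.
- exact: open_measurable_rV.
split.
  rewrite (_ : ~` _ = [set 0]); first exact: measurable_fun_set1.
  by apply/seteqP; split => [x /negP/negPn/eqP|x ->] //=; rewrite eqxx.
apply: measurable_fun_continuous_on => // x x0.
by have [_ [C1H _]] := hH; have [] := C1H x x0 i.
Qed.

End finsler.

(** * The nonlocal kernel *)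

Section product_null_sets.
Context d1 d2 (T1 : measurableType d1) (T2 : measurableType d2) (R : realType).
Variables (m1 : {sigma_finite_measure set T1 -> \bar R}).
Variables (m2 : {sigma_finite_measure set T2 -> \bar R}).

(** The product measure of a set is the integral of the measures of its sections. Statements about
    almost all increments can thus be frozen at one endpoint. *)
Lemma ae_prod_xsection (P : T1 * T2 -> Prop) :
  {ae (m1 \x m2)%E, forall z, P z} -> {ae m1, forall x, {ae m2, forall y, P (x, y)}}.
Proof.
move=> [A [mA A0 PA]]; rewrite /product_measure1/= in A0.
have mx := measurable_fun_xsection m2 mA.
have : ae_eq m1 setT (m2 \o xsection A) (cst 0%E).
  apply/(ae_eq_integral_abs m1 measurableT mx); rewrite -[RHS]A0.
  by apply: eq_integral => x _; rewrite gee0_abs.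
apply: filterS => x /= /(_ I) mx0; exists (xsection A x); split => //.
  exact: measurable_xsection.
by move=> y; rewrite /xsection/= inE; exact: PA.
Qed.

Lemma prod_null_xsection (A : set (T1 * T2)) : measurable A ->
  (forall x, m2 (xsection A x) = 0%E) -> (m1 \x m2)%E A = 0%E.
Proof. by move=> mA A0; rewrite /product_measure1 integral0_eq//= => x _; exact: A0. Qed.

Lemma ae_prod_fst (P : T1 -> Prop) : {ae m1, forall x, P x} ->
  {ae (m1 \x m2)%E, forall z, P z.1}.
Proof.
move=> [A [mA A0 PA]]; exists (A `*` setT); split; first exact: measurableX.
  by rewrite product_measure1E// [X in (X * _)%E](_ : _ = 0%E) ?mul0e.
by move=> z Pz; split => //; exact: PA.
Qed.

Lemma ae_prod_snd (P : T2 -> Prop) : {ae m2, forall x, P x} ->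
  {ae (m1 \x m2)%E, forall z, P z.2}.
Proof.
move=> [A [mA A0 PA]]; exists (setT `*` A); split; first exact: measurableX.
  by rewrite product_measure1E// [X in (_ * X)%E](_ : _ = 0%E) ?mule0.
by move=> z Pz; split => //; exact: PA.
Qed.

End product_null_sets.

(** Supplies the actual point at which one endpoint of the increments is frozen. *)
Lemma ae_pos_exists d (T : measurableType d) (R : realType)
    (m : {measure set T -> \bar R}) (A : set T) (P : T -> Prop) :
  measurable A -> (0 < m A)%E -> {ae m, forall x, P x} -> exists2 x, A x & P x.
Proof.
move=> mA mA0 [B [mB mB0 PB]]; apply: contrapT => h.
have AB : A `<=` B by move=> x Ax; apply: PB => Px; apply: h; exists x.
have : (m A <= m B)%E by apply: le_measure => //; rewrite inE.
by rewrite mB0 leNgt mA0.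
Qed.

Lemma measurable_inv (R : realType) : measurable_fun setT (@GRing.inv R).
Proof.
have o0 : open [set x : R | x != 0].
  rewrite (_ : mkset _ = ~` [set 0]); last by apply/seteqP; split=> x /eqP.
  by apply: closed_openC; apply: compact_closed; [exact: norm_hausdorff|exact: compact_set1].
have m0 : measurable [set x : R | x != 0] by exact: open_measurable.
rewrite -(setvU [set x : R | x != 0]); apply/measurable_funU => //.
  exact: measurableC.
split.
  rewrite (_ : ~` _ = [set 0]); first exact: measurable_fun_set1.
  by apply/seteqP; split => [x /negP/negPn/eqP|x ->] //=; rewrite eqxx.
by apply: open_continuous_measurable_fun => // x; rewrite inE => x0; exact: inv_continuous.
Qed.

Section kernel.
Context {R : realType} {N : nat}.
Local Notation mu := (@lebesgue_rV R N).
Hypothesis hN : (0 < N)%N.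
Variable w : 'rV[R]_N -> R.
Hypothesis hw : weight w.

Lemma measurable_rV_B d (T : measurableType d) (f g : T -> 'rV[R]_N) :
  measurable_fun setT f -> measurable_fun setT g -> measurable_fun setT (fun x => f x - g x).
Proof.
move=> /measurable_fun_coordP mf /measurable_fun_coordP mg; apply/measurable_fun_coordP => i.
under eq_fun do rewrite !mxE.
exact: measurable_funB.
Qed.

Lemma measurable_rV_mid d (T : measurableType d) (f g : T -> 'rV[R]_N) (c : R) :
  measurable_fun setT f -> measurable_fun setT g -> measurable_fun setT (fun x => c *: (f x + g x)).
Proof.
move=> /measurable_fun_coordP mf /measurable_fun_coordP mg; apply/measurable_fun_coordP => i.
under eq_fun do rewrite !mxE.
by apply: measurable_funM => //; exact: measurable_funD.
Qed.

Lemma measurable_enorm : measurable_fun setT (@enorm R N).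
Proof. apply: continuous_measurable_rV; exact: enorm_continuous. Qed.

Lemma weight_measurable : measurable_fun setT w.
Proof. by have [wi _] := hw; exact: loc_integrable_measurable openT wi. Qed.

Lemma eball_open (c : 'rV[R]_N) r : open (eball c r).
Proof.
rewrite (_ : eball c r = (fun x => enorm (x - c)) @^-1` `]-oo, r[%classic); last first.
  by apply/seteqP; split => x; rewrite /= in_itv.
apply: open_comp; last exact: interval_open.
move=> x _; apply: (@continuous_comp 'rV[R]_N 'rV[R]_N R (fun y => y - c) (@enorm R N)).
  by apply: continuousB; [|exact: cst_continuous].
exact: enorm_continuous.
Qed.

Lemma eball_cube (c : 'rV[R]_N) r : exists M : R,
  eball c r `<=` [set x : 'rV[R]_N | forall i, `|x ord0 i| <= M].
Proof.
exists (r + enorm c) => x xc i; rewrite -(subrK c x) mxE (le_trans (ler_normD _ _))//.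
by rewrite lerD ?coord_le_enorm// (le_trans (coord_le_enorm _ _))// ltW.
Qed.

Lemma weight_eball_integrable c r : mu.-integrable (eball c r) (EFin \o w).
Proof.
have [M cM] := eball_cube c r; have [wi _] := hw.
apply: (integrableS _ _ cM).
- by apply: compact_measurable_rV; exact: compact_cube.
- by apply: open_measurable_rV; exact: eball_open.
- by apply: wi => //; exact: compact_cube.
Qed.

(** [w] is positive only a.e., while the Tonelli argument for the kernel asks for an integrand that
    is nonnegative everywhere. *)
Lemma weight_eball_norm c r :
  \int[mu]_(x in eball c r) w x = fine (\int[mu]_(x in eball c r) `|w x|%:E)%E.
Proof.
have mB : measurable (eball c r) by apply: open_measurable_rV; exact: eball_open.
have mw : measurable_fun (eball c r) w by apply: measurable_funTS; exact: weight_measurable.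
rewrite /Rintegral; congr fine; apply: ae_eq_integral => //.
- exact/measurable_EFinP.
- by apply/measurable_EFinP; exact: measurableT_comp.
- by have [_] := hw; apply: filterS => x wx _; rewrite gtr0_norm.
Qed.

Lemma weight_eball_gt0 c r : 0 < r -> 0 < \int[mu]_(x in eball c r) w x.
Proof.
move=> r0; have mB : measurable (eball c r) by apply: open_measurable_rV; exact: eball_open.
have mw : measurable_fun (eball c r) w by apply: measurable_funTS; exact: weight_measurable.
have iw := weight_eball_integrable c r.
rewrite weight_eball_norm fine_gt0//; apply/andP; split; last first.
  by have /integrableP[_ ] := iw.
rewrite lt0e integral_ge0 ?andbT//; apply/eqP => I0.
have mw' : measurable_fun (eball c r) (EFin \o w) by exact/measurable_EFinP.
have /(ae_eq_integral_abs mu mB mw') w0 : (\int[mu]_(x in eball c r) `|(EFin \o w) x| = 0)%E by exact: I0.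
have B0 : (0 < mu (eball c r))%E.
  apply: open_lebesgue_gt0; first exact: eball_open.
  by exists c; rewrite /eball/= subrr enorm0.
have [_ w1] := hw.
have [x Bx] := ae_pos_exists mB B0 (filterI w0 w1).
by move=> [/= /(_ Bx) [->]]; rewrite ltxx.
Qed.

Lemma kernel_measurable s p : measurable_fun setT (nonlocal_density w s p).
Proof.
have m1 : measurable_fun setT (fst : 'rV[R]_N * 'rV[R]_N -> _) by exact: measurable_fst.
have m2 : measurable_fun setT (snd : 'rV[R]_N * 'rV[R]_N -> _) by exact: measurable_snd.
have minv : measurable_fun setT (@GRing.inv R) by exact: measurable_inv.
have mball : measurable_fun setT (fun z : 'rV[R]_N * 'rV[R]_N =>
   \int[mu]_(x in eball (2^-1 *: (z.1 + z.2)) (enorm (z.1 - z.2) / 2)) w x).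
  under eq_fun do rewrite weight_eball_norm.
  apply: (measurableT_comp (fine_measurable measurableT)) => //.
  (* The ball moves with the pair [z]. Writing its weight as the integral of an indicator over the
     third variable makes it measurable in [z] by Tonelli. *)
  pose F (zy : ('rV[R]_N * 'rV[R]_N) * 'rV[R]_N) : \bar R :=
    (`|w zy.2| * \1_[set t : ('rV[R]_N * 'rV[R]_N) * 'rV[R]_N |
       enorm (t.2 - 2^-1 *: (t.1.1 + t.1.2)) < enorm (t.1.1 - t.1.2) / 2] zy)%:E.
  have mF : measurable_fun setT F.
    apply/measurable_EFinP; apply: measurable_funM.
      apply: measurableT_comp => //; apply: (measurableT_comp weight_measurable).
      exact: measurable_snd.
    apply: measurable_indic; rewrite (_ : mkset _ = setT `&`
      (fun t : ('rV[R]_N * 'rV[R]_N) * 'rV[R]_N =>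
        enorm (t.2 - 2^-1 *: (t.1.1 + t.1.2)) < enorm (t.1.1 - t.1.2) / 2) @^-1` [set true]).
      have mf1 := measurableT_comp m1 (measurable_fst (T1 := ('rV[R]_N * 'rV[R]_N)%type) (T2 := 'rV[R]_N)).
      have mf2 := measurableT_comp m2 (measurable_fst (T1 := ('rV[R]_N * 'rV[R]_N)%type) (T2 := 'rV[R]_N)).
      apply: measurable_fun_ltr => //.
        apply: (measurableT_comp measurable_enorm); apply: measurable_rV_B.
          exact: measurable_snd.
        exact: measurable_rV_mid mf1 mf2.
      apply: measurable_funM => //; apply: (measurableT_comp measurable_enorm).
      exact: measurable_rV_B mf1 mf2.
    by apply/seteqP; split=> t //= [].
  have F0 t : (0 <= F t)%E by rewrite lee_fin mulr_ge0.
  have := measurable_fun_fubini_tonelli_F (m2 := mu) F mF F0.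
  congr measurable_fun; apply/funext => z; rewrite /fubini_F [RHS]integral_mkcond.
  apply: eq_integral => y _; rewrite /F /= patchE indicE.
  rewrite (_ : ((z, y) \in _) = (y \in eball (2^-1 *: (z.1 + z.2)) (enorm (z.1 - z.2) / 2))).
    by case: ifP => _; rewrite ?mulr1 ?mulr0.
  by apply/idP/idP; rewrite !inE.
apply: measurable_funM.
  apply: measurable_funM; last exact: measurableT_comp.
  by apply: measurable_funM; apply: measurableT_comp => //; exact: weight_measurable.
apply: measurableT_comp => //; apply: (measurableT_comp (measurable_powR _)).
apply: (measurableT_comp measurable_enorm); exact: measurable_rV_B.
Qed.

Lemma rV_set1_null (x : 'rV[R]_N) : mu [set x] = 0%E.
Proof.
rewrite (_ : [set x] = [set y | forall i, [set x ord0 i] (y ord0 i)]); last first.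
  by apply/seteqP; split => [y -> //|y yx]; apply/rowP => i; exact: yx.
rewrite (@lebesgue_rV_box _ _ (fun i => [set x ord0 i])); last by move=> i; exact: measurable_set1.
by rewrite (bigD1 (Ordinal hN))//= lebesgue_measure_set1 mul0e.
Qed.

(** Off the diagonal the ball has positive radius and therefore positive weight. The diagonal is
    null because its sections are single points, which are null as [N > 0]. *)
Lemma kernel_gt0_ae s p : {ae (mu \x mu)%E, forall z, 0 < nonlocal_density w s p z}.
Proof.
have [_ w0] := hw.
have w1 := @ae_prod_fst _ _ _ _ _ mu mu _ w0.
have w2 := @ae_prod_snd _ _ _ _ _ mu mu _ w0.
have diag : {ae (mu \x mu)%E, forall z, z.1 - z.2 != 0}.
  exists [set z : 'rV[R]_N * 'rV[R]_N | enorm (z.1 - z.2) = 0].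
  have md : measurable [set z : 'rV[R]_N * 'rV[R]_N | enorm (z.1 - z.2) = 0].
    have : measurable_fun setT (fun z : 'rV[R]_N * 'rV[R]_N => enorm (z.1 - z.2)).
      apply: (measurableT_comp measurable_enorm); apply: measurable_rV_B.
        exact: measurable_fst.
      exact: measurable_snd.
    by move=> /(_ measurableT [set 0] (measurable_set1 _)); rewrite setTI.
  split=> //.
    apply: prod_null_xsection => // x; rewrite -[RHS](rV_set1_null x); congr (mu _).
    apply/seteqP; split=> y; rewrite /xsection/= inE/=.
      by move=> /enorm_eq0/eqP; rewrite subr_eq0 => /eqP.
    by move=> ->; rewrite subrr enorm0.
  by move=> z /negP/negPn/eqP /= ->; rewrite enorm0.
apply: filterS3 w1 w2 diag => -[x y] /= wx wy xy.
have e0 : 0 < enorm (x - y).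
  by rewrite lt_def sqrtr_ge0 andbT; apply: contra_neq xy; exact: enorm_eq0.
rewrite /nonlocal_density/kernelK/= divr_gt0 ?powR_gt0// divr_gt0 ?mulr_gt0//.
by apply: weight_eball_gt0; rewrite divr_gt0.
Qed.

End kernel.

(** * Scalar inequalities *)

Section scalar_inequalities.
Context {R : realType}.
Implicit Types (a b c p t x y : R).

Lemma powR_young p a b : 1 < p -> 0 <= a -> 0 <= b ->
  a `^ (p - 1) * b <= (1 - p^-1) * a `^ p + p^-1 * b `^ p.
Proof.
move=> p1 a0 b0; have p0 : 0 < p by rewrite (lt_trans ltr01).
have q0 : 0 < p / (p - 1) by rewrite divr_gt0// subr_gt0.
have p10 : p - 1 != 0 by rewrite subr_eq0 gt_eqF.
have pn0 : p != 0 by rewrite gt_eqF.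
have pq : (p / (p - 1))^-1 + p^-1 = 1 by field; rewrite p10 pn0.
have := conjugate_powR (powR_ge0 a (p - 1)) b0 q0 p0 pq.
rewrite -powRrM (_ : (p - 1) * (p / (p - 1)) = p); last by field.
move=> h; apply: le_trans h _.
by rewrite le_eqVlt; apply/orP; left; apply/eqP; field; rewrite ?p10 ?pn0.
Qed.

Lemma powR_mulB1 p a : 1 < p -> 0 <= a -> a `^ (p - 1) * a = a `^ p.
Proof.
move=> p1 a0; rewrite -[X in _ * X]powRr1// -powRD ?subrK//.
by rewrite (gt_eqF (lt_trans ltr01 p1)).
Qed.

(** For [b > 0], the Young deficit of [a] and [b x] is a nonnegative function of [x >= 0] that
    vanishes at [x = 1]. Approaching 1 from both sides ([s = 1] and [s = -1]) shows that its
    derivative [c * p - k] is 0, that is b^p = a^(p-1) b. *)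
Lemma powR_young_eq p a b : 1 < p -> 0 <= a -> 0 <= b ->
  a `^ (p - 1) * b = (1 - p^-1) * a `^ p + p^-1 * b `^ p -> a = b.
Proof.
move=> p1 a0 b0 E; have p0 : 0 < p by rewrite (lt_trans ltr01).
have pV1 : 0 < 1 - p^-1 by rewrite subr_gt0 invf_lt1.
have pn0 : p != 0 by rewrite gt_eqF.
have [b00|bn0] := eqVneq b 0.
  move: E; rewrite b00 mulr0 powR0 ?gt_eqF// mulr0 addr0 => /esym/eqP.
  by rewrite mulf_eq0 gt_eqF//= powR_eq0 => /andP[/eqP].
have bp : 0 < b by rewrite lt_def bn0.
pose c := p^-1 * b `^ p; pose k := a `^ (p - 1) * b; pose c0 := (1 - p^-1) * a `^ p.
have h_ge0 x : 0 <= x -> 0 <= c0 + c * x `^ p - k * x.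
  move=> x0; rewrite subr_ge0 /c /k -!mulrA -powRM//.
  exact: (powR_young p1 a0 (mulr_ge0 b0 x0)).
have dh (s : R) : is_derive (0 : R) (1 : R) (fun t : R => c0 + c * (1 + s * t) `^ p - k * (1 + s * t))
    ((c * p - k) * s).
  have d1 := is_deriveM (is_derive_cst s (0 : R) (1 : R)) (is_derive_id (0 : R) (1 : R)).
  have d2 := is_deriveD (is_derive_cst (1 : R) (0 : R) (1 : R)) d1.
  have one : (cst 1 + cst s * id : R -> R) 0 = 1 by rewrite -[LHS]/(1 + s * 0) mulr0 addr0.
  have d3 : is_derive ((cst 1 + cst s * id : R -> R) 0) (1 : R) (@powR R ^~ p) p.
    rewrite one; have := @is_derive1_powR R p 1 ltr01.
    by rewrite powR1 mulr1.
  have d4 := is_derive1_comp d3 d2.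
  have d5 := is_deriveM (is_derive_cst c (0 : R) (1 : R)) d4.
  have d6 := is_deriveD (is_derive_cst c0 (0 : R) (1 : R)) d5.
  have d7 := is_deriveM (is_derive_cst k (0 : R) (1 : R)) d2.
  have d8 := is_deriveB d6 d7.
  apply: (is_derive_eq d8); rewrite !scaler0 !addr0 !add0r.
  rewrite -[cst s 0 *: (1 : R)]/(s * 1) -[cst c 0 *: _]/(c * (p * (s * 1))) -[cst k 0 *: _]/(k * (s * 1)).
  by ring.
have h0 s : c0 + c * (1 + s * 0) `^ p - k * (1 + s * 0) = 0.
  by rewrite mulr0 addr0 powR1 !mulr1 /k E subrr.
have k1 : 0 <= (c * p - k) * 1.
  by apply: is_derive_ge0 (dh 1) (h0 1) _ => t /andP[t0 _]; apply: h_ge0; rewrite mul1r addr_ge0// ltW.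
have k2 : 0 <= (c * p - k) * -1.
  by apply: is_derive_ge0 (dh (-1)) (h0 (-1)) _ => t /andP[_ t1]; apply: h_ge0; rewrite mulN1r subr_ge0.
have ck : b `^ (p - 1) * b = a `^ (p - 1) * b.
  rewrite powR_mulB1//; have : c * p = b `^ p by rewrite /c mulrAC mulVf// mul1r.
  by move: k1 k2; rewrite /k; lra.
have /(congr1 (fun x => x `^ (p - 1)^-1)) := mulIf bn0 ck.
by rewrite -!powRrM mulfV ?subr_eq0 ?gt_eqF// !powRr1.
Qed.

(** Convexity of the power at l (a/l) + (1-l) (b/(1-l)), obtained from Young's inequality for
    (a+b)^(p-1) against a/l and b/(1-l). The coefficient of a^p tends to 1 as l tends to 1, which is
    what approximation arguments need when b is an error. *)
Lemma powRD_le p (l : R) a b : 1 < p -> 0 < l < 1 -> 0 <= a -> 0 <= b ->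
  (a + b) `^ p <= l `^ (1 - p) * a `^ p + (1 - l) `^ (1 - p) * b `^ p.
Proof.
move=> p1 /andP[l0 l1] a0 b0; have p0 : 0 < p by rewrite (lt_trans ltr01).
have ab0 := addr_ge0 a0 b0; have l10 : 0 < 1 - l by rewrite subr_gt0.
have key (m x : R) : 0 < m -> 0 <= x ->
    (a + b) `^ (p - 1) * x <= m * (1 - p^-1) * (a + b) `^ p + p^-1 * (m `^ (1 - p) * x `^ p).
  move=> m0 x0; have := powR_young p1 ab0 (divr_ge0 x0 (ltW m0)).
  rewrite -(ler_pM2l m0) => h.
  have -> : (a + b) `^ (p - 1) * x = m * ((a + b) `^ (p - 1) * (x / m)) by field; rewrite gt_eqF.
  apply: le_trans h _; rewrite powRM ?invr_ge0 ?(ltW m0)//.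
  have -> : m^-1 `^ p = m `^ (- p) by rewrite -powR_inv1 ?(ltW m0)// -powRrM mulN1r.
  rewrite (_ : m `^ (1 - p) = m * m `^ (- p)); last first.
    by rewrite powRD ?powRr1 ?(ltW m0)//; apply/implyP => _; rewrite gt_eqF.
  by rewrite le_eqVlt; apply/orP; left; apply/eqP; ring.
have := lerD (key l a l0 a0) (key (1 - l) b l10 b0).
rewrite -mulrDr powR_mulB1// => h.
have pV : 0 < p^-1 by rewrite invr_gt0.
rewrite -(ler_pM2l pV); lra.
Qed.

(** The right-hand side is the tangent at [y] of the concave power 1-d. Its slope (1-d) y^(-d) is
    the singular nonlinearity of the equation, which links the mass with the source term. The proof
    is Young's inequality with exponents 1/(1-d) and 1/d. *)
Lemma powR_concave_tangent (d : R) x y : 0 < d < 1 -> 0 <= x -> 0 < y ->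
  x `^ (1 - d) <= d * y `^ (1 - d) + (1 - d) * (y `^ (- d) * x).
Proof.
move=> /andP[d0 d1] x0 y0; have d10 : 0 < 1 - d by rewrite subr_gt0.
have := @conjugate_powR R ((y `^ (- d) * x) `^ (1 - d)) ((y `^ (1 - d)) `^ d) (1 - d)^-1 d^-1
  (powR_ge0 _ _) (powR_ge0 _ _).
rewrite !invr_gt0 d10 d0 !invrK subrK => /(_ isT isT erefl).
rewrite -!powRrM mulfV ?gt_eqF// powRr1 ?mulr_ge0 ?powR_ge0// => h.
rewrite (_ : x `^ (1 - d) = (y `^ (- d) * x) `^ (1 - d) * y `^ ((1 - d) * d)); last first.
  rewrite powRM ?powR_ge0// -powRrM mulrAC -powRD; last by rewrite (gt_eqF y0) implybT.
  by rewrite (_ : - d * (1 - d) + (1 - d) * d = 0) ?powRr0 ?mul1r//; ring.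
apply: le_trans h _; rewrite mulfK ?gt_eqF//.
by rewrite le_eqVlt; apply/orP; left; apply/eqP; ring.
Qed.

Lemma Jp_norm p t : 1 < p -> `|Jp p t| = `|t| `^ (p - 1).
Proof.
move=> p1; rewrite /Jp normrM ger0_norm ?powR_ge0//; have [->|t0] := eqVneq t 0.
  by rewrite normr0 mulr0 powR0// subr_eq0 gt_eqF.
rewrite -[X in _ * X]powRr1// -powRD; first by congr (_ `^ _); ring.
by rewrite normr_eq0 t0 implybT.
Qed.

Lemma Jp_self p t : 1 < p -> Jp p t * t = `|t| `^ p.
Proof.
move=> p1; rewrite -powR_mulB1// -Jp_norm// -normrM ger0_norm// /Jp -mulrA.
by rewrite mulr_ge0 ?powR_ge0// -expr2 sqr_ge0.
Qed.

Lemma Jp_measurable p : measurable_fun setT (@Jp R p).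
Proof.
apply: measurable_funM => //; apply: (measurableT_comp (measurable_powR _)).
exact: normr_measurable.
Qed.

(** Squaring both sides leaves x y = |x| |y|. *)
Lemma same_sign_dist x y : `|x - y| = `| `|x| - `|y| | -> 0 <= x * y.
Proof.
move=> /(congr1 (fun t => t ^+ 2)); rewrite !real_normK ?num_real// !sqrrB !real_normK ?num_real//.
move=> /addIr/addrI/oppr_inj; rewrite -[LHS]mulr_natr -[RHS]mulr_natr => h.
by rewrite (mulIf _ h) ?mulr_ge0// pnatr_eq0.
Qed.

(** Subtracting [e] gives the value 0 at 0, so composition with it preserves compact supports. Its
    slope is at most 1 in absolute value and it stays within [e] of [|t|]. *)
Definition smooth_abs (e t : R) := Num.sqrt (t ^+ 2 + e ^+ 2) - e.

Lemma smooth_abs_le e t : 0 < e -> 0 <= smooth_abs e t <= `|t|.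
Proof.
move=> e0; rewrite /smooth_abs subr_ge0; apply/andP; split.
  have {1}-> : e = Num.sqrt (e ^+ 2) by rewrite sqrtr_sqr gtr0_norm.
  by rewrite ler_wsqrtr// lerDr sqr_ge0.
have te0 : 0 <= `|t| + e := addr_ge0 (normr_ge0 t) (ltW e0).
have E : `|t| + e = Num.sqrt ((`|t| + e) ^+ 2) by rewrite sqrtr_sqr (ger0_norm te0).
rewrite lerBlDr E ler_wsqrtr// sqrrD real_normK ?num_real// lerD2r lerDl.
by rewrite mulrn_wge0// mulr_ge0// ltW.
Qed.

Lemma smooth_abs_dist e t : 0 < e -> `|smooth_abs e t - `|t| | <= e.
Proof.
move=> e0; have /andP[_ h] := smooth_abs_le t e0.
rewrite ler0_norm ?subr_le0// opprB lerBlDr /smooth_abs addrC subrK.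
by rewrite -sqrtr_sqr ler_wsqrtr// lerDl sqr_ge0.
Qed.

Lemma is_derive_smooth_abs e t : 0 < e ->
  is_derive t (1 : R) (smooth_abs e) (t / Num.sqrt (t ^+ 2 + e ^+ 2)).
Proof.
move=> e0; have pos : 0 < t ^+ 2 + e ^+ 2 by rewrite ltr_wpDl ?sqr_ge0// exprn_gt0.
have h1 := is_deriveD (is_deriveX 2 (is_derive_id t (1 : R))) (is_derive_cst (e ^+ 2) t (1 : R)).
have h2 := is_derive1_sqrt pos.
have h3 := @is_derive1_comp _ Num.sqrt (id ^+ 2 + cst (e ^+ 2)) t _ _ h2 h1.
have h4 := is_deriveB h3 (is_derive_cst e t (1 : R)).
apply: (is_derive_eq h4); rewrite subr0 addr0 /= expr1 -[_ *: (1 : R)]/(_ * 1) mulr1.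
by field; rewrite gt_eqF// sqrtr_gt0.
Qed.

Lemma smooth_abs_slope e t : 0 < e -> `|t / Num.sqrt (t ^+ 2 + e ^+ 2)| <= 1.
Proof.
move=> e0; have pos : 0 < Num.sqrt (t ^+ 2 + e ^+ 2).
  by rewrite sqrtr_gt0 ltr_wpDl ?sqr_ge0// exprn_gt0.
rewrite normrM normfV (gtr0_norm pos) ler_pdivrMr// mul1r -sqrtr_sqr ler_wsqrtr//.
by rewrite lerDl sqr_ge0.
Qed.

Lemma smooth_abs_lipschitz e x y : 0 < e -> `|smooth_abs e x - smooth_abs e y| <= `|x - y|.
Proof.
move=> e0; have := @mvt_bound R (fun t => smooth_abs e (t + y)) (fun t => (t + y) / Num.sqrt ((t + y) ^+ 2 + e ^+ 2)) (x - y) 1.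
rewrite subrK add0r mul1r; apply => t _; last exact: smooth_abs_slope.
rewrite -[X in is_derive _ _ _ X]mulr1.
apply: (@is_derive1_comp _ (smooth_abs e) (fun t => t + y)); first exact: is_derive_smooth_abs.
have h := is_deriveD (is_derive_id t (1 : R)) (is_derive_cst y t (1 : R)).
by apply: (is_derive_eq h); rewrite addr0.
Qed.

End scalar_inequalities.

(** * Energies *)

Lemma measurable_norm d (T : measurableType d) (R : realType) (f : T -> R) :
  measurable_fun setT f -> measurable_fun setT (fun x => `|f x|).
Proof. by move=> mf; exact: (measurableT_comp (@normr_measurable R setT) mf). Qed.

(** Working with nonnegative integrands and extended real values lets this lemma prove finiteness
    instead of presupposing it. *)
Lemma ge0_integral_le_comb d (T : measurableType d) (R : realType)
    (m : {measure set T -> \bar R}) (D : set T) (a b : R) (f g h : T -> R) :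
  measurable D -> 0 <= a -> 0 <= b -> measurable_fun D f -> measurable_fun D g ->
  measurable_fun D h -> (forall x, 0 <= f x) -> (forall x, 0 <= g x) -> (forall x, 0 <= h x) ->
  {ae m, forall x, D x -> h x <= a * f x + b * g x} ->
  (\int[m]_(x in D) (h x)%:E <=
    a%:E * \int[m]_(x in D) (f x)%:E + b%:E * \int[m]_(x in D) (g x)%:E)%E.
Proof.
move=> mD a0 b0 mf mg mh f0 g0 h0 hfg.
have mEf : measurable_fun D (EFin \o f) by exact/measurable_EFinP.
have mEg : measurable_fun D (EFin \o g) by exact/measurable_EFinP.
have mEh : measurable_fun D (EFin \o h) by exact/measurable_EFinP.
rewrite -(ge0_integralZl_EFin m mD _ mEf a0); last by move=> x _; rewrite lee_fin.
rewrite -(ge0_integralZl_EFin m mD _ mEg b0); last by move=> x _; rewrite lee_fin.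
have mEaf := measurable_funeM a%:E mEf; have mEbg := measurable_funeM b%:E mEg.
rewrite -(ge0_integralD m mD _ mEaf _ mEbg); last 2 first.
- by move=> x _; rewrite /= -EFinM lee_fin mulr_ge0.
- by move=> x _; rewrite /= -EFinM lee_fin mulr_ge0.
apply: (ae_ge0_le_integral mD _ mEh _ (emeasurable_funD mEaf mEbg)).
- by move=> x _; rewrite lee_fin.
- by move=> x _; rewrite /= -!EFinM -EFinD lee_fin addr_ge0// mulr_ge0.
- by apply: filterS hfg => x hfg Dx; rewrite /= -!EFinM -EFinD lee_fin; exact: hfg.
Qed.

Section energies.
Context {R : realType} {N : nat}.
Local Notation mu := (@lebesgue_rV R N).
Local Notation mu2 := (mu \x mu)%E.
Implicit Types (u v phi psi : 'rV[R]_N -> R) (g k : 'rV[R]_N -> 'rV[R]_N).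
Hypothesis hN : (0 < N)%N.
Variable Omega : set 'rV[R]_N.
Hypothesis oO : open Omega.
Variables (alpha s p : R).
Hypotheses (alpha0 : 0 < alpha) (p1 : 1 < p).
Variable H : 'rV[R]_N -> R.
Hypothesis hH : finsler_minkowski H.
Variable w : 'rV[R]_N -> R.
Hypothesis hw : weight w.

Let mO : measurable Omega := open_measurable_rV oO.
Let p0 : 0 < p := lt_trans ltr01 p1.

(* The energy with an explicit gradient field, and with the weight and the
   kernel replaced by their absolute values: they are only a.e. nonnegative. *)
Definition grad_density g (x : 'rV[R]_N) : R := H (g x) `^ p * `|w x|.

Definition diff_density v (z : 'rV[R]_N * 'rV[R]_N) : R :=
  alpha * (`|v z.1 - v z.2| `^ p * `|nonlocal_density w s p z|).

Definition field_energy g v : \bar R :=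
  (\int[mu]_(x in Omega) (grad_density g x)%:E + \int[mu2]_z (diff_density v z)%:E)%E.

Definition measurable_field g v :=
  (forall i, measurable_fun Omega (fun x => g x ord0 i)) /\ measurable_fun setT v.

Lemma field_comp_measurable g (h : 'rV[R]_N -> R) :
  (forall i, measurable_fun Omega (fun x => g x ord0 i)) ->
  measurable_fun setT h -> measurable_fun Omega (h \o g).
Proof.
move=> mg mh; pose G := g \_ Omega.
have mG : measurable_fun setT G.
  apply/measurable_fun_coordP => i.
  have /(measurable_restrict _ mO measurableT) : measurable_fun (setT `&` Omega) (fun x => g x ord0 i).
    by rewrite setTI.
  congr measurable_fun; apply/funext => x; rewrite /G !patchE.
  by case: ifP => // _; rewrite mxE.
apply: (eq_measurable_fun (h \o G)); first by move=> x Ox; rewrite /= /G patchE Ox.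
by apply: measurable_funTS; exact: measurableT_comp.
Qed.

Lemma grad_density_measurable g : (forall i, measurable_fun Omega (fun x => g x ord0 i)) ->
  measurable_fun Omega (grad_density g).
Proof.
move=> mg; apply: measurable_funM.
  apply: (@field_comp_measurable g (fun xi => H xi `^ p)) => //.
  apply: (measurableT_comp (measurable_powR _)).
  by apply: continuous_measurable_rV; exact: (finsler_continuous hH).
apply: measurable_funTS; apply: measurable_norm.
exact: (weight_measurable hw).
Qed.

Lemma measurable_diff v : measurable_fun setT v ->
  measurable_fun setT (fun z : 'rV[R]_N * 'rV[R]_N => v z.1 - v z.2).
Proof.
by move=> mv; apply: measurable_funB; apply: (measurableT_comp mv);
  [exact: measurable_fst|exact: measurable_snd].
Qed.

Lemma kernel_norm_measurable : measurable_fun setT (fun z => `|nonlocal_density w s p z|).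
Proof. by apply: measurable_norm; exact: (kernel_measurable hw s p). Qed.

Lemma diff_density_measurable v : measurable_fun setT v -> measurable_fun setT (diff_density v).
Proof.
move=> mv; apply: measurable_funM => //; apply: measurable_funM; last exact: kernel_norm_measurable.
apply: (measurableT_comp (measurable_powR _)); apply: measurable_norm.
exact: measurable_diff.
Qed.

Lemma grad_density_ge0 g x : 0 <= grad_density g x.
Proof. by rewrite mulr_ge0 ?powR_ge0. Qed.

Lemma diff_density_ge0 v z : 0 <= diff_density v z.
Proof. by apply: mulr_ge0; [exact: ltW|apply: mulr_ge0; rewrite ?powR_ge0]. Qed.

Lemma weak_gradient_measurable v g : weak_gradient Omega v g ->
  forall i, measurable_fun Omega (fun x => g x ord0 i).
Proof. by move=> [_ vg] i; apply: (loc_integrable_measurable oO); have [] := vg i. Qed.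

(** The passage from the energy of the statement to its working form: weak gradients agree a.e., and
    the weight and the kernel are positive a.e., so replacing them by their absolute values changes
    no integral. *)
Lemma energy_field v g : measurable_fun setT v -> weak_gradient Omega v g ->
  energy Omega p s alpha H w v = field_energy g v.
Proof.
move=> mv vg; rewrite /energy /field_energy; congr (_ + _)%E.
  have mwg := weak_gradient_measurable (wgradP (ex_intro _ g vg)).
  apply: ae_eq_integral => //.
  - apply/measurable_EFinP/measurable_funM.
      apply: (@field_comp_measurable _ (fun xi => H xi `^ p)) => //.
      apply: (measurableT_comp (measurable_powR _)).
      by apply: continuous_measurable_rV; exact: (finsler_continuous hH).
    by apply: measurable_funTS; exact: (weight_measurable hw).
  - have mg := weak_gradient_measurable vg.
    by apply/measurable_EFinP; exact: grad_density_measurable.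
  - have [_ w0] := hw; have gg := wgrad_eq_ae oO vg.
    by apply: filterS2 w0 gg => x wx gx Ox; rewrite /grad_density gx// gtr0_norm.
transitivity (alpha%:E * \int[mu2]_z (`|v z.1 - v z.2| `^ p * `|nonlocal_density w s p z|)%:E)%E.
  congr (_ * _)%E; apply: ae_eq_integral => //.
  - apply/measurable_EFinP/measurable_funM; last exact: (kernel_measurable hw s p).
    apply: (measurableT_comp (measurable_powR _)); apply: measurable_norm.
    exact: measurable_diff.
  - apply/measurable_EFinP/measurable_funM; last exact: kernel_norm_measurable.
    apply: (measurableT_comp (measurable_powR _)); apply: measurable_norm.
    exact: measurable_diff.
  - have := kernel_gt0_ae hN hw s p.
    by apply: filterS => z z0 _; rewrite (gtr0_norm z0).
rewrite -ge0_integralZl//.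
- apply/measurable_EFinP/measurable_funM; last exact: kernel_norm_measurable.
  apply: (measurableT_comp (measurable_powR _)); apply: measurable_norm.
  exact: measurable_diff.
- by rewrite lee_fin ltW.
Qed.

Lemma field_energy_ge0 g v : (0 <= field_energy g v)%E.
Proof.
apply: adde_ge0; apply: integral_ge0 => ? _; rewrite lee_fin.
  exact: grad_density_ge0.
exact: diff_density_ge0.
Qed.

Lemma field_energy_le (a b : R) g v k phi g' v' : 0 <= a -> 0 <= b ->
  measurable_field g v -> measurable_field k phi -> measurable_field g' v' ->
  (forall x, grad_density g' x <= a * grad_density g x + b * grad_density k x) ->
  (forall z, diff_density v' z <= a * diff_density v z + b * diff_density phi z) ->
  (field_energy g' v' <= a%:E * field_energy g v + b%:E * field_energy k phi)%E.
Proof.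
move=> a0 b0 [mg mv] [mk mphi] [mg' mv'] hg hv.
have I1 (h : 'rV[R]_N -> 'rV[R]_N) : (0 <= \int[mu]_(x in Omega) (grad_density h x)%:E)%E.
  by apply: integral_ge0 => x _; rewrite lee_fin grad_density_ge0.
have I2 (h : 'rV[R]_N -> R) : (0 <= \int[mu2]_z (diff_density h z)%:E)%E.
  by apply: integral_ge0 => x _; rewrite lee_fin diff_density_ge0.
rewrite /field_energy ge0_muleDr// [X in (_ <= _ + X)%E]ge0_muleDr//.
have h1 := @ge0_integral_le_comb _ _ _ mu Omega a b _ _ _ mO a0 b0
  (grad_density_measurable mg) (grad_density_measurable mk) (grad_density_measurable mg')
  (grad_density_ge0 g) (grad_density_ge0 k) (grad_density_ge0 g') (aeW _ (fun x _ => hg x)).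
have h2 := @ge0_integral_le_comb _ _ _ mu2 setT a b _ _ _ measurableT a0 b0
  (diff_density_measurable mv) (diff_density_measurable mphi) (diff_density_measurable mv')
  (diff_density_ge0 v) (diff_density_ge0 phi) (diff_density_ge0 v') (aeW _ (fun x _ => hv x)).
by apply: le_trans (leeD h1 h2) _; rewrite addeACA.
Qed.

Lemma measurable_fieldB g v k phi : measurable_field g v -> measurable_field k phi ->
  measurable_field (fun x => g x - k x)%R (fun x => v x - phi x)%R.
Proof.
move=> [mg mv] [mk mphi]; split; last exact: measurable_funB.
by move=> i; under eq_fun do rewrite !mxE; exact: measurable_funB.
Qed.

Lemma measurable_fieldZ (c : R) g v : measurable_field g v ->
  measurable_field (fun x => c *: g x)%R (fun x => c * v x)%R.
Proof.
move=> [mg mv]; split; last exact: measurable_funM.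
by move=> i; under eq_fun do rewrite !mxE; exact: measurable_funM.
Qed.

Lemma measurable_field_C1 phi : C1_on setT phi -> measurable_field (grad phi) phi.
Proof.
move=> Cphi; split; last by apply: continuous_measurable_rV; exact: C1_continuous.
move=> i; under eq_fun do rewrite mxE.
by apply: measurable_funTS; apply: continuous_measurable_rV; exact: C1_partial_continuous.
Qed.

(** [powRD_le] inside both integrals, with phi = v - (v - phi). When phi approaches v for fixed [l],
    only the factor l^(1-p) on the energy of v survives. *)
Lemma field_energy_conv (l : R) g v k phi : 0 < l < 1 ->
  measurable_field g v -> measurable_field k phi ->
  (field_energy k phi <= (l `^ (1 - p))%:E * field_energy g v +
    ((1 - l) `^ (1 - p))%:E * field_energy (fun x => g x - k x)%R (fun x => v x - phi x)%R)%E.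
Proof.
move=> l01 mg mk; apply: field_energy_le; rewrite ?powR_ge0//; first exact: measurable_fieldB.
  move=> x; rewrite /grad_density !mulrA -mulrDl ler_wpM2r//.
  apply: le_trans (powRD_le p1 l01 (finsler_ge0 hH _) (finsler_ge0 hH _)).
  apply: ge0_ler_powR; rewrite ?nnegrE ?addr_ge0 ?(finsler_ge0 hH) ?(ltW p0)//.
  by rewrite -(finslerN hH (g x - k x)) opprB; have := finslerD hH (g x) (k x - g x); rewrite [X in H X <= _]addrC subrK.
move=> z; rewrite /diff_density.
have E (a b A B K : R) : a * (alpha * (A * K)) + b * (alpha * (B * K)) = alpha * ((a * A + b * B) * K).
  by ring.
rewrite E ler_wpM2l ?(ltW alpha0)// ler_wpM2r//.
apply: le_trans (powRD_le p1 l01 (normr_ge0 _) (normr_ge0 _)).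
apply: ge0_ler_powR; rewrite ?nnegrE ?addr_ge0 ?(ltW p0)//.
have -> : phi z.1 - phi z.2 = (v z.1 - v z.2) - (v z.1 - phi z.1 - (v z.2 - phi z.2)) by ring.
exact: ler_normB.
Qed.

Lemma field_energyZ (c : R) g v : measurable_field g v ->
  field_energy (fun x => c *: g x)%R (fun x => c * v x)%R = ((`|c| `^ p)%:E * field_energy g v)%E.
Proof.
move=> [mg mv]; rewrite /field_energy ge0_muleDr; last 2 first.
- by apply: integral_ge0 => x _; rewrite lee_fin grad_density_ge0.
- by apply: integral_ge0 => x _; rewrite lee_fin diff_density_ge0.
rewrite -!ge0_integralZl_EFin//; do ?by [exact: powR_ge0|move=> x _; rewrite lee_fin ?grad_density_ge0 ?diff_density_ge0
    |apply/measurable_EFinP; exact: grad_density_measurable|apply/measurable_EFinP; exact: diff_density_measurable].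
congr (_ + _)%E; apply: eq_integral => x _; rewrite -EFinM; congr EFin.
  by rewrite /grad_density (finslerZ hH) powRM ?finsler_ge0// mulrA.
by rewrite /diff_density -mulrBr normrM powRM//; ring.
Qed.

Lemma field_energy_integrable g v : measurable_field g v -> (field_energy g v < +oo)%E ->
  mu.-integrable Omega (EFin \o grad_density g) /\
  mu2.-integrable setT (EFin \o diff_density v).
Proof.
move=> [mg mv] E.
have I1 : (0 <= \int[mu]_(x in Omega) (grad_density g x)%:E)%E.
  by apply: integral_ge0 => x _; rewrite lee_fin grad_density_ge0.
have I2 : (0 <= \int[mu2]_z (diff_density v z)%:E)%E.
  by apply: integral_ge0 => x _; rewrite lee_fin diff_density_ge0.
split; apply/integrableP; split.
- by apply/measurable_EFinP; exact: grad_density_measurable.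
- under eq_integral => x _ do rewrite gee0_abs ?lee_fin ?grad_density_ge0//.
  by apply: le_lt_trans E; rewrite leeDl.
- by apply/measurable_EFinP; exact: diff_density_measurable.
- under eq_integral => x _ do rewrite gee0_abs ?lee_fin ?diff_density_ge0//.
  by apply: le_lt_trans E; rewrite leeDr.
Qed.

End energies.

(** * Testing the weak form *)

Section integrable_real.
Context d (T : measurableType d) (R : realType) (m : {measure set T -> \bar R}) (D : set T).
Hypothesis mD : measurable D.
Implicit Types h k : T -> R.

Lemma integrable_scale (c : R) h : m.-integrable D (EFin \o h) ->
  m.-integrable D (EFin \o (fun x => c * h x)).
Proof.
move=> ih; rewrite (_ : EFin \o _ = (fun x => c%:E * (EFin \o h) x)%E); first exact: integrableZl.
by apply/funext => x /=; rewrite EFinM.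
Qed.

Lemma integrable_add h k : m.-integrable D (EFin \o h) -> m.-integrable D (EFin \o k) ->
  m.-integrable D (EFin \o (fun x => h x + k x)).
Proof.
move=> ih ik; rewrite (_ : EFin \o _ = (EFin \o h) \+ (EFin \o k))%E; first exact: integrableD.
by apply/funext => x /=; rewrite EFinD.
Qed.

Lemma integrable_sub h k : m.-integrable D (EFin \o h) -> m.-integrable D (EFin \o k) ->
  m.-integrable D (EFin \o (fun x => h x - k x)).
Proof.
move=> ih ik; rewrite (_ : EFin \o _ = (EFin \o h) \- (EFin \o k))%E; first exact: integrableB.
by apply/funext => x /=; rewrite EFinB.
Qed.

End integrable_real.

Section test_functions.
Context {R : realType} {N : nat}.
Implicit Types (phi : 'rV[R]_N -> R).

Lemma smooth_abs_slope_continuous (e : R) : 0 < e ->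
  continuous (fun t : R => t / Num.sqrt (t ^+ 2 + e ^+ 2)).
Proof.
move=> e0 t; apply: cvgM; first exact: cvg_id.
have pos : 0 < t ^+ 2 + e ^+ 2 by rewrite ltr_wpDl ?sqr_ge0// exprn_gt0.
apply: cvgV; first by rewrite gt_eqF// sqrtr_gt0.
apply: (continuous_comp (f := fun t : R => t ^+ 2 + e ^+ 2)); last exact: sqrt_continuous.
by apply: cvgD; [exact: exprn_continuous|exact: cvg_cst].
Qed.

Lemma is_derive_smooth_abs_comp (e : R) phi i x : 0 < e -> C1_on setT phi ->
  is_derive x (delta_mx ord0 i) (smooth_abs e \o phi)
    (phi x / Num.sqrt (phi x ^+ 2 + e ^+ 2) * partial i phi x).
Proof.
by move=> e0 Cphi; apply: is_derive_comp1; [exact: is_derive_smooth_abs|exact: C1_is_derive].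
Qed.

Lemma C1_smooth_abs (e : R) phi : 0 < e -> C1_on setT phi -> C1_on setT (smooth_abs e \o phi).
Proof.
move=> e0 Cphi x _ i; have [dx _] := is_derive_smooth_abs_comp i x e0 Cphi; split => //.
rewrite (_ : partial i _ = fun x => (phi x / Num.sqrt (phi x ^+ 2 + e ^+ 2)) * partial i phi x).
  apply: rV_continuousM; last exact: C1_partial_continuous.
  move=> y; apply: (@continuous_comp 'rV[R]_N R R phi (fun t => t / Num.sqrt (t ^+ 2 + e ^+ 2))).
    exact: C1_continuous.
  exact: smooth_abs_slope_continuous.
by apply/funext => y; have [_ <-] := is_derive_smooth_abs_comp i y e0 Cphi.
Qed.

Lemma grad_smooth_abs (e : R) phi x : 0 < e -> C1_on setT phi ->
  grad (smooth_abs e \o phi) x = (phi x / Num.sqrt (phi x ^+ 2 + e ^+ 2)) *: grad phi x.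
Proof.
move=> e0 Cphi; apply/rowP => i; rewrite !mxE.
by have [_ <-] := is_derive_smooth_abs_comp i x e0 Cphi.
Qed.

Lemma Cc1_smooth_abs (Omega : set 'rV[R]_N) (e : R) phi : 0 < e -> Ccoo Omega phi ->
  Cc1 Omega (smooth_abs e \o phi).
Proof.
move=> e0 [sphi cphi]; split; first exact: C1_smooth_abs (smooth_C1 sphi).
apply: csupp_sub cphi _ => x /= ->; apply/eqP; rewrite -normr_le0.
have /andP[h0 h1] := smooth_abs_le 0 e0; rewrite normr0 in h1.
by rewrite ger0_norm.
Qed.

End test_functions.

Lemma young_arith (R : realFieldType) (a b c d x y q r : R) :
  a <= q * b + r * c -> a + d + (q * x + r * y - d) <= q * (b + x) + r * (c + y).
Proof. rewrite !mulrDr; lra. Qed.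

(* [P], [Q]: the two pairings, [FF] the right-hand side of the weak form; [k], [k']
   the energies of the scaled error, whose sum is at most 1. *)
Lemma energy_self_arith (R : realFieldType) (r i A B k k' P Q FF S C : R) :
  0 < r -> r < 1 -> 0 < i -> 0 <= A -> 0 <= B -> C * (k + k') <= 1 ->
  A <= P + i * ((1 - r) * A + r * (C * k)) -> B <= Q + i * ((1 - r) * B + r * (C * k')) ->
  P + Q = FF -> FF <= S + i * ((1 - r) * (A + B) + r * (C * (k + k'))) ->
  A + B <= S + 2 * i * (A + B + 1).
Proof.
move=> r0 r1 i0 A0 B0 Ck hA hB PQ hS.
have h : (1 - r) * (A + B) + r * (C * (k + k')) <= A + B + 1.
  have h1 : 0 <= r * (A + B) by apply: mulr_ge0; [exact: ltW|exact: addr_ge0].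
  have h2 : r * (C * (k + k')) <= r * 1 by rewrite ler_wpM2l// ltW.
  by rewrite mulrBl mul1r; lra.
have h3 : i * ((1 - r) * (A + B) + r * (C * (k + k'))) <= i * (A + B + 1) by rewrite ler_wpM2l// ltW.
by lra.
Qed.

(** [X] is the integral of F |v| and [G] that of the Young gap; [X] is eliminated between the
    tangent inequality and the tested equation. *)
Lemma mass_arith (R : realFieldType) (d E X G M : R) : d < 1 ->
  M <= d * E + (1 - d) * X -> X + G <= E -> M + (1 - d) * G <= E.
Proof.
move=> d1 h1 h2; have : (1 - d) * (X + G) <= (1 - d) * E by rewrite ler_wpM2l// subr_ge0 ltW.
lra.
Qed.

Section weak_form.
Context {R : realType} {N : nat}.
Local Notation mu := (@lebesgue_rV R N).
Local Notation mu2 := (mu \x mu)%E.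
Implicit Types (u v phi psi : 'rV[R]_N -> R) (g k : 'rV[R]_N -> 'rV[R]_N).
Hypothesis hN : (0 < N)%N.
Variable Omega : set 'rV[R]_N.
Hypothesis oO : open Omega.
Variables (alpha s p : R).
Hypotheses (alpha0 : 0 < alpha) (p1 : 1 < p).
Variable H : 'rV[R]_N -> R.
Hypothesis hH : finsler_minkowski H.
Variable w : 'rV[R]_N -> R.
Hypothesis hw : weight w.

Let mO : measurable Omega := open_measurable_rV oO.
Let p0 : 0 < p := lt_trans ltr01 p1.

Local Notation grad_density := (grad_density p H w).
Local Notation diff_density := (diff_density alpha s p w).
Local Notation field_energy := (field_energy Omega alpha s p H w).
Local Notation measurable_field := (measurable_field Omega).

Definition flux_pairing g k (x : 'rV[R]_N) : R := dotr (flux p H (g x)) (k x) * `|w x|.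

Definition diff_pairing u psi (z : 'rV[R]_N * 'rV[R]_N) : R :=
  alpha * (Jp p (u z.1 - u z.2) * (psi z.1 - psi z.2) * `|nonlocal_density w s p z|).

Lemma flux_pairing_measurable g k :
  (forall i, measurable_fun Omega (fun x => g x ord0 i)) ->
  (forall i, measurable_fun Omega (fun x => k x ord0 i)) ->
  measurable_fun Omega (flux_pairing g k).
Proof.
move=> mg mk; apply: measurable_funM; last first.
  by apply: measurable_funTS; apply: measurable_norm; exact: (weight_measurable hw).
rewrite /dotr; apply: measurable_sum => i; apply: measurable_funM => //.
apply: (field_comp_measurable oO (h := fun xi => flux p H xi ord0 i)) => //.
exact: (flux_measurable hH).
Qed.

Lemma diff_pairing_measurable u psi : measurable_fun setT u -> measurable_fun setT psi ->
  measurable_fun setT (diff_pairing u psi).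
Proof.
move=> mu' mpsi; apply: measurable_funM => //; apply: measurable_funM; last by apply: kernel_norm_measurable; exact: hw.
apply: measurable_funM; last exact: measurable_diff.
by apply: (measurableT_comp (Jp_measurable p)); exact: measurable_diff.
Qed.

(** The dominating field [k'] is there for the test functions [smooth_abs e \o phi]: their gradient
    is dominated by that of [phi], and the bound should involve the energy of [phi] alone. *)
Lemma flux_pairing_le g k k' x : H (k x) <= H (k' x) ->
  `|flux_pairing g k x| <= (1 - p^-1) * grad_density g x + p^-1 * grad_density k' x.
Proof.
move=> kk'; rewrite /flux_pairing /grad_density normrM normr_id !mulrA -mulrDl ler_wpM2r//.
apply: le_trans (flux_le hN hH _ _ p1) _.
apply: le_trans (powR_young p1 (finsler_ge0 hH _) (finsler_ge0 hH _)).
by rewrite ler_wpM2l ?powR_ge0.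
Qed.

Lemma diff_pairing_le u psi psi' z : `|psi z.1 - psi z.2| <= `|psi' z.1 - psi' z.2| ->
  `|diff_pairing u psi z| <= (1 - p^-1) * diff_density u z + p^-1 * diff_density psi' z.
Proof.
move=> pp'; rewrite /diff_pairing /diff_density.
have E (a b A B K : R) : a * (alpha * (A * K)) + b * (alpha * (B * K)) = alpha * ((a * A + b * B) * K).
  by ring.
rewrite E normrM (gtr0_norm alpha0) ler_wpM2l ?(ltW alpha0)// normrM normr_id ler_wpM2r//.
rewrite normrM Jp_norm//; apply: le_trans (powR_young p1 (normr_ge0 _) (normr_ge0 _)).
by rewrite ler_wpM2l ?powR_ge0.
Qed.

Lemma flux_pairing_integrable g k k' :
  (forall i, measurable_fun Omega (fun x => g x ord0 i)) ->
  (forall i, measurable_fun Omega (fun x => k x ord0 i)) ->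
  (forall x, H (k x) <= H (k' x)) ->
  mu.-integrable Omega (EFin \o grad_density g) ->
  mu.-integrable Omega (EFin \o grad_density k') ->
  mu.-integrable Omega (EFin \o flux_pairing g k).
Proof.
move=> mg mk kk' ig ik.
apply: (le_integrable mO _ _ (integrableD mO (integrableZl mO (1 - p^-1) ig) (integrableZl mO p^-1 ik))).
  by apply/measurable_EFinP; exact: flux_pairing_measurable.
move=> x _; rewrite /= lee_fin; apply: le_trans (ler_norm _).
exact: flux_pairing_le.
Qed.

Lemma diff_pairing_integrable u psi psi' : measurable_fun setT u -> measurable_fun setT psi ->
  (forall z, `|psi z.1 - psi z.2| <= `|psi' z.1 - psi' z.2|) ->
  mu2.-integrable setT (EFin \o diff_density u) ->
  mu2.-integrable setT (EFin \o diff_density psi') ->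
  mu2.-integrable setT (EFin \o diff_pairing u psi).
Proof.
move=> mu' mpsi pp' iu ipsi.
have mT : measurable [set: 'rV[R]_N * 'rV[R]_N] by exact: measurableT.
apply: (le_integrable mT _ _ (integrableD mT (integrableZl mT (1 - p^-1) iu) (integrableZl mT p^-1 ipsi))).
  by apply/measurable_EFinP; exact: diff_pairing_measurable.
move=> z _; rewrite /= lee_fin; apply: le_trans (ler_norm _).
exact: diff_pairing_le.
Qed.

Lemma integral_EFin d (T : measurableType d) (m : {measure set T -> \bar R}) D (h : T -> R) :
  measurable D -> m.-integrable D (EFin \o h) ->
  (\int[m]_(x in D) (h x)%:E = (\int[m]_(x in D) h x)%:E)%E.
Proof. by move=> mD ih; rewrite /Rintegral fineK//; exact: integrable_fin_num. Qed.

(* The Young deficit of the nonlocal term: nonnegative, and zero only where the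
   increments of v and u agree up to sign. *)
Definition young_gap u v psi (z : 'rV[R]_N * 'rV[R]_N) : R :=
  (1 - p^-1) * diff_density u z + p^-1 * diff_density v z - diff_pairing u psi z.

Lemma young_gap_ge0 u v psi z : `|psi z.1 - psi z.2| <= `|v z.1 - v z.2| ->
  0 <= young_gap u v psi z.
Proof.
by move=> pv; rewrite subr_ge0 (le_trans (ler_norm _))// diff_pairing_le.
Qed.

Variables (gu : 'rV[R]_N -> 'rV[R]_N) (u F : 'rV[R]_N -> R).
Hypotheses (mgu : measurable_field gu u) (Eu : (field_energy gu u < +oo)%E).
Hypothesis Fint : forall psi, Cc1 Omega psi -> mu.-integrable Omega (fun x => (F x * psi x)%:E).
Hypothesis weak : forall psi, Cc1 Omega psi ->
  mu2.-integrable setT (EFin \o diff_pairing u psi) ->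
  \int[mu]_(x in Omega) flux_pairing gu (grad psi) x + \int[mu2]_z diff_pairing u psi z =
  \int[mu]_(x in Omega) (F x * psi x).

(* The weak form tested with [smooth_abs e \o phi], whose gradient is a multiple of
   grad phi by a factor in [-1, 1]. *)
Lemma young_test phi (e : R) : 0 < e -> Ccoo Omega phi -> (field_energy (grad phi) phi < +oo)%E ->
  (\int[mu]_(x in Omega) (F x * smooth_abs e (phi x))%:E +
   \int[mu2]_z (young_gap u phi (smooth_abs e \o phi) z)%:E <=
   (1 - p^-1)%:E * field_energy gu u + p^-1%:E * field_energy (grad phi) phi)%E.
Proof.
move=> e0 cphi Ephi; have [sphi _] := cphi; have Cphi := smooth_C1 sphi.
have mphi := measurable_field_C1 Omega Cphi.
pose psi := smooth_abs e \o phi; have cpsi : Cc1 Omega psi by exact: Cc1_smooth_abs.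
have mpsi := measurable_field_C1 Omega cpsi.1.
have [iu1 iu2] := field_energy_integrable oO alpha0 hH hw mgu Eu.
have [ip1 ip2] := field_energy_integrable oO alpha0 hH hw mphi Ephi.
have Hpsi x : H (grad psi x) <= H (grad phi x).
  rewrite grad_smooth_abs// (finslerZ hH) ler_piMl ?(finsler_ge0 hH)//.
  exact: smooth_abs_slope.
have Dpsi z : `|psi z.1 - psi z.2| <= `|phi z.1 - phi z.2| by exact: smooth_abs_lipschitz.
have if1 := flux_pairing_integrable mgu.1 mpsi.1 Hpsi iu1 ip1.
have if2 := diff_pairing_integrable mgu.2 mpsi.2 Dpsi iu2 ip2.
have mT : measurable [set: 'rV[R]_N * 'rV[R]_N] by exact: measurableT.
have iyl1 := integrable_scale mO (1 - p^-1) iu1; have iyl2 := integrable_scale mO p^-1 ip1.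
have iyn1 := integrable_scale mT (1 - p^-1) iu2; have iyn2 := integrable_scale mT p^-1 ip2.
have iyl := integrable_add mO iyl1 iyl2; have iyn := integrable_add mT iyn1 iyn2.
have iy := integrable_sub mT iyn if2.
(* The local pairing is estimated outright by Young's inequality, while the nonlocal one keeps its
   deficit, which becomes [young_gap]. *)
have hpair : \int[mu]_(x in Omega) flux_pairing gu (grad psi) x <=
    \int[mu]_(x in Omega) ((1 - p^-1) * grad_density gu x + p^-1 * grad_density (grad phi) x).
  apply: (le_Rintegral mO if1 iyl) => x _.
  by apply: le_trans (ler_norm _) _; exact: flux_pairing_le.
rewrite (RintegralD mO iyl1 iyl2) (RintegralZl _ mO iu1) (RintegralZl _ mO ip1) in hpair.
have hgap : \int[mu2]_z young_gap u phi psi z =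
    (1 - p^-1) * \int[mu2]_z diff_density u z + p^-1 * \int[mu2]_z diff_density phi z
    - \int[mu2]_z diff_pairing u psi z.
  rewrite /young_gap (RintegralB mT iyn if2).
  by rewrite (RintegralD mT iyn1 iyn2) (RintegralZl _ mT iu2) (RintegralZl _ mT ip2).
have real_ineq : \int[mu]_(x in Omega) (F x * psi x) + \int[mu2]_z young_gap u phi psi z <=
    (1 - p^-1) * (\int[mu]_(x in Omega) grad_density gu x + \int[mu2]_z diff_density u z) +
    p^-1 * (\int[mu]_(x in Omega) grad_density (grad phi) x + \int[mu2]_z diff_density phi z).
  by rewrite -(weak cpsi if2) hgap; exact: young_arith.
rewrite /field_energy (integral_EFin mO iu1) (integral_EFin mT iu2) (integral_EFin mO ip1) (integral_EFin mT ip2).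
by rewrite (integral_EFin mO (Fint cpsi)) (integral_EFin mT iy) -lee_fin in real_ineq *.
Qed.

End weak_form.

(** * Passage to the limit *)

Section fatou_ae.
Context {R : realType}.

(** Joins the two Fatou bounds, one for the source term and one for the gap, into a single lower
    limit. *)
Lemma limn_einfD_le (a b : (\bar R)^nat) : (forall n, (0 <= a n)%E) -> (forall n, (0 <= b n)%E) ->
  (limn_einf a + limn_einf b <= limn_einf (fun n => a n + b n))%E.
Proof.
move=> a0 b0; rewrite !limn_einf_lim.
have e0 (c : (\bar R)^nat) : (forall n, (0 <= c n)%E) -> (0 <= limn (einfs c))%E.
  move=> c0; apply: lime_ge; first exact: is_cvg_einfs.
  by apply: nearW => n; apply: le_ereal_inf_tmp => _ [k _ <-].
have cab : (einfs a n + einfs b n @[n --> \oo] --> limn (einfs a) + limn (einfs b))%E.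
  by apply: cvgeD; [apply: ge0_adde_def; rewrite inE; exact: e0|exact: is_cvg_einfs|exact: is_cvg_einfs].
rewrite -(cvg_lim _ cab)//; apply: lee_lim; [by apply/cvg_ex; eexists; exact: cab|exact: is_cvg_einfs|].
apply: nearW => n; apply: le_ereal_inf_tmp => _ [k nk <-].
by apply: leeD; apply: ereal_inf_lbound; exists k.
Qed.

Lemma limn_einf_le_cvg (a b : (\bar R)^nat) (l : \bar R) : (forall n, (a n <= b n)%E) ->
  b n @[n --> \oo] --> l -> (limn_einf a <= l)%E.
Proof.
move=> ab bl; rewrite -(cvg_limn_einf_sup bl).1 !limn_einf_lim.
apply: lee_lim; [exact: is_cvg_einfs|exact: is_cvg_einfs|].
apply: nearW => n; apply: le_ereal_inf_tmp => _ [k nk <-]; apply: le_trans (ab k).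
by apply: ereal_inf_lbound; exists k.
Qed.

Lemma fatou_ae d (T : measurableType d) (m : {measure set T -> \bar R}) (D : set T)
    (f_ : nat -> T -> R) (f : T -> R) : measurable D ->
  (forall n, measurable_fun D (f_ n)) -> measurable_fun D f ->
  (forall n x, 0 <= f_ n x) ->
  {ae m, forall x, D x -> f_ n x @[n --> \oo] --> f x} ->
  (\int[m]_(x in D) (f x)%:E <= limn_einf (fun n => \int[m]_(x in D) (f_ n x)%:E))%E.
Proof.
move=> mD mf_ mf f0 cf.
have mE n : measurable_fun D (fun x => (f_ n x)%:E) by exact/measurable_EFinP.
apply: le_trans (fatou m mD mE _); last by move=> n x _; rewrite lee_fin.
rewrite le_eqVlt; apply/orP; left; apply/eqP; apply: ae_eq_integral => //.
- exact/measurable_EFinP.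
- apply: (emeasurable_fun_cvg (fun n x => einfs (fun k => (f_ k x)%:E) n)).
    by move=> n; exact: (measurable_fun_einfs mE).
  by move=> x Dx; rewrite limn_einf_lim; exact: is_cvg_einfs.
- apply: filterS cf => x fx Dx; apply/esym.
  have : (f_ n x)%:E @[n --> \oo] --> (f x)%:E by apply: cvg_EFin; [exact: nearW|exact: fx].
  by move=> /cvg_limn_einf_sup[].
Qed.

(** The integrals sum to at most 1, so the series of the functions is finite a.e. and its terms tend
    to 0. The geometric rate makes the whole sequence converge, without passing to a subsequence. *)
Lemma ae_cvg0_summable d (T : measurableType d) (m : {measure set T -> \bar R})
    (f_ : nat -> T -> R) : (forall n, measurable_fun setT (f_ n)) -> (forall n x, 0 <= f_ n x) ->
  (forall n, (\int[m]_x (f_ n x)%:E <= (1 / (2 ^ (n + 1))%:R)%:E)%E) ->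
  {ae m, forall x, f_ n x @[n --> \oo] --> (0 : R)}.
Proof.
move=> mf f0 hf.
have mE n : measurable_fun setT (fun x => (f_ n x)%:E) by exact/measurable_EFinP.
have I : (\int[m]_x (\sum_(0 <= n <oo) (f_ n x)%:E) <= 1%:E)%E.
  rewrite integral_nneseries//; last by move=> n x _; rewrite lee_fin.
  have -> : ((1 : R)%:E = \sum_(0 <= n <oo) (1 / (2 ^ (n + 1))%:R)%:E)%E.
    have := @cvg_geometric_eseries_half R 1 0; rewrite expr0 divr1 => h.
    by apply/esym; exact: (cvg_lim (@ereal_hausdorff R) h).
  apply: lee_nneseries => [n _ _|n _]; last exact: hf.
  by apply: integral_ge0 => x _; rewrite lee_fin.
have ms : measurable_fun setT (fun x => \sum_(0 <= n <oo) (f_ n x)%:E)%E.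
  by apply: ge0_emeasurable_sum => // n x _ _; rewrite lee_fin.
have sint : m.-integrable setT (fun x => \sum_(0 <= n <oo) (f_ n x)%:E)%E.
  apply/integrableP; split => //; apply: le_lt_trans (ltry 1); apply: le_trans I.
  apply: ge0_le_integral => //.
  - exact: measurableT_comp.
  - by move=> x _; rewrite gee0_abs// nneseries_ge0// => n _ _; rewrite lee_fin.
have := integrable_ae measurableT sint; apply: filterS => x /(_ Logic.I) fx.
apply: cvg_series_cvg_0; apply: nnseries_is_cvg => //.
by move: fx; rewrite ge0_fin_numE// nneseries_ge0// => n _ _; rewrite lee_fin.
Qed.

Lemma ae_eq0_ge0 d (T : measurableType d) (m : {measure set T -> \bar R}) (h : T -> R) :
  measurable_fun setT h -> (forall x, 0 <= h x) -> (\int[m]_x (h x)%:E <= 0)%E ->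
  {ae m, forall x, h x = 0}.
Proof.
move=> mh h0 ih; have mE : measurable_fun setT (EFin \o h) by exact/measurable_EFinP.
have : (\int[m]_x `|(EFin \o h) x| = 0)%E.
  apply/eqP; rewrite eq_le integral_ge0 ?andbT//.
  by under eq_integral => x _ do rewrite gee0_abs ?lee_fin//.
move=> /(ae_eq_integral_abs m measurableT mE); apply: filterS => x /(_ Logic.I).
by move=> [].
Qed.

Lemma ge0_lty_fineK (x : \bar R) : (0 <= x)%E -> (x < +oo)%E -> x = (fine x)%:E.
Proof. by move=> x0 xoo; rewrite fineK// ge0_fin_numE. Qed.

Lemma cvg_powR (p : R) (a : nat -> R) (l : R) : 0 < p -> (forall n, 0 <= a n) -> 0 <= l ->
  a n @[n --> \oo] --> l -> a n `^ p @[n --> \oo] --> l `^ p.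
Proof.
move=> p0 a0 l0 al; have [l00|ln0] := eqVneq l 0.
  rewrite l00 powR0 ?gt_eqF//; apply/cvgrPdist_le => e e0.
  have e1 : 0 < e `^ p^-1 by rewrite powR_gt0.
  move/cvgrPdist_le : al => /(_ _ e1); apply: filterS => n.
  rewrite l00 !sub0r !normrN ger0_norm// ger0_norm ?powR_ge0// => ae.
  rewrite -[leRHS](@powRr1 _ e) ?(ltW e0)// -(mulVf (lt0r_neq0 p0)) powRrM.
  by apply: ge0_ler_powR; rewrite ?nnegrE ?powR_ge0// ltW.
have lp : 0 < l by rewrite lt_def ln0.
apply: (@continuous_cvg _ _ _ _ _ _ (fun x => x `^ p)) => //.
have [dl _] := is_derive1_powR p lp.
by apply: differentiable_continuous; apply/derivable1_diffP.
Qed.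

Lemma cvg0_powR (p : R) (a : nat -> R) : 0 < p -> (forall n, 0 <= a n) ->
  a n `^ p @[n --> \oo] --> (0 : R) -> a n @[n --> \oo] --> (0 : R).
Proof.
move=> p0 a0 al; have pV : 0 < p^-1 by rewrite invr_gt0.
have := cvg_powR pV (fun n => powR_ge0 (a n) p) (lexx 0) al.
rewrite powR0 ?gt_eqF// (eq_cvg _ (g := a))// => n.
by rewrite -powRrM mulfV ?gt_eqF// powRr1.
Qed.

End fatou_ae.

Section test_function_algebra.
Context {R : realType} {N : nat}.
Implicit Types (phi : 'rV[R]_N -> R) (Omega : set 'rV[R]_N).

Lemma Ccoo_Z Omega (c : R) phi : Ccoo Omega phi -> Ccoo Omega (fun x => c * phi x).
Proof.
move=> [sphi cphi]; split; first exact: smoothZ.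
by apply: csupp_sub cphi _ => x ->; rewrite mulr0.
Qed.

Lemma Ccoo_B Omega phi psi : Ccoo Omega phi -> Ccoo Omega psi ->
  Ccoo Omega (fun x => phi x - psi x).
Proof.
move=> [sphi cphi] [spsi cpsi].
have E : (fun x => phi x - psi x) = phi + (fun x => -1 * psi x).
  by apply/funext => x; rewrite -[RHS]/(phi x + -1 * psi x) mulN1r.
rewrite E; split; first by apply: smoothD => //; exact: smoothZ.
by apply: csuppD => //; apply: csupp_sub cpsi _ => x ->; rewrite mulr0.
Qed.

Lemma grad_Z (c : R) phi x : C1_on setT phi ->
  grad (fun x => c * phi x) x = c *: grad phi x.
Proof. by move=> Cphi; apply/rowP => i; rewrite !mxE partialZ. Qed.

Lemma grad_B phi psi x : C1_on setT phi -> C1_on setT psi ->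
  grad (fun x => phi x - psi x) x = grad phi x - grad psi x.
Proof.
move=> Cphi Cpsi; apply/rowP => i; rewrite !mxE.
rewrite -[LHS]/('D_(delta_mx ord0 i) (phi - psi) x) deriveB//.
  by have [] := Cphi x I i.
by have [] := Cpsi x I i.
Qed.

Lemma smooth_abs_cvg (a : nat -> R) (l : R) : a n @[n --> \oo] --> l ->
  smooth_abs n.+1%:R^-1 (a n) @[n --> \oo] --> `|l|.
Proof.
move=> al; have h0 : smooth_abs n.+1%:R^-1 (a n) - `|a n| @[n --> \oo] --> (0 : R).
  apply/norm_cvg0P; apply: (squeeze_cvgr _ (cvg_cst 0) (@cvg_harmonic R)).
  by apply: nearW => n; rewrite normr_ge0/=; apply: smooth_abs_dist; rewrite invr_gt0.
have h1 : (smooth_abs n.+1%:R^-1 (a n) - `|a n|) + `|a n| @[n --> \oo] --> 0 + `|l|.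
  by apply: cvgD => //; exact: cvg_norm.
rewrite add0r in h1; rewrite (eq_cvg _ _ (g := fun n => smooth_abs n.+1%:R^-1 (a n) - `|a n| + `|a n|))// => n.
by rewrite subrK.
Qed.

Lemma half_pow_cvg0 : (1 / (2 ^ (n + 1))%:R : R) @[n --> \oo] --> (0 : R).
Proof.
have h : (2^-1 : R) ^+ n * 2^-1 @[n --> \oo] --> 0 * (2^-1 : R).
  apply: cvgM; last exact: cvg_cst.
  by apply: cvg_expr; rewrite ger0_norm// invf_lt1// ltr1n.
rewrite mul0r in h; rewrite (eq_cvg _ _ (g := fun n => 2^-1 ^+ n * 2^-1))// => n.
by rewrite addn1 expnSr natrM div1r invfM natrX exprVn mulrC.
Qed.

Lemma half_pow_cvg (a b c d : R) :
  a + b * (c + d * (1 / (2 ^ (n + 1))%:R)) @[n --> \oo] --> a + b * c.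
Proof.
have h : a + b * (c + d * (1 / (2 ^ (n + 1))%:R)) @[n --> \oo] --> a + b * (c + d * 0).
  apply: cvgD; first exact: cvg_cst.
  apply: cvgM; first exact: cvg_cst.
  apply: cvgD; first exact: cvg_cst.
  apply: cvgM; first exact: cvg_cst.
  exact: half_pow_cvg0.
by rewrite mulr0 addr0 in h.
Qed.

End test_function_algebra.

(** * Energy identity of the solution, sharp inequality and rigidity *)

Section extremal.
Context {R : realType} {N : nat}.
Local Notation mu := (@lebesgue_rV R N).
Local Notation mu2 := (mu \x mu)%E.
Implicit Types (v phi psi : 'rV[R]_N -> R) (g k : 'rV[R]_N -> 'rV[R]_N).
Hypothesis hN : (0 < N)%N.
Variable Omega : set 'rV[R]_N.
Hypotheses (oO : open Omega) (Oc_gt0 : (0 < mu (~` Omega))%E).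
Variables (alpha s p : R).
Hypotheses (alpha0 : 0 < alpha) (p1 : 1 < p).
Variable H : 'rV[R]_N -> R.
Hypothesis hH : finsler_minkowski H.
Variable w : 'rV[R]_N -> R.
Hypothesis hw : weight w.

Let mO : measurable Omega := open_measurable_rV oO.
Let p0 : 0 < p := lt_trans ltr01 p1.

Local Notation grad_density := (grad_density p H w).
Local Notation diff_density := (diff_density alpha s p w).
Local Notation field_energy := (field_energy Omega alpha s p H w).
Local Notation measurable_field := (measurable_field Omega).
Local Notation diff_pairing := (diff_pairing alpha s p w).
Local Notation flux_pairing := (flux_pairing p H w).
Local Notation young_gap := (young_gap alpha s p w).

(** Membership in [W0] with an explicit field [g] carried along with [v]. That [g] is a weak
    gradient is deliberately forgotten: the limit arguments use only the approximation of the
    pair. *)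
Definition approximable g v := [/\ measurable_field g v, (field_energy g v < +oo)%E,
  {ae mu, forall x, ~ Omega x -> v x = 0} &
  forall e : R, 0 < e -> exists2 phi, Ccoo Omega phi &
    (field_energy (fun x => g x - grad phi x)%R (fun x => v x - phi x)%R < e%:E)%E].

Lemma approximableZ (c : R) g v : approximable g v ->
  approximable (fun x => c *: g x) (fun x => c * v x).
Proof.
move=> [mg Eg v0 app]; have mcg := measurable_fieldZ c mg.
have EZ (h : 'rV[R]_N -> 'rV[R]_N) y : measurable_field h y ->
    field_energy (fun x => c *: h x) (fun x => c * y x) = ((`|c| `^ p)%:E * field_energy h y)%E.
  by move=> mh; apply: field_energyZ.
split.
- exact: mcg.
- by rewrite (EZ _ _ mg) lte_mul_pinfty// lee_fin powR_ge0.
- by apply: filterS v0 => x v0 Ox; rewrite (v0 Ox) mulr0.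
- move=> e e0; have c0 : 0 <= `|c| `^ p by exact: powR_ge0.
  (* The added 1 keeps the tolerance well defined when [c = 0]. *)
  have [phi cphi Ephi] := app (e / (`|c| `^ p + 1)) ltac:(rewrite divr_gt0// ltr_pwDr).
  exists (fun x => c * phi x); first exact: Ccoo_Z.
  have [sphi _] := cphi; have Cphi := smooth_C1 sphi.
  rewrite (_ : (fun x => c *: g x - _) = (fun x => c *: (g x - grad phi x))); last first.
    by apply/funext => x; rewrite grad_Z// scalerBr.
  rewrite (_ : (fun x => c * v x - _) = (fun x => c * (v x - phi x))); last first.
    by apply/funext => x; rewrite mulrBr.
  rewrite EZ; last by apply: measurable_fieldB => //; exact: measurable_field_C1.
  apply: (@le_lt_trans _ _ ((`|c| `^ p)%:E * (e / (`|c| `^ p + 1))%:E)%E).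
    by apply: lee_wpmul2l; rewrite ?lee_fin// ltW.
  by rewrite -EFinM lte_fin mulrCA gtr_pMr// ltr_pdivrMr ?mul1r ?ltrDl// ltr_pwDr.
Qed.

(** Lets the limit inequality be applied to the error [u - phi] itself: an approximation [psi] of
    [v] yields [psi - phi] for [v - phi], with the same error. *)
Lemma approximableB g v phi : approximable g v -> Ccoo Omega phi ->
  (field_energy (fun x => g x - grad phi x)%R (fun x => v x - phi x)%R < +oo)%E ->
  approximable (fun x => g x - grad phi x) (fun x => v x - phi x).
Proof.
move=> [mg Eg v0 app] cphi Ephi; have [sphi kphi] := cphi; have Cphi := smooth_C1 sphi.
split; [|exact: Ephi| |].
- by apply: measurable_fieldB; [exact: mg|exact: measurable_field_C1].
- apply: filterS v0 => x v0 Ox; rewrite (v0 Ox) sub0r; apply/eqP; rewrite oppr_eq0; apply/eqP.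
  by apply: support_out => /kphi.2.
- move=> e e0; have [psi cpsi Epsi] := app e e0; have [spsi _] := cpsi; have Cpsi := smooth_C1 spsi.
  exists (fun x => psi x - phi x); first exact: Ccoo_B.
  rewrite (_ : (fun x => g x - _ - _) = (fun x => g x - grad psi x)); last first.
    by apply/funext => x; rewrite grad_B// opprB addrA subrK.
  rewrite (_ : (fun x => v x - _ - _) = (fun x => v x - psi x))//.
  by apply/funext => x; rewrite opprB addrA subrK.
Qed.

Lemma energy_diff_le g v : (\int[mu2]_z (diff_density v z)%:E <= field_energy g v)%E.
Proof.
rewrite leeDr//; apply: integral_ge0 => x _; rewrite lee_fin.
exact: grad_density_ge0.
Qed.

(* The energies of the errors are summable, so the increments of [phi n] converge
   a.e. on the product; freezing a point outside Omega turns this into pointwise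
   convergence without any Poincare inequality. *)
Lemma approx_cvg_ae g v (phi : nat -> 'rV[R]_N -> R) : measurable_field g v ->
  {ae mu, forall x, ~ Omega x -> v x = 0} -> (forall n, Ccoo Omega (phi n)) ->
  (forall n, (field_energy (fun x => g x - grad (phi n) x)%R (fun x => v x - phi n x)%R <
     (1 / (2 ^ (n + 1))%:R)%:E)%E) ->
  {ae mu, forall x, phi n x @[n --> \oo] --> v x}.
Proof.
move=> [mg mv] v0 cphi Ephi.
have mphi n : measurable_fun setT (phi n).
  apply: continuous_measurable_rV; apply: C1_continuous; apply: smooth_C1; exact: (cphi n).1.
have h : {ae mu2, forall z, diff_density (fun x => v x - phi n x) z @[n --> \oo] --> (0 : R)}.
  apply: ae_cvg0_summable.
  - by move=> n; apply: diff_density_measurable => //; exact: measurable_funB.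
  - by move=> n z; exact: diff_density_ge0.
  - move=> n; apply: le_trans (ltW (Ephi n)).
    exact: (energy_diff_le (fun x => g x - grad (phi n) x)).
have k0 := kernel_gt0_ae hN hw s p.
have h2 : {ae mu2, forall z, (v z.1 - phi n z.1 - (v z.2 - phi n z.2)) @[n --> \oo] --> (0 : R)}.
  apply: filterS2 h k0 => z hz kz; apply/norm_cvg0P; apply: (cvg0_powR p0) => //.
  have K0 : 0 < alpha * `|nonlocal_density w s p z| by rewrite mulr_gt0// normr_gt0 gt_eqF.
  have c0 : diff_density (fun x => v x - phi n x) z * (alpha * `|nonlocal_density w s p z|)^-1
      @[n --> \oo] --> 0 * (alpha * `|nonlocal_density w s p z|)^-1.
    by apply: cvgM => //; exact: cvg_cst.
  rewrite mul0r in c0; rewrite (eq_cvg _ _ (g := fun n => diff_density (fun x => v x - phi n x) z * (alpha * `|nonlocal_density w s p z|)^-1))// => n.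
  by rewrite /diff_density /= mulrCA mulfK ?gt_eqF.
have [x0 Ox0 [vx0 hx0]] := ae_pos_exists (measurableC mO) Oc_gt0
  (filterI v0 (ae_prod_xsection h2)).
apply: filterS hx0 => y /= hy.
have c0 : v x0 - phi n x0 - (v y - phi n y) + v y @[n --> \oo] --> 0 + v y.
  by apply: cvgD => //; exact: cvg_cst.
rewrite add0r in c0; rewrite (eq_cvg _ _ (g := fun n => v x0 - phi n x0 - (v y - phi n y) + v y))// => n.
have -> : phi n x0 = 0 by apply: support_out => /(cphi n).2.2.
by rewrite (vx0 Ox0); ring.
Qed.

Variables (gu : 'rV[R]_N -> 'rV[R]_N) (u F : 'rV[R]_N -> R).
Hypothesis app_u : approximable gu u.
Hypotheses (F0 : forall x, 0 <= F x) (mF : measurable_fun Omega F).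
Hypothesis Fint : forall psi, Cc1 Omega psi -> mu.-integrable Omega (fun x => (F x * psi x)%:E).
Hypothesis weak : forall psi, Cc1 Omega psi ->
  mu2.-integrable setT (EFin \o diff_pairing u psi) ->
  \int[mu]_(x in Omega) flux_pairing gu (grad psi) x + \int[mu2]_z diff_pairing u psi z =
  \int[mu]_(x in Omega) (F x * psi x).

Lemma young_gap_measurable v psi : measurable_fun setT v -> measurable_fun setT psi ->
  measurable_fun setT (young_gap u v psi).
Proof.
have [[_ mu'] _ _ _] := app_u.
move=> mv mpsi; apply: measurable_funB; last exact: (diff_pairing_measurable alpha s p hw mu' mpsi).
by apply: measurable_funD; apply: measurable_funM => //; exact: diff_density_measurable.
Qed.

(* The weak form for the nonsmooth and possibly inadmissible test function |v|, as an
   inequality. *)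
Lemma young_limit g v : approximable g v ->
  (\int[mu]_(x in Omega) (F x * `|v x|)%:E +
   \int[mu2]_z (young_gap u v (fun x => `|v x|) z)%:E <=
   (1 - p^-1)%:E * field_energy gu u + p^-1%:E * field_energy g v)%E.
Proof.
move=> [mgv Eg v0 app]; have [mgu Eu _ _] := app_u.
have /choice[phi phiP] : forall n : nat, exists phi, Ccoo Omega phi /\
    (field_energy (fun x => g x - grad phi x)%R (fun x => v x - phi x)%R < (1 / (2 ^ (n + 1))%:R)%:E)%E.
  move=> n; have [|phi cphi Ephi] := app (1 / (2 ^ (n + 1))%:R); last by exists phi.
  by rewrite divr_gt0// ltr0n expn_gt0.
have cphi n := (phiP n).1; have Ephi n := (phiP n).2.
have Cphi n := smooth_C1 (cphi n).1.
have mphi n := measurable_field_C1 Omega (Cphi n).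
pose e_ (n : nat) : R := n.+1%:R^-1; have e0 n : 0 < e_ n by rewrite invr_gt0.
pose psi n := smooth_abs (e_ n) \o phi n.
have Cpsi n : C1_on setT (psi n) by exact: C1_smooth_abs.
have mpsi n := (measurable_field_C1 Omega (Cpsi n)).2.
have cv := approx_cvg_ae mgv v0 cphi Ephi.
have cpsi : {ae mu, forall x, psi n x @[n --> \oo] --> `|v x|}.
  by apply: filterS cv => x vx; exact: smooth_abs_cvg vx.
have gap0 n z : 0 <= young_gap u (phi n) (psi n) z.
  by apply: young_gap_ge0 => //; exact: smooth_abs_lipschitz.
have A : (\int[mu]_(x in Omega) (F x * `|v x|)%:E <=
    limn_einf (fun n => \int[mu]_(x in Omega) (F x * psi n x)%:E))%E.
  apply: fatou_ae => //.
  - by move=> n; apply: measurable_funM => //; exact: measurable_funTS.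
  - by apply: measurable_funM => //; apply: measurable_funTS; apply: measurable_norm; exact: mgv.2.
  - by move=> n x; rewrite mulr_ge0//; have /andP[] := smooth_abs_le (phi n x) (e0 n).
  - by apply: filterS cpsi => x vx _; apply: cvgM => //; exact: cvg_cst.
have B : (\int[mu2]_z (young_gap u v (fun x => `|v x|) z)%:E <=
    limn_einf (fun n => \int[mu2]_z (young_gap u (phi n) (psi n) z)%:E))%E.
  apply: fatou_ae => //.
  - by move=> n; exact: young_gap_measurable (mphi n).2 (mpsi n).
  - by apply: young_gap_measurable; [exact: mgv.2|apply: measurable_norm; exact: mgv.2].
  - have c1 := @ae_prod_fst _ _ _ _ _ mu mu _ cv; have c2 := @ae_prod_snd _ _ _ _ _ mu mu _ cv.
    have d1 := @ae_prod_fst _ _ _ _ _ mu mu _ cpsi; have d2 := @ae_prod_snd _ _ _ _ _ mu mu _ cpsi.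
    have c12 : {ae mu2, forall z, phi n z.1 @[n --> \oo] --> v z.1 /\ phi n z.2 @[n --> \oo] --> v z.2}.
      by apply: filterS2 c1 c2 => z h1 h2; split.
    have d12 : {ae mu2, forall z, psi n z.1 @[n --> \oo] --> `|v z.1| /\ psi n z.2 @[n --> \oo] --> `|v z.2|}.
      by apply: filterS2 d1 d2 => z h1 h2; split.
    apply: filterS2 c12 d12 => z [z1 z2] [y1 y2] _.
    apply: cvgB; last first.
      apply: cvgM; first exact: cvg_cst.
      apply: cvgM; last exact: cvg_cst.
      apply: cvgM; first exact: cvg_cst.
      exact: cvgB.
    apply: cvgD; first exact: cvg_cst.
    apply: cvgM; first exact: cvg_cst.
    apply: cvgM; first exact: cvg_cst.
    apply: cvgM; last exact: cvg_cst.
    by apply: cvg_powR => //; apply: cvg_norm; exact: cvgB.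
have Ege0 h y : (0 <= field_energy h y)%E by exact: field_energy_ge0.
have fEu := ge0_lty_fineK (Ege0 gu u) Eu.
have Ev0 : 0 <= fine (field_energy g v) by apply: fine_ge0; exact: Ege0.
have fEv := ge0_lty_fineK (Ege0 g v) Eg.
set eu := fine _ in fEu; set ev := fine (field_energy g v) in Ev0 fEv *; clearbody eu ev.
have r0 : 0 < p^-1 by rewrite invr_gt0.
(* For fixed [l] the approximation errors disappear as [n] grows and leave the factor l^(1-p) on the
   energy of [v]; [l] is brought close to 1 only afterwards. *)
have AB (l : R) : 0 < l < 1 -> (\int[mu]_(x in Omega) (F x * `|v x|)%:E +
   \int[mu2]_z (young_gap u v (fun x => `|v x|) z)%:E <=
   ((1 - p^-1) * eu + p^-1 * (l `^ (1 - p) * ev))%:E)%E.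
  move=> l01; apply: le_trans (leeD A B) _; apply: le_trans (limn_einfD_le _ _) _.
  - move=> n; apply: integral_ge0 => x _; rewrite lee_fin mulr_ge0//.
    by have /andP[] := smooth_abs_le (phi n x) (e0 n).
  - by move=> n; apply: integral_ge0 => z _; rewrite lee_fin.
  pose c_ (n : nat) : R := (1 - p^-1) * eu + p^-1 * (l `^ (1 - p) * ev + (1 - l) `^ (1 - p) * (1 / (2 ^ (n + 1))%:R)).
  apply: (@limn_einf_le_cvg _ _ (fun n => (c_ n)%:E)).
    move=> n; have Eb : (field_energy (grad (phi n)) (phi n) <=
        (l `^ (1 - p) * ev + (1 - l) `^ (1 - p) * (1 / (2 ^ (n + 1))%:R))%:E)%E.
      apply: le_trans (field_energy_conv oO s alpha0 p1 hH hw l01 mgv (mphi n)) _.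
      rewrite EFinD !EFinM -fEv; apply: leeD => //.
      by apply: lee_wpmul2l; [rewrite lee_fin powR_ge0|exact: ltW].
    have Efin : (field_energy (grad (phi n)) (phi n) < +oo)%E by apply: le_lt_trans Eb _; exact: ltry.
    apply: le_trans (young_test hN oO alpha0 p1 hH hw mgu Eu Fint weak (e0 n) (cphi n) Efin) _.
    rewrite fEu /c_ [X in (_ <= X)%E]EFinD !EFinM; apply: leeD => //.
    by apply: lee_wpmul2l; rewrite ?lee_fin ?(ltW r0).
  apply: cvg_EFin; first exact: nearW.
  exact: half_pow_cvg.
rewrite fEu fEv; apply/lee_addgt0Pr => e e_gt0.
have re0 : 0 <= p^-1 * ev by rewrite mulr_ge0// ltW.
(* [c] is the value wanted for l^(1-p), hence l = c^(-1/(p-1)) below. The excess (c-1) ev / p is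
   then at most [e]. *)
pose c := 1 + e / (p^-1 * ev + 1).
have c1 : 1 < c by rewrite ltrDl divr_gt0// ltr_pwDr.
have c0 : 0 < c := lt_trans ltr01 c1.
have q0 : 0 < (p - 1)^-1 by rewrite invr_gt0 subr_gt0.
have l01 : 0 < c `^ (- (p - 1)^-1) < 1.
  rewrite powR_gt0//= powRN invf_lt1 ?powR_gt0//.
  have h1 : 1 `^ (p - 1)^-1 = 1 :> R by rewrite powR1.
  by rewrite -[X in X < _]h1; apply: gt0_ltr_powR; rewrite ?nnegrE ?ler01 ?(ltW c0).
have := AB _ l01; rewrite -powRrM mulNr -mulrN opprB mulVf ?powRr1 ?(ltW c0)//; last first.
  by rewrite gt_eqF// subr_gt0.
move=> h; apply: le_trans h _; rewrite -!EFinM -!EFinD lee_fin -addrA lerD2l.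
rewrite /c mulrDl mul1r mulrDr lerD2l mulrCA -mulrA ger_pMr//.
by rewrite ler_pdivrMl ?mulr1 ?lerDl// ltr_pwDr.
Qed.

Lemma young_limit_mass g v : approximable g v ->
  (\int[mu]_(x in Omega) (F x * `|v x|)%:E <=
   (1 - p^-1)%:E * field_energy gu u + p^-1%:E * field_energy g v)%E.
Proof.
move=> app; apply: le_trans (young_limit app); rewrite leeDl//.
apply: integral_ge0 => z _; rewrite lee_fin; apply: young_gap_ge0 => //.
exact: ler_dist_dist.
Qed.

(** Young's inequality for [c *: k], divided by [c]. The energy of [g] acquires the small factor
    1/c, and the factor c^p is harmless for an error [k] of energy below c^(-p). *)
Lemma flux_pairing_scaled_le g k (c : R) x : 0 < c ->
  flux_pairing g k x <= c^-1 * ((1 - p^-1) * grad_density g x + p^-1 * (c `^ p * grad_density k x)).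
Proof.
move=> c0; rewrite ler_pdivlMl//.
have -> : c * flux_pairing g k x = flux_pairing g (fun x => c *: k x) x.
  by rewrite /flux_pairing dotrZ mulrA.
have -> : c `^ p * grad_density k x = grad_density (fun x => c *: k x) x.
  by rewrite /grad_density (finslerZ hH) (gtr0_norm c0) powRM ?(ltW c0) ?finsler_ge0// mulrA.
apply: le_trans (ler_norm _) _.
by apply: flux_pairing_le.
Qed.

Lemma diff_pairing_scaled_le v psi (c : R) z : 0 < c ->
  diff_pairing v psi z <= c^-1 * ((1 - p^-1) * diff_density v z + p^-1 * (c `^ p * diff_density psi z)).
Proof.
move=> c0; rewrite ler_pdivlMl//.
have -> : c * diff_pairing v psi z = diff_pairing v (fun x => c * psi x) z.
  by rewrite /diff_pairing -mulrBr; ring.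
have -> : c `^ p * diff_density psi z = diff_density (fun x => c * psi x) z.
  by rewrite /diff_density /= -mulrBr (normrM c) (gtr0_norm c0) powRM ?(ltW c0)//; ring.
apply: le_trans (ler_norm _) _.
exact: diff_pairing_le.
Qed.

(* u is not an admissible test function; it is approximated by phi, and the error in
   both sides of the weak form is bounded by Young's inequality after scaling u - phi
   by a large factor c. *)
Lemma energy_self : (field_energy gu u <= \int[mu]_(x in Omega) (F x * `|u x|)%:E)%E.
Proof.
have [mgu Eu u0 app] := app_u.
have Ege0 h y : (0 <= field_energy h y)%E by exact: field_energy_ge0.
have mT : measurable [set: 'rV[R]_N * 'rV[R]_N] by exact: measurableT.
have r0 : 0 < p^-1 by rewrite invr_gt0.
have r1 : p^-1 < 1 by rewrite invf_lt1.
have mFabs v : measurable_fun setT v -> measurable_fun Omega (fun x => F x * `|v x|).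
  by move=> mv; apply: measurable_funM => //; apply: measurable_funTS; exact: measurable_norm.
have S_le := young_limit_mass app_u.
have fEu := ge0_lty_fineK (Ege0 gu u) Eu.
have Sfin : (\int[mu]_(x in Omega) (F x * `|u x|)%:E < +oo)%E.
  by apply: le_lt_trans S_le _; rewrite fEu -!EFinM -EFinD ltry.
have ige0 v : (0 <= \int[mu]_(x in Omega) (F x * `|v x|)%:E)%E.
  by apply: integral_ge0 => x _; rewrite lee_fin mulr_ge0.
have iF v : measurable_fun setT v -> (\int[mu]_(x in Omega) (F x * `|v x|)%:E < +oo)%E ->
    mu.-integrable Omega (EFin \o (fun x => F x * `|v x|)).
  move=> mv fv; apply/integrableP; split; first by apply/measurable_EFinP; exact: mFabs.
  by under eq_integral => x _ do rewrite gee0_abs ?lee_fin ?mulr_ge0//.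
have iFu := iF _ mgu.2 Sfin.
rewrite (integral_EFin mO iFu).
have [iu1 iu2] := field_energy_integrable oO alpha0 hH hw mgu Eu.
set A := \int[mu]_(x in Omega) grad_density gu x; set B := \int[mu2]_z diff_density u z.
have fEuAB : field_energy gu u = (A + B)%:E.
  by rewrite /field_energy (integral_EFin mO iu1) (integral_EFin mT iu2) -EFinD.
rewrite fEuAB lee_fin.
set S := \int[mu]_(x in Omega) (F x * `|u x|).
have A0 : 0 <= A by apply: Rintegral_ge0 => x _; exact: grad_density_ge0.
have B0 : 0 <= B by apply: Rintegral_ge0 => x _; exact: diff_density_ge0.
(* The factor 2 counts two errors, each at most (A+B+1)/c: one in the pairings and one in the
   right-hand side of the weak form. *)
suff key (c : R) : 0 < c -> A + B <= S + 2 * c^-1 * (A + B + 1).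
  apply/ler_addgt0Pr => e e0.
  have d0 : 0 < A + B + 1 by rewrite ltr_wpDl ?addr_ge0.
  have c0 : 0 < 2 * (A + B + 1) / e by rewrite divr_gt0// mulr_gt0.
  apply: le_trans (key _ c0) _; rewrite lerD2l le_eqVlt; apply/orP; left; apply/eqP.
  by field; rewrite gt_eqF// gt_eqF.
move=> c0; have cp0 : 0 < c `^ p by rewrite powR_gt0.
(* With this tolerance c (u - phi) has energy at most 1. *)
have [phi cphi] := app (c `^ p)^-1 ltac:(by rewrite invr_gt0).
pose k := fun x => gu x - grad phi x; pose chi := fun x => u x - phi x.
rewrite -/k -/chi => Ek; have [sphi kphi] := cphi; have Cphi := smooth_C1 sphi.
have mphi := measurable_field_C1 Omega Cphi.
have Ekoo : (field_energy k chi < +oo)%E by apply: lt_trans Ek _; exact: ltry.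
have appk : approximable k chi by apply: approximableB.
have [mk _ _ _] := appk.
have [ik1 ik2] := field_energy_integrable oO alpha0 hH hw mk Ekoo.
have fEk := ge0_lty_fineK (Ege0 k chi) Ekoo.
have Ephi : (field_energy (grad phi) phi < +oo)%E.
  have h2 : 0 < (2^-1 : R) < 1 by rewrite invr_gt0 ltr0n/= invf_lt1// ltr1n.
  apply: le_lt_trans (field_energy_conv oO s alpha0 p1 hH hw h2 mgu mphi) _.
  have fEu' := ge0_lty_fineK (Ege0 gu u) Eu; rewrite -/k -/chi fEu' fEk.
  by rewrite -!EFinM -EFinD ltry.
have [ip1 ip2] := field_energy_integrable oO alpha0 hH hw mphi Ephi.
have if1 := flux_pairing_integrable hN oO p1 hH hw mgu.1 mphi.1 (fun x => lexx _) iu1 ip1.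
have if2 := diff_pairing_integrable alpha0 p1 hw mgu.2 mphi.2 (fun x => lexx _) iu2 ip2.
have cc1 : Cc1 Omega phi by split.
have wk := weak cc1 if2.
set A' := \int[mu]_(x in Omega) grad_density k x.
set B' := \int[mu2]_z diff_density chi z.
have fEk2 : field_energy k chi = (A' + B')%:E.
  by rewrite EFinD -(integral_EFin mO ik1) -(integral_EFin mT ik2).
have Ek1 : c `^ p * (A' + B') <= 1.
  by move: Ek; rewrite fEk2 lte_fin => h; rewrite -ler_pdivlMl// mulr1 ltW.
(* By Euler's identity [A] integrates the pairing of [gu] with itself, which splits into the
   pairings with [grad phi] and with the error [k]. *)
have hA : A <= \int[mu]_(x in Omega) flux_pairing gu (grad phi) x +
    c^-1 * ((1 - p^-1) * A + p^-1 * (c `^ p * A')).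
  have j1 := integrable_scale mO (1 - p^-1) iu1.
  have j2 := integrable_scale mO (c `^ p) ik1.
  have j3 := integrable_scale mO p^-1 j2.
  have j4 := integrable_scale mO c^-1 (integrable_add mO j1 j3).
  rewrite -(RintegralZl _ mO iu1) -(RintegralZl _ mO ik1) -(RintegralZl _ mO j2).
  rewrite -(RintegralD mO j1 j3) -(RintegralZl _ mO (integrable_add mO j1 j3)) -(RintegralD mO if1 j4).
  apply: (le_Rintegral mO iu1 (integrable_add mO if1 j4)) => x _.
  have := flux_pairing_scaled_le gu k x c0; rewrite -lerBlDl; apply: le_trans.
  rewrite /flux_pairing /k dotrB mulrBl lerD2r.
  by rewrite (flux_self hN hH _ p1).
have hB : B <= \int[mu2]_z diff_pairing u phi z +
    c^-1 * ((1 - p^-1) * B + p^-1 * (c `^ p * B')).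
  have j1 := integrable_scale mT (1 - p^-1) iu2.
  have j2 := integrable_scale mT (c `^ p) ik2.
  have j3 := integrable_scale mT p^-1 j2.
  have j4 := integrable_scale mT c^-1 (integrable_add mT j1 j3).
  rewrite -(RintegralZl _ mT iu2) -(RintegralZl _ mT ik2) -(RintegralZl _ mT j2).
  rewrite -(RintegralD mT j1 j3) -(RintegralZl _ mT (integrable_add mT j1 j3)) -(RintegralD mT if2 j4).
  apply: (le_Rintegral mT iu2 (integrable_add mT if2 j4)) => z _.
  have := diff_pairing_scaled_le u chi z c0; rewrite -lerBlDl; apply: le_trans.
  have -> : diff_pairing u chi z = diff_density u z - diff_pairing u phi z.
    by rewrite /diff_pairing /chi /diff_density -(Jp_self _ p1); ring.
  by [].
have appck : approximable (fun x => c *: k x) (fun x => c * chi x) by exact: approximableZ.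
(* The source term of the error is controlled by the limit inequality itself, applied to [c * chi];
   this also shows that it is integrable. *)
have Lk := young_limit_mass appck.
have mcchi : measurable_fun setT (fun x => c * chi x) by apply: measurable_funM => //; exact: mk.2.
have fEck : field_energy (fun x => c *: k x) (fun x => c * chi x) = (c `^ p * (A' + B'))%:E.
  by rewrite field_energyZ// (gtr0_norm c0) fEk2.
rewrite fEck fEuAB -!EFinM -EFinD in Lk.
have iFk := iF _ mcchi (le_lt_trans Lk (ltry _)).
rewrite (integral_EFin mO iFk) lee_fin in Lk.
have iFk' := integrable_scale mO c^-1 iFk.
have hS : \int[mu]_(x in Omega) (F x * phi x) <= S + c^-1 * ((1 - p^-1) * (A + B) + p^-1 * (c `^ p * (A' + B'))).
  apply: (@le_trans _ _ (S + c^-1 * \int[mu]_(x in Omega) (F x * `|c * chi x|))); last first.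
    by rewrite lerD2l ler_wpM2l// invr_ge0 ltW.
  rewrite -(RintegralZl _ mO iFk) -(RintegralD mO iFu iFk').
  apply: (le_Rintegral mO (Fint cc1) (integrable_add mO iFu iFk')) => x _.
  rewrite normrM (gtr0_norm c0) mulrCA mulKf ?gt_eqF// -mulrDr ler_wpM2l//.
  have -> : phi x = u x - chi x by rewrite /chi opprB addrC subrK.
  by apply: le_trans (ler_norm _) _; exact: ler_normB.
have c10 : 0 < c^-1 by rewrite invr_gt0.
exact: (energy_self_arith r0 r1 c10 A0 B0 Ek1 hA hB wk hS).
Qed.

(** Since the kernel is positive a.e., zero nonlocal energy makes almost all increments vanish;
    freezing a point outside [Omega] fixes the constant value at 0. *)
Lemma diff_eq0_ae v : measurable_fun setT v -> {ae mu, forall x, ~ Omega x -> v x = 0} ->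
  (\int[mu2]_z (diff_density v z)%:E <= 0)%E -> {ae mu, forall x, v x = 0}.
Proof.
move=> mv v0 hv; have md := diff_density_measurable alpha s p hw mv.
have dd0 z : 0 <= diff_density v z by exact: diff_density_ge0.
have h := ae_eq0_ge0 md dd0 hv.
have k0 := kernel_gt0_ae hN hw s p.
have h2 : {ae mu2, forall z, v z.1 = v z.2}.
  apply: filterS2 h k0 => z /eqP; rewrite /diff_density mulf_eq0 gt_eqF//= mulf_eq0.
  move=> hz kz; apply/eqP; rewrite -subr_eq0 -normr_eq0; move: hz.
  have -> : (`|nonlocal_density w s p z| == 0) = false by rewrite normr_eq0 gt_eqF.
  by rewrite orbF powR_eq0 => /andP[].
have [x0 Ox0 [vx0 hx0]] := ae_pos_exists (measurableC mO) Oc_gt0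
  (filterI v0 (ae_prod_xsection h2)).
by apply: filterS hx0 => y /= <-; exact: vx0.
Qed.

(** A zero gap forces equality throughout Jp(U) D <= |U|^(p-1) |D| <= |U|^(p-1) |V| <= (1-1/p) |U|^p
    + |V|^p / p. The last equality gives |U| = |V|, then Jp(U) D = |U|^p gives D = U, and |V| = |D|
    means that the two values of [v] have the same sign. *)
Lemma young_gap_eq0 v z : 0 < nonlocal_density w s p z ->
  young_gap u v (fun x => `|v x|) z = 0 ->
  `|v z.1| - `|v z.2| = u z.1 - u z.2 /\ 0 <= v z.1 * v z.2.
Proof.
move=> k0; rewrite /young_gap /diff_density /diff_pairing.
set U := u z.1 - u z.2; set V := v z.1 - v z.2; set D := `|v z.1| - `|v z.2|; set k := `|nonlocal_density w s p z|.
have ak : alpha * k != 0 by rewrite mulf_neq0 ?gt_eqF// normr_gt0 gt_eqF.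
have -> : (1 - p^-1) * (alpha * (`|U| `^ p * k)) + p^-1 * (alpha * (`|V| `^ p * k)) -
  alpha * (Jp p U * D * k) = alpha * k * ((1 - p^-1) * `|U| `^ p + p^-1 * `|V| `^ p - Jp p U * D) by ring.
move=> /eqP; rewrite mulf_eq0 (negbTE ak)/= subr_eq0 => /eqP e.
have DV : `|D| <= `|V| by exact: ler_dist_dist.
have JD : Jp p U * D <= `|U| `^ (p - 1) * `|V|.
  apply: le_trans (ler_norm _) _; rewrite normrM Jp_norm//.
  by rewrite ler_wpM2l// powR_ge0.
have UV : `|U| = `|V|.
  apply: (powR_young_eq p1) => //; apply/eqP; rewrite eq_le powR_young//=.
  by rewrite e.
have DU : D = U.
  (* For [U = 0] the factor [Jp p U] cannot be cancelled; there |D| <= |V| = |U| already gives D =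
     0. *)
  have [U0|U0] := eqVneq U 0.
    move: DV; rewrite -UV U0 normr0 => DV; apply/eqP.
    by rewrite -normr_le0.
  have J0 : Jp p U != 0 by rewrite -normr_eq0 Jp_norm// powR_eq0 normr_eq0 (negbTE U0).
  apply: (mulfI J0); rewrite Jp_self// -e -UV.
  by rewrite -mulrDl subrK mul1r.
by split => //; apply: same_sign_dist; rewrite -/V -UV -DU.
Qed.

Hypothesis On0 : Omega !=set0.
Hypothesis u_gt0 : {ae mu, forall x, Omega x -> 0 < u x}.

Lemma rigidity v : measurable_fun setT v -> {ae mu, forall x, ~ Omega x -> v x = 0} ->
  (\int[mu2]_z (young_gap u v (fun x => `|v x|) z)%:E <= 0)%E ->
  exists e : R, {ae mu, forall x, v x = e * u x}.
Proof.
move=> mv v0 gap_le0; have [[_ mu'] _ u0 _] := app_u.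
have h : {ae mu2, forall z, young_gap u v (fun x => `|v x|) z = 0}.
  apply: ae_eq0_ge0 gap_le0; first by apply: young_gap_measurable => //; exact: measurable_norm.
  by move=> z; apply: young_gap_ge0 => //; exact: ler_dist_dist.
have k0 := kernel_gt0_ae hN hw s p.
have h2 : {ae mu2, forall z, `|v z.1| - `|v z.2| = u z.1 - u z.2 /\ 0 <= v z.1 * v z.2}.
  by apply: filterS2 h k0 => z hz kz; exact: young_gap_eq0.
have h3 := ae_prod_xsection h2.
have [x0 Ox0 [[vx0 ux0] hx0]] := ae_pos_exists (measurableC mO) Oc_gt0
  (filterI (filterI v0 u0) h3).
have absv : {ae mu, forall y, `|v y| = u y}.
  apply: filterS hx0 => y /= [+ _]; rewrite vx0// ux0// normr0 !sub0r.
  exact: oppr_inj.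
have [x1 Ox1 [[ux1 vx1] hx1]] := ae_pos_exists mO (open_lebesgue_gt0 oO On0)
  (filterI (filterI u_gt0 absv) h3).
have vx1_n0 : v x1 != 0 by rewrite -normr_gt0 vx1 ux1.
have [vpos|vneg] := ltP 0 (v x1).
- exists 1; apply: filterS2 absv hx1 => y <- [_]; rewrite pmulr_rge0// mul1r => vy.
  by rewrite ger0_norm.
- exists (-1); apply: filterS2 absv hx1 => y <- [_]; rewrite nmulr_rge0 ?lt_neqAle ?vx1_n0// => vy.
  by rewrite ler0_norm// mulN1r opprK.
Qed.

Variables (f0 : 'rV[R]_N -> R) (delta : R).
Hypotheses (delta01 : 0 < delta < 1) (f0_ge0 : forall x, 0 <= f0 x).
Hypotheses (mf0 : measurable_fun Omega f0) (FE : forall x, F x = f0 x * u x `^ (- delta)).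

Definition mass v : \bar R := (\int[mu]_(x in Omega) (`|v x| `^ (1 - delta) * f0 x)%:E)%E.

Lemma mass_measurable v : measurable_fun setT v ->
  measurable_fun Omega (fun x => `|v x| `^ (1 - delta) * f0 x).
Proof.
move=> mv; apply: measurable_funM => //.
apply: (measurableT_comp (measurable_powR _)); apply: measurable_funTS.
exact: measurable_norm.
Qed.

Lemma mass_ge0 v : (0 <= mass v)%E.
Proof. by apply: integral_ge0 => x _; rewrite lee_fin mulr_ge0 ?powR_ge0. Qed.

Lemma massZ (c : R) v : measurable_fun setT v ->
  mass (fun x => c * v x) = ((`|c| `^ (1 - delta))%:E * mass v)%E.
Proof.
move=> mv; rewrite /mass -ge0_integralZl_EFin ?powR_ge0//.
- by apply: eq_integral => x _; rewrite normrM powRM// -mulrA EFinM.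
- by move=> x _; rewrite lee_fin mulr_ge0 ?powR_ge0.
- by apply/measurable_EFinP; exact: mass_measurable.
Qed.

Lemma mass_ae0 v : measurable_fun setT v -> {ae mu, forall x, v x = 0} -> mass v = 0%E.
Proof.
move=> mv v0; rewrite -(integral0 mu Omega); apply: ae_eq_integral => //.
  by apply/measurable_EFinP; exact: mass_measurable.
apply: filterS v0 => x -> _; rewrite normr0 powR0 ?mul0r//.
by have /andP[_ d1] := delta01; rewrite gt_eqF ?subr_gt0.
Qed.

(** Where [u > 0], F |u| equals f u^(1-delta). One inequality is [energy_self]; the other is
    [young_limit_mass] with [v = u], where the coefficients 1 - 1/p and 1/p add up to 1. *)
Lemma mass_self : mass u = field_energy gu u.
Proof.
have [mgu Eu u0 app] := app_u.
have -> : mass u = (\int[mu]_(x in Omega) (F x * `|u x|)%:E)%E.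
  apply: ae_eq_integral => //.
  - by apply/measurable_EFinP; apply: mass_measurable; exact: mgu.2.
  - apply/measurable_EFinP/measurable_funM => //; apply: measurable_funTS.
    by apply: measurable_norm; exact: mgu.2.
  apply: filterS u_gt0 => x ux Ox; rewrite FE gtr0_norm ?ux//; congr EFin.
  rewrite [1 - delta]addrC powRD ?powRr1 ?(ltW (ux Ox))//; last by rewrite (gt_eqF (ux Ox)) implybT.
  by ring.
apply/eqP; rewrite eq_le energy_self andbT; apply: le_trans (young_limit_mass app_u) _.
have Ege0 : (0 <= field_energy gu u)%E by exact: field_energy_ge0.
rewrite (ge0_lty_fineK Ege0 Eu) -!EFinM -EFinD -mulrDl subrK mul1r.
exact: lexx.
Qed.

Lemma mass_le g v : approximable g v -> field_energy g v = field_energy gu u ->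
  (mass v + (1 - delta)%:E * \int[mu2]_z (young_gap u v (fun x => `|v x|) z)%:E
    <= field_energy gu u)%E.
Proof.
move=> app Ev; have /andP[d0 d1] := delta01.
have [[_ mv] _ _ _] := app; have [[_ mu'] Eu _ _] := app_u.
have mFv : measurable_fun Omega (fun x => F x * `|v x|).
  by apply: measurable_funM; [exact: mF|apply: measurable_funTS; exact: measurable_norm].
have Fv0 x : 0 <= F x * `|v x| by rewrite mulr_ge0.
have mu0 x : 0 <= `|u x| `^ (1 - delta) * f0 x by rewrite mulr_ge0 ?powR_ge0.
have mv0 x : 0 <= `|v x| `^ (1 - delta) * f0 x by rewrite mulr_ge0 ?powR_ge0.
have h1 : (mass v <= delta%:E * mass u + (1 - delta)%:E * \int[mu]_(x in Omega) (F x * `|v x|)%:E)%E.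
  have d2 : 0 <= 1 - delta by rewrite subr_ge0 ltW.
  apply: (ge0_integral_le_comb mO (ltW d0) d2 (mass_measurable mu') mFv (mass_measurable mv) mu0 Fv0 mv0).
  apply: filterS u_gt0 => x ux Ox; rewrite FE.
  have h := ler_wpM2r (f0_ge0 x) (powR_concave_tangent delta01 (normr_ge0 (v x)) (ux Ox)).
  by apply: le_trans h _; rewrite (gtr0_norm (ux Ox)) le_eqVlt; apply/orP; left; apply/eqP; ring.
have h2 := young_limit app; rewrite Ev in h2.
have Ege0 : (0 <= field_energy gu u)%E by exact: field_energy_ge0.
rewrite mass_self in h1; move: h1 h2; rewrite (ge0_lty_fineK Ege0 Eu).
move: (fine _) => E; rewrite -!EFinM -EFinD -mulrDl subrK mul1r => h1 h2.
set X := (\int[mu]_(x in Omega) (F x * `|v x|)%:E)%E in h1 h2.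
set G := integral _ _ _ in h2 *.
have G0 : (0 <= G)%E.
  apply: integral_ge0 => z _; rewrite lee_fin; apply: young_gap_ge0; [exact: alpha0|exact: p1|].
  exact: ler_dist_dist.
have X0 : (0 <= X)%E by apply: integral_ge0 => x _; rewrite lee_fin.
have Goo : (G < +oo)%E by apply: le_lt_trans (ltry E); apply: le_trans h2; rewrite leeDr.
have Xoo : (X < +oo)%E by apply: le_lt_trans (ltry E); apply: le_trans h2; rewrite leeDl.
have M0 := mass_ge0 v.
move: h1 h2; rewrite (ge0_lty_fineK G0 Goo) (ge0_lty_fineK X0 Xoo) -!EFinM -!EFinD => h1.
have Moo : (mass v < +oo)%E by apply: le_lt_trans h1 (ltry _).
move: h1; rewrite (ge0_lty_fineK M0 Moo) !lee_fin => h1 h2.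
exact: mass_arith d1 h1 h2.
Qed.

(** The right-hand side is the energy [e] times a positive power of l^(1-d) m / S, with l =
    (S/e)^(1/p). Scaling bounds this ratio by 1, so both the inequality and its equality case can be
    read off from it. *)
Lemma sobolev_quotientE (d S e m : R) : 0 < d < 1 -> 0 < S -> 0 < e -> 0 <= m ->
  S `^ ((1 - d - p) / (1 - d)) * m `^ (p / (1 - d)) =
  e * (((S / e) `^ p^-1) `^ (1 - d) * m / S) `^ (p / (1 - d)).
Proof.
move=> /andP[d0 d1] S0 e0 m0; have d2 : 1 - d != 0 by rewrite gt_eqF// subr_gt0.
set q := p / (1 - d); have q0 : 0 < q by rewrite divr_gt0// subr_gt0.
have a0 : 0 < S / e by rewrite divr_gt0.
rewrite -powRrM powRM ?mulr_ge0 ?powR_ge0 ?invr_ge0 ?(ltW S0)// powRM ?powR_ge0//.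
rewrite -powRrM (_ : p^-1 * (1 - d) * q = 1); last by rewrite /q; field; rewrite d2 gt_eqF.
rewrite powRr1 ?(ltW a0)// (_ : S^-1 `^ q = S `^ (- q)); last first.
  by rewrite -powR_inv1 ?(ltW S0)// -powRrM mulN1r.
rewrite (_ : (1 - d - p) / (1 - d) = 1 + - q); last by rewrite /q; field; rewrite d2.
rewrite powRD ?(gt_eqF S0) ?implybT// powRr1 ?(ltW S0)//.
by field; rewrite gt_eqF.
Qed.

Variable S : R.
Hypotheses (S0 : 0 < S) (ES : field_energy gu u = S%:E).

(* S / e is the factor bringing the p-homogeneous energy of v to that of u. *)
Lemma extremal_scaling g v (e : R) : approximable g v -> field_energy g v = e%:E -> 0 < e ->
  exists m : R, [/\ 0 <= m, mass v = m%:E,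
    ((S / e) `^ p^-1) `^ (1 - delta) * m <= S &
    ((S / e) `^ p^-1) `^ (1 - delta) * m = S -> exists k : R, {ae mu, forall x, v x = k * u x}].
Proof.
move=> app Ee e0; set l := (S / e) `^ p^-1; have l0 : 0 < l by rewrite powR_gt0// divr_gt0.
have /andP[d0 d1] := delta01; have [mv Ev v0 _] := app.
have app_l : approximable (fun x => l *: g x) (fun x => l * v x) by exact: approximableZ.
have El : field_energy (fun x => l *: g x) (fun x => l * v x) = field_energy gu u.
  rewrite field_energyZ// Ee ES -EFinM; congr EFin.
  rewrite gtr0_norm// /l -powRrM mulVf ?gt_eqF// powRr1 ?divr_ge0 ?ltW//.
  by rewrite divfK// gt_eqF.
have h := mass_le app_l El; rewrite ES massZ in h; last exact: mv.2.
rewrite (gtr0_norm l0) in h.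
have rig : (\int[mu2]_z (young_gap u (fun x => l * v x) (fun x => `|l * v x|) z)%:E <= 0)%E ->
    exists k : R, {ae mu, forall x, v x = k * u x}.
  move=> G_le0; have [mlv _ lv0 _] := app_l.
  have [k hk] := rigidity mlv.2 lv0 G_le0.
  exists (k / l); apply: filterS hk => x hk.
  by apply: (mulfI (lt0r_neq0 l0)); rewrite hk; field; rewrite gt_eqF.
have G0 : (0 <= \int[mu2]_z (young_gap u (fun x => (l * v x)%R) (fun x => `|l * v x|%R) z)%:E)%E.
  apply: integral_ge0 => z _; rewrite lee_fin; apply: young_gap_ge0; [exact: alpha0|exact: p1|].
  exact: ler_dist_dist.
have dd : 0 < 1 - delta by rewrite subr_gt0.
have L0 : 0 < l `^ (1 - delta) by rewrite powR_gt0.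
move: (integral _ _ _) (mass v) rig G0 h (mass_ge0 v) => G M rig G0 + M0.
move: (l `^ (1 - delta)) L0 => L L0 h {El app_l}.
have LM : (L%:E * M <= S%:E)%E by apply: le_trans h; rewrite leeDl// mule_ge0// lee_fin ltW.
have Moo : (M < +oo)%E.
  have : (M <= L^-1%:E * S%:E)%E by rewrite lee_pdivlMl.
  by move=> h2; apply: le_lt_trans h2 _; rewrite -EFinM ltry.
have fM := ge0_lty_fineK M0 Moo; rewrite fM in LM h *.
exists (fine M); split; [exact: fine_ge0|by []|exact: LM|].
(* In the equality case the scaled mass exhausts the bound [S] and leaves no room for a positive
   gap. *)
move=> eqS; apply: rig; rewrite -EFinM eqS in h.
case: G G0 h => [r| |] G0 h; last 2 first.
- by move: h; rewrite gt0_muley// ?lte_fin// addey.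
- by [].
- by move: h; rewrite -EFinM -EFinD lee_fin gerDl pmulr_rle0.
Qed.

Lemma extremal_ineq g v : approximable g v ->
  ((S `^ ((1 - delta - p) / (1 - delta)))%:E * mass v `^ (p / (1 - delta)) <= field_energy g v)%E /\
  (((S `^ ((1 - delta - p) / (1 - delta)))%:E * mass v `^ (p / (1 - delta)))%E = field_energy g v ->
    exists k : R, {ae mu, forall x, v x = k * u x}).
Proof.
move=> app; have [mv Ev v0 _] := app; have /andP[d0 d1] := delta01.
have Ege0 : (0 <= field_energy g v)%E by exact: field_energy_ge0.
have q0 : 0 < p / (1 - delta) by rewrite divr_gt0// subr_gt0.
have fE := ge0_lty_fineK Ege0 Ev; set e := fine _ in fE.
(* With zero energy the rescaling by S/e is meaningless, but then [v] is 0 a.e., both sides vanish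
   and [k = 0] works. *)
have [e0|e0] := leP e 0.
  have v_ae0 : {ae mu, forall x, v x = 0}.
    apply: diff_eq0_ae mv.2 v0 _; apply: le_trans (energy_diff_le g v) _.
    by rewrite fE lee_fin.
  split; last by move=> _; exists 0; apply: filterS v_ae0 => x ->; rewrite mul0r.
  by rewrite (mass_ae0 mv.2 v_ae0) poweR0r ?mule0// gt_eqF.
have [m [m0 -> mS hk]] := extremal_scaling app fE e0.
rewrite fE poweR_EFin -EFinM (sobolev_quotientE delta01 S0 e0 m0).
set a := (_ `^ _) `^ _ in mS hk *.
have am0 : 0 <= a * m / S by rewrite !mulr_ge0 ?powR_ge0// invr_ge0 ltW.
have am1 : a * m / S <= 1 by rewrite ler_pdivrMr// mul1r.
split.
  rewrite lee_fin ger_pMr//.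
  by apply: le_trans (ge0_ler_powR (ltW q0) _ _ am1) _; rewrite ?nnegrE// powR1.
(* Equality says that the ratio [a * m / S], already at most 1, has a positive power equal to 1;
   hence the ratio is 1 and the equality case of the scaling applies. *)
move=> [] /(canRL (mulKf (lt0r_neq0 e0))); rewrite mulVf ?gt_eqF// => h.
apply: hk; apply/eqP; rewrite eq_le mS/= -[leLHS]mul1r -ler_pdivlMr//.
rewrite leNgt; apply/negP => am_lt1.
have := gt0_ltr_powR q0 _ _ am_lt1; rewrite !nnegrE h powR1 ltxx => /(_ am0 ler01).
by [].
Qed.

End extremal.

(** * Functions in W0 *)

Section energy_norm_bounds.
Context {R : realType}.

Lemma poweR_inv_lt (p e : R) (x : \bar R) : 0 < p -> 0 < e -> (0 <= x)%E ->
  (x `^ p^-1 < e%:E)%E <-> (x < (e `^ p)%:E)%E.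
Proof.
move=> p0 e0; case: x => [x| |] //; last first.
  by move=> _; rewrite poweRyr ?invr_eq0 ?gt_eqF//; split.
rewrite lee_fin => x0; rewrite poweR_EFin !lte_fin; split => h.
- have := gt0_ltr_powR p0 _ _ h; rewrite !nnegrE powR_ge0 ltW// => /(_ isT isT).
  by rewrite -powRrM mulVf ?gt_eqF// powRr1.
- have pV : 0 < p^-1 by rewrite invr_gt0.
  have := gt0_ltr_powR pV _ _ h; rewrite !nnegrE powR_ge0 x0 => /(_ isT isT).
  by rewrite -powRrM mulfV ?gt_eqF// powRr1// ltW.
Qed.

Lemma poweR_inv_lty (p : R) (x : \bar R) : 0 < p -> (0 <= x)%E ->
  (x `^ p^-1 < +oo)%E <-> (x < +oo)%E.
Proof.
move=> p0; case: x => [x| |] //; last first.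
  by move=> _; rewrite poweRyr ?invr_eq0 ?gt_eqF.
by rewrite poweR_EFin !ltry.
Qed.

End energy_norm_bounds.

Section sobolev_space.
Context {R : realType} {N : nat}.
Local Notation mu := (@lebesgue_rV R N).
Local Notation mu2 := (mu \x mu)%E.
Hypothesis hN : (0 < N)%N.
Variable Omega : set 'rV[R]_N.
Hypothesis oO : open Omega.
Variables (alpha s p : R).
Hypotheses (alpha0 : 0 < alpha) (p1 : 1 < p).
Variable H : 'rV[R]_N -> R.
Hypothesis hH : finsler_minkowski H.
Variable w : 'rV[R]_N -> R.
Hypothesis hw : weight w.
Implicit Types (v phi : 'rV[R]_N -> R) (g : 'rV[R]_N -> 'rV[R]_N).

Local Notation field_energy := (field_energy Omega alpha s p H w).
Local Notation approximable := (approximable Omega alpha s p H w).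
Local Notation energy := (energy Omega p s alpha H w).
Local Notation W0 := (W0 Omega p s alpha H w).

Let mO : measurable Omega := open_measurable_rV oO.
Let p0 : 0 < p := lt_trans ltr01 p1.

Lemma energy_test_field v g phi : measurable_fun setT v -> weak_gradient Omega v g ->
  Ccoo Omega phi ->
  energy (v \- phi) = field_energy (fun x => g x - grad phi x) (fun x => v x - phi x).
Proof.
move=> mv vg [sphi _]; have Cphi := smooth_C1 sphi.
have wphi := weak_gradient_grad oO Cphi.
rewrite (energy_field hN oO s p alpha0 hH hw _ (weak_gradientB oO vg wphi))//.
by apply: measurable_funB => //; exact: (measurable_field_C1 Omega Cphi).2.
Qed.

(** [W0] measures approximation by the norm and [approximable] by its p-th power, so the tolerance
    [e] for the energy is requested as e^(1/p) for the norm. *)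
Lemma W0_approximable v : W0 v ->
  [/\ weak_gradient Omega v (wgrad Omega v), approximable (wgrad Omega v) v &
      energy v = field_energy (wgrad Omega v) v].
Proof.
move=> [mv v0 wv Ev app]; have vg := wgradP wv.
have eE := energy_field hN oO s p alpha0 hH hw mv vg.
have Ege0 h y : (0 <= field_energy h y)%E by exact: field_energy_ge0.
split; [exact: vg| |exact: eE]; split.
- by split; [exact: weak_gradient_measurable vg|exact: mv].
- by move: Ev; rewrite /energy_norm eE => /(poweR_inv_lty p0 (Ege0 _ _)).
- exact: v0.
- move=> e e0; have ep : 0 < e `^ p^-1 by rewrite powR_gt0.
  have [phi cphi] := app _ ep; rewrite /energy_norm (energy_test_field mv vg cphi).
  move=> /(poweR_inv_lt p0 ep (Ege0 _ _)); rewrite -powRrM mulVf ?gt_eqF// powRr1 ?(ltW e0)//.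
  by move=> h; exists phi.
Qed.

Lemma approximable_W0 v g : weak_gradient Omega v g -> approximable g v -> W0 v.
Proof.
move=> vg [[mg mv] Ev v0 app].
have Ege0 h y : (0 <= field_energy h y)%E by exact: field_energy_ge0.
split; [exact: mv|exact: v0|by exists g| |].
- rewrite /energy_norm (energy_field hN oO s p alpha0 hH hw mv vg).
  by apply/(poweR_inv_lty p0 (Ege0 _ _)).
- move=> e e0; have ep : 0 < e `^ p by rewrite powR_gt0.
  have [phi cphi Ephi] := app _ ep; exists phi => //.
  rewrite /energy_norm (energy_test_field mv vg cphi).
  by apply/(poweR_inv_lt p0 e0 (Ege0 _ _)).
Qed.

Lemma W0_Z (c : R) v : W0 v ->
  W0 (fun x => c * v x) /\ energy (fun x => c * v x) = ((`|c| `^ p)%:E * energy v)%E.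
Proof.
move=> /W0_approximable [vg app ->]; have cvg := weak_gradientZ oO c vg.
have [mv _ _ _] := app.
split; first by apply: (approximable_W0 cvg); exact: approximableZ.
rewrite (energy_field hN oO s p alpha0 hH hw _ cvg); first by rewrite field_energyZ.
by apply: measurable_funM => //; exact: mv.2.
Qed.

End sobolev_space.

(** * Integrability of the datum and positivity of the solution *)

Section datum.
Context {R : realType} {N : nat}.
Local Notation mu := (@lebesgue_rV R N).
Local Notation mu2 := (mu \x mu)%E.

(** In the first case [m] is conjugate to l = p_t^* / (1-delta), and l > 1 because (1-delta)(N-p_t)
    < N - p_t < N <= N p_t. The bound on [m] serves to place [f] in L^1. *)
Lemma datum_exponent_ge1 (p t delta m : R) : 0 < delta < 1 -> datum_exponent N p t delta m -> 1 <= m.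
Proof.
move=> /andP[d0 d1]; rewrite /datum_exponent; set pt := p * t / (t + 1).
case=> [[/andP[pt1 ptN] ->]|[_ /ltW//]|[_ ->//]].
set l := _ / (1 - delta); suff l1 : 1 < l.
  by rewrite ler_pdivlMr ?subr_gt0// mul1r gerBl ler01.
rewrite /l ltr_pdivlMr ?subr_gt0// mul1r ltr_pdivlMr ?subr_gt0//.
have n0 : 0 < N%:R :> R by apply: lt_trans ptN; apply: lt_le_trans pt1.
have pt0 : 0 < pt := lt_le_trans ltr01 pt1.
apply: (@lt_trans _ _ (N%:R - pt)).
  by rewrite gtr_pMl ?subr_gt0// gtrBl.
by apply: (@lt_le_trans _ _ N%:R); rewrite ?gtrBl// ler_peMr// ltW.
Qed.

Lemma bounded_measure_lty (Omega : set 'rV[R]_N) : open Omega -> bounded_set Omega ->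
  (mu Omega < +oo)%E.
Proof.
move=> oO /bounded_set_cube[M OM]; apply: le_lt_trans (@lebesgue_rV_cube_fin R N M); have mO := open_measurable_rV oO.
have mC := compact_measurable_rV (@compact_cube R N M).
apply: le_measure; rewrite ?inE//.
Qed.

(** The points within sup distance 1 of [c] have coordinates above [|M| + 1], hence lie outside the
    cube that contains [Omega]. This provides the outer points at which increments are frozen. *)
Lemma bounded_setC_gt0 (Omega : set 'rV[R]_N) : (0 < N)%N -> open Omega -> bounded_set Omega ->
  (0 < mu (~` Omega))%E.
Proof.
move=> hN oO /bounded_set_cube[M OM]; pose c : 'rV[R]_N := const_mx (`|M| + 2).
apply: lt_le_trans (lebesgue_rV_open_cube_gt0 c (@ltr01 R)) _.
have mC : measurable [set x : 'rV[R]_N | forall i, `|c ord0 i - x ord0 i| < 1].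
  apply: (measurable_box (A := fun i => [set t | `|c ord0 i - t| < 1])) => i.
  rewrite (_ : [set t | _] = ball (c ord0 i) 1)//; exact: measurable_ball.
have mOc := measurableC (open_measurable_rV oO).
apply: le_measure; rewrite ?inE//.
move=> x /= cx /OM /(_ (Ordinal hN)) hx; have := cx (Ordinal hN); rewrite mxE.
move: hx; rewrite ler_norml => /andP[_ hx]; rewrite ltr_norml => /andP[_].
have := ler_norm M; lra.
Qed.

(** The bound |f| <= 1 + |f|^m, integrated over a set of finite measure. *)
Lemma in_Lp_integrable (Omega : set 'rV[R]_N) (m : R) (f : 'rV[R]_N -> R) : measurable Omega ->
  (mu Omega < +oo)%E -> 1 <= m -> in_Lp Omega m f ->
  mu.-integrable Omega (EFin \o (fun x => `|f x|)).
Proof.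
move=> mO Ooo m1 [mf fm].
have mabs : measurable_fun Omega (fun x => `|f x|) by exact: (measurableT_comp (@normr_measurable R setT)).
have mpow : measurable_fun Omega (fun x => `|f x| `^ m) by exact: (measurableT_comp (measurable_powR _)).
apply/integrableP; split; first exact/measurable_EFinP.
have h := @ge0_integral_le_comb _ _ _ mu Omega 1 1 (cst 1) (fun x => `|f x| `^ m) (fun x => `|f x|)
  mO ler01 ler01 (measurable_cst _) mpow mabs (fun=> ler01) (fun x => powR_ge0 _ _)
  (fun x => normr_ge0 _).
under eq_integral => x _ do rewrite gee0_abs ?lee_fin//.
apply: le_lt_trans (h _) _; last first.
  rewrite !mul1e (_ : (fun x => (cst 1 x)%:E) = cst 1%:E)// integral_cst// mul1e lte_add_pinfty//.
apply: aeW => x _ /=; rewrite !mul1r.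
have [f1|f1] := leP `|f x| 1; first by rewrite (le_trans f1)// lerDl powR_ge0.
apply: (@le_trans _ _ (`|f x| `^ m)); last by rewrite lerDr.
rewrite -[leLHS]powRr1//; apply: ler_powR => //; exact: ltW.
Qed.

(** The local lower bounds are applied to countably many compact boxes covering [Omega], so that
    only countably many null sets are discarded. *)
Lemma exhausted_ae_pos (Omega : set 'rV[R]_N) (u : 'rV[R]_N -> R) : open Omega -> Omega !=set0 ->
  (forall omega : set 'rV[R]_N, compact (closure omega) -> closure omega `<=` Omega ->
     exists2 C : R, 0 < C & {ae mu, forall x, omega x -> C <= u x}) ->
  {ae mu, forall x, Omega x -> 0 < u x}.
Proof.
move=> oO On0 hC; have [a [b [abO Oab]]] := open_box_cover oO On0.
have h n : {ae mu, forall x, cbox (a n) (b n) x -> 0 < u x}.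
  have cl : closure (cbox (a n) (b n)) = cbox (a n) (b n).
    by apply/esym; rewrite -closure_id; exact: cbox_closed.
  have [||C C0] := hC (cbox (a n) (b n)); rewrite ?cl.
  - exact: cbox_compact.
  - exact: abO.
  - by apply: filterS => x hx cx; exact: lt_le_trans C0 (hx cx).
have := ae_foralln h; apply: filterS => x hx Ox.
have [n _ abx] := Oab x Ox; apply: (hx n); exact: obox_cbox.
Qed.

(** On the compact support of [psi] the solution is at least some C > 0, so u^(-delta) is at most
    C^(-delta) there and the product is dominated by a multiple of [|f|]. *)
Lemma singular_integrable (Omega : set 'rV[R]_N) (delta : R) (f u psi : 'rV[R]_N -> R) :
  open Omega -> 0 < delta -> mu.-integrable Omega (EFin \o (fun x => `|f x|)) -> measurable_fun Omega f ->
  measurable_fun setT u ->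
  (forall omega : set 'rV[R]_N, compact (closure omega) -> closure omega `<=` Omega ->
     exists2 C : R, 0 < C & {ae mu, forall x, omega x -> C <= u x}) ->
  Cc1 Omega psi -> mu.-integrable Omega (fun x => (`|f x| * u x `^ (- delta) * psi x)%:E).
Proof.
move=> oO d0 fi mf mu' hC [Cpsi [kpsi psiO]].
have mO := open_measurable_rV oO.
have [C C0 uC] := hC _ kpsi psiO.
have [B hB] := continuous_bounded_on_compact (C1_continuous Cpsi) kpsi.
have psiB x : `|psi x| <= `|B|.
  have [/hB h|h] := pselect (closure [set x | psi x != 0] x).
    by apply: le_trans h (ler_norm _).
  by rewrite support_out// normr0.
have mabs : measurable_fun Omega (fun x => `|f x|) by exact: (measurableT_comp (@normr_measurable R setT)).
have mh : measurable_fun Omega (fun x => `|f x| * u x `^ (- delta) * psi x).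
  apply: measurable_funM; last first.
    by apply: measurable_funTS; apply: continuous_measurable_rV; exact: C1_continuous.
  apply: measurable_funM => //; apply: (measurableT_comp (measurable_powR _)).
  exact: measurable_funTS.
have fi2 := integrable_scale mO (C `^ (- delta) * `|B|) fi.
apply/integrableP; split; first exact/measurable_EFinP.
apply: le_lt_trans (integrableP _ _ _ fi2).2.
apply: ae_ge0_le_integral => //.
- by apply/measurable_EFinP; exact: (measurableT_comp (@normr_measurable R setT)).
- by apply/measurable_EFinP; apply: (measurableT_comp (@normr_measurable R setT)); exact: measurable_funM.
apply: filterS uC => x uC Ox; rewrite /= lee_fin !normrM !normr_id.
have [p0|p0] := eqVneq (psi x) 0.
  by rewrite p0 normr0 mulr0 !mulr_ge0.
have ux : C <= u x by exact: uC.
have u0 : 0 < u x := lt_le_trans C0 ux.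
rewrite -mulrA [leRHS]mulrC ler_wpM2l// !(ger0_norm (powR_ge0 _ _)) ler_pM ?powR_ge0//.
rewrite !powRN lef_pV2 ?posrE ?powR_gt0//; by apply: ge0_ler_powR; rewrite ?nnegrE ?(ltW C0) ?(ltW u0) ?(ltW d0).
Qed.

End datum.

Section weak_solutions.
Context {R : realType} {N : nat}.
Local Notation mu := (@lebesgue_rV R N).
Local Notation mu2 := (mu \x mu)%E.
Hypothesis hN : (0 < N)%N.
Variable Omega : set 'rV[R]_N.
Hypothesis oO : open Omega.
Variables (alpha s p delta : R).
Hypotheses (alpha0 : 0 < alpha) (p1 : 1 < p) (delta0 : 0 < delta).
Variable H : 'rV[R]_N -> R.
Hypothesis hH : finsler_minkowski H.
Variable w : 'rV[R]_N -> R.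
Hypothesis hw : weight w.
Implicit Types (u v psi : 'rV[R]_N -> R).
Let mO : measurable Omega := open_measurable_rV oO.

(** Rewrites the weak equation with absolute values of the datum, the weight and the kernel, and
    with [alpha] inside the nonlocal integral. Moving [alpha] inside relies on the integrability of
    the pairing, hence that premise. *)
Lemma weak_form (f u psi : 'rV[R]_N -> R) (gu : 'rV[R]_N -> 'rV[R]_N) :
  measurable_fun Omega f -> {ae mu, forall x, Omega x -> 0 <= f x} ->
  measurable_field Omega gu u -> Cc1 Omega psi ->
  mu.-integrable Omega (fun x => (`|f x| * u x `^ (- delta) * psi x)%:E) ->
  mu2.-integrable setT (EFin \o diff_pairing alpha s p w u psi) ->
  \int[mu]_(x in Omega) (dotr (flux p H (gu x)) (grad psi x) * w x)
    + alpha * \int[mu2]_z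
        (Jp p (u z.1 - u z.2) * (psi z.1 - psi z.2) * nonlocal_density w s p z)
    = \int[mu]_(x in Omega) (f x * u x `^ (- delta) * psi x) ->
  \int[mu]_(x in Omega) flux_pairing p H w gu (grad psi) x +
    \int[mu2]_z diff_pairing alpha s p w u psi z =
  \int[mu]_(x in Omega) (`|f x| * u x `^ (- delta) * psi x).
Proof.
move=> mf fge0 [mgu mu'] [Cpsi _] iF iD.
have [mgpsi mpsi] := measurable_field_C1 Omega Cpsi.
have mw := weight_measurable hw; have [_ w0] := hw.
have mflux : measurable_fun Omega (fun x => dotr (flux p H (gu x)) (grad psi x)).
  rewrite /dotr; apply: measurable_sum => i; apply: measurable_funM => //.
  apply: (field_comp_measurable oO (h := fun xi => flux p H xi ord0 i)) => //.
  exact: (flux_measurable hH).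
have -> : \int[mu]_(x in Omega) (dotr (flux p H (gu x)) (grad psi x) * w x) =
    \int[mu]_(x in Omega) flux_pairing p H w gu (grad psi) x.
  congr fine; apply: ae_eq_integral => //.
  - by apply/measurable_EFinP; apply: measurable_funM => //; exact: measurable_funTS.
  - by apply/measurable_EFinP; apply: flux_pairing_measurable.
  - by apply: filterS w0 => x w0 _; rewrite /flux_pairing gtr0_norm.
have -> : \int[mu]_(x in Omega) (f x * u x `^ (- delta) * psi x) =
    \int[mu]_(x in Omega) (`|f x| * u x `^ (- delta) * psi x).
  congr fine; apply: ae_eq_integral => //.
  - apply/measurable_EFinP; apply: measurable_funM; last exact: measurable_funTS.
    apply: measurable_funM => //; apply: (measurableT_comp (measurable_powR _)).
    exact: measurable_funTS.
  - exact: measurable_int iF.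
  - by apply: filterS fge0 => x f0 Ox; rewrite ger0_norm// f0.
move=> <-; congr (_ + _).
have mT : measurable [set: 'rV[R]_N * 'rV[R]_N] by exact: measurableT.
pose h (z : 'rV[R]_N * 'rV[R]_N) := Jp p (u z.1 - u z.2) * (psi z.1 - psi z.2) * `|nonlocal_density w s p z|.
have mJ : measurable_fun setT (fun z : 'rV[R]_N * 'rV[R]_N => Jp p (u z.1 - u z.2) * (psi z.1 - psi z.2)).
  apply: measurable_funM; last exact: measurable_diff.
  by apply: (measurableT_comp (Jp_measurable p)); exact: measurable_diff.
have -> : \int[mu2]_z (Jp p (u z.1 - u z.2) * (psi z.1 - psi z.2) * nonlocal_density w s p z) =
    \int[mu2]_z h z.
  congr fine; apply: ae_eq_integral => //.
  - by apply/measurable_EFinP; apply: measurable_funM => //; exact: (kernel_measurable hw s p).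
  - by apply/measurable_EFinP; apply: measurable_funM => //; exact: (kernel_norm_measurable s p hw).
  - have := kernel_gt0_ae hN hw s p.
    by apply: filterS => z z0 _; rewrite /h (gtr0_norm z0).
have ih : mu2.-integrable setT (EFin \o h).
  have := integrable_scale mT alpha^-1 iD.
  congr (mu2.-integrable _ _); apply/funext => z /=; congr EFin.
  by rewrite /diff_pairing mulKf// gt_eqF.
by rewrite -(RintegralZl _ mT ih).
Qed.

End weak_solutions.

(** * Normalization of the solution and the value of [Theta] *)

Theorem theorem1p2 (R : realType) (N : nat) (hN : (2 <= N)%N)
  (Omega : set 'rV[R]_N) (hOmega : bounded_lipschitz_domain Omega)
  (alpha s p delta t m : R) (halpha : 0 < alpha) (hs : 0 < s < 1) (hp : 1 < p)
  (hdelta : 0 < delta < 1)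
  (H : 'rV[R]_N -> R) (hH : finsler_minkowski H)
  (w : 'rV[R]_N -> R) (hw : muckenhoupt_t Omega p t w)
  (hm : datum_exponent N p t delta m)
  (f : 'rV[R]_N -> R) (hfm : in_Lp Omega m f)
  (hf0 : {ae lebesgue_rV N, forall x, Omega x -> 0 <= f x})
  (hf : ~ {ae lebesgue_rV N, forall x, Omega x -> f x = 0})
  (u : 'rV[R]_N -> R) (hu : weak_solution Omega p s alpha H w delta f u) :
  [/\ Theta Omega p s alpha H w delta f =
        (energy Omega p s alpha H w u `^ ((1 - delta - p) / (1 - delta)))%E,
      forall C : R,
        (forall v, W0 Omega p s alpha H w v ->
          (C%:E * singular_mass Omega delta f v `^ (p / (1 - delta))
             <= energy Omega p s alpha H w v)%E)
        <-> (C%:E <= Theta Omega p s alpha H w delta f)%E &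
      forall v, W0 Omega p s alpha H w v ->
        (Theta Omega p s alpha H w delta f *
           singular_mass Omega delta f v `^ (p / (1 - delta))
         = energy Omega p s alpha H w v)%E ->
        exists k : R, {ae lebesgue_rV N, forall x, v x = k * u x}].
Proof.
have hN0 : (0 < N)%N by exact: ltn_trans hN.
have [oO _ On0 bO _] := hOmega.
have mO := open_measurable_rV oO.
have Ooo := bounded_measure_lty oO bO.
have Oc := bounded_setC_gt0 hN0 oO bO.
have [_ _ [ww _] _] := hw.
have [W0u uC wf] := hu.
have /andP[d0 d1] := hdelta.
have dd : 0 < 1 - delta by rewrite subr_gt0.
have fi := in_Lp_integrable mO Ooo (datum_exponent_ge1 hdelta hm) hfm.
have [mf _] := hfm.
have u_gt0 := exhausted_ae_pos oO On0 uC.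
have [vgu app_u Eu] := W0_approximable hN0 oO halpha hp hH ww W0u.
have [mu_u Eu_fin _ _] := app_u.
(* [f] is nonnegative only a.e.; its absolute value makes the source term nonnegative everywhere, as
   the limit arguments assume. *)
pose F x := `|f x| * u x `^ (- delta).
have F0 x : 0 <= F x by rewrite mulr_ge0 ?powR_ge0.
have mabs : measurable_fun Omega (fun x => `|f x|).
  exact: (measurableT_comp (@normr_measurable R setT)).
have mF : measurable_fun Omega F.
  apply: measurable_funM => //; apply: (measurableT_comp (measurable_powR _)).
  by apply: measurable_funTS; exact: mu_u.2.
have Fint psi (cpsi : Cc1 Omega psi) :=
  singular_integrable oO d0 fi mf mu_u.2 uC cpsi.
have weak psi (cpsi : Cc1 Omega psi)
    (ipsi : (lebesgue_rV N \x lebesgue_rV N)%E.-integrable setT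
       (EFin \o diff_pairing alpha s p w u psi)) :=
  weak_form hN0 oO halpha hH ww mf hf0 mu_u cpsi (Fint psi cpsi) ipsi (wf psi cpsi).
have f0ge0 x : 0 <= `|f x| by exact: normr_ge0.
have massE v : measurable_fun setT v ->
    singular_mass Omega delta f v = mass Omega (fun x => `|f x|) delta v.
  move=> mv; apply: ae_eq_integral => //.
  - apply/measurable_EFinP; apply: measurable_funM => //.
    apply: (measurableT_comp (measurable_powR _)); apply: measurable_funTS.
    exact: measurable_norm.
  - by apply/measurable_EFinP; exact: mass_measurable.
  - by apply: filterS hf0 => x f0 Ox; rewrite (ger0_norm (f0 Ox)).
have Ms := mass_self hN0 oO Oc halpha hp hH ww app_u F0 mF Fint weak u_gt0 mabs (fun=> erefl).
have Ege0 v : (0 <= field_energy Omega alpha s p H w (wgrad Omega v) v)%E.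
  exact: field_energy_ge0.
have ES := ge0_lty_fineK (Ege0 u) Eu_fin.
move: (fine _) ES => S ES.
have S_ge0 : 0 <= S by rewrite -lee_fin -ES.
(* If the energy were 0, so would be the mass of [u]; since [u > 0] a.e. in [Omega], this would
   force [f = 0] a.e. *)
have S0 : 0 < S.
  rewrite lt_neqAle S_ge0 andbT; apply/negP => /eqP S00; apply: hf.
  rewrite ES -S00 in Ms.
  have mm := mass_measurable delta mabs mu_u.2.
  have mE : measurable_fun Omega (fun x => (`|u x| `^ (1 - delta) * `|f x|)%:E).
    exact/measurable_EFinP.
  have : (\int[lebesgue_rV N]_(x in Omega) `|(`|u x| `^ (1 - delta) * `|f x|)%:E| = 0)%E.
    by apply: etrans Ms; apply: eq_integral => x _; rewrite gee0_abs// lee_fin mulr_ge0// ?powR_ge0.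
  move=> /(ae_eq_integral_abs _ mO mE); apply: filterS2 u_gt0 => x ux h Ox.
  have /eqP := h Ox; rewrite eqe mulf_eq0 normr_eq0 => /orP[|/eqP//].
  by rewrite powR_eq0 normr_eq0 gt_eqF// ux.
have ext v : W0 Omega p s alpha H w v ->
    ((S `^ ((1 - delta - p) / (1 - delta)))%:E * singular_mass Omega delta f v `^ (p / (1 - delta))
       <= energy Omega p s alpha H w v)%E /\
    (((S `^ ((1 - delta - p) / (1 - delta)))%:E * singular_mass Omega delta f v `^ (p / (1 - delta)))%E
       = energy Omega p s alpha H w v -> exists k : R, {ae lebesgue_rV N, forall x, v x = k * u x}).
  move=> W0v; have [_ app_v ->] := W0_approximable hN0 oO halpha hp hH ww W0v.
  rewrite massE; last by have [[_ mv] _ _ _] := app_v.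
  exact: (extremal_ineq hN0 oO Oc halpha hp hH ww app_u F0 mF Fint weak On0 u_gt0 hdelta f0ge0
    mabs (fun=> erefl) S0 ES app_v).
set T := S `^ _ in ext; have T0 : 0 <= T by exact: powR_ge0.
(* Chosen so that c^(1-delta) S = 1: [c u] is admissible for [Theta], and its energy c^p S is
   exactly [T], so it attains the infimum and tests the best constant. *)
pose c := S `^ (- (1 - delta)^-1); have c0 : 0 < c by rewrite powR_gt0.
have [W0c Ec] := W0_Z hN0 oO halpha hp hH ww c W0u.
have mcu : measurable_fun setT (fun x => c * u x) by apply: measurable_funM => //; exact: mu_u.2.
have Mc : singular_mass Omega delta f (fun x => c * u x) = 1%E.
  rewrite massE// (massZ oO delta f0ge0 mabs c mu_u.2) Ms ES -EFinM (gtr0_norm c0); congr EFin.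
  by rewrite /c -powRrM mulNr mulVf ?gt_eqF// powR_inv1// mulVf// gt_eqF.
have ETc : energy Omega p s alpha H w (fun x => c * u x) = T%:E.
  rewrite Ec Eu ES -EFinM (gtr0_norm c0); congr EFin.
  rewrite /c /T -powRrM -[X in _ * X]powRr1// -powRD ?(gt_eqF S0) ?implybT//.
  by congr (_ `^ _); field; rewrite gt_eqF.
have ThetaE : Theta Omega p s alpha H w delta f = T%:E.
  apply/eqP; rewrite eq_le; apply/andP; split.
    (* [c u] cannot vanish a.e. because its mass is 1. *)
    apply: ereal_inf_lbound; exists (fun x => c * u x) => //; split => // uz.
    have := Mc; rewrite massE// (mass_ae0 oO hdelta mabs mcu uz) => /eqP.
    by rewrite eqe eq_sym oner_eq0.
  apply: le_ereal_inf_tmp => _ [v [W0v _ Mv] <-].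
  by have := (ext v W0v).1; rewrite Mv poweR1r mule1.
rewrite ThetaE; split.
- by rewrite Eu ES poweR_EFin.
- move=> C; split => [/(_ _ W0c)|CT v W0v].
    by rewrite Mc poweR1r mule1 ETc.
  apply: le_trans (ext v W0v).1; apply: lee_wpmul2r => //; exact: poweR_ge0.
- by move=> v W0v; exact: (ext v W0v).2.
Qed.
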